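(* For $d=2$ there are exactly $32$, and for $d=1$ exactly $41$, conjugacy classes of $\varrho$-maximal subgroups of the Weyl group $W(R_d)$. The values of $\alpha$ in these cases, sorted by Picard rank $\varrho$, are the following, where each listed number occurs for exactly one conjugacy class of $\varrho$-maximal subgroups of that Picard rank, except that a number followed by ''(twice)'' occurs for exactly two distinct classes. Degree $d=2$: $\varrho=1$: $1$. $\varrho=2$: $1$, $2$ (twice), $\frac73$, $3$ (twice), $4$. $\varrho=3$: $1$, $\frac53$, $\frac{11}6$, $2$, $\frac94$, $\frac52$, $\frac83$, $3$ (twice). $\varrho=4$: $\frac23$, $\frac{11}{12}$, $\frac{11}9$, $\frac{13}9$, $\frac{19}{12}$, $\frac53$, $2$. $\varrho=5$: $\frac{17}{36}$, $\frac23$, $\frac{13}{18}$, $1$. $\varrho=6$: $\frac7{30}$, $\frac{13}{45}$. $\varrho=7$: $\frac1{10}$. $\varrho=8$: $\frac1{30}$. Degree $d=1$: $\varrho=1$: $1$. $\varrho=2$: $2$, $4$ (twice), $\frac{16}3$, $6$, $7$, $8$, $10$. $\varrho=3$: $3$, $4$, $6$, $\frac{77}{12}$, $\frac{23}3$, $\frac{26}3$, $9$, $\frac{32}3$, $11$ (twice), $14$. $\varrho=4$: $4$, $\frac{35}6$, $\frac{20}3$, $\frac{31}4$, $\frac{85}9$, $\frac{92}9$, $\frac{31}3$, $13$. $\varrho=5$: $4$, $\frac{355}{72}$, $\frac{41}6$, $\frac{31}4$, $\frac{103}{12}$, $\frac{92}9$. $\varrho=6$: $\frac{178}{45}$, $\frac{16}3$,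 $\frac{94}{15}$. $\varrho=7$: $\frac{59}{20}$, $\frac{18}5$. $\varrho=8$: $\frac{29}{15}$. $\varrho=9$: $1$. In particular, for every smooth del Pezzo surface $S$ of degree $d\in\{1,2\}$ over a field $k$ with $S(k)\neq\emptyset$, the number $\alpha(S)$ is one of the values listed for degree $d$ and Picard rank $\varrho=\operatorname{rk}\operatorname{Pic}(S)$.
   Context: A del Pezzo surface $S$ over a field $k$ is a smooth projective surface over $k$ whose anticanonical class $-K_S$ is ample; its degree is $d=(-K_S,-K_S)$. Let $\overline{k}$ be an algebraic closure of $k$. A $(-1)$-curve is a curve $E$ on $S_{\overline{k}}$ with $(-K_S,[E])=1$, $([E],[E])=-1$. For $d\in\{1,2\}$ the lattice $\Lambda_d=\operatorname{Pic}(S_{\overline{k}})$ of rank $10-d$, with its intersection form $\langle\cdot,\cdot\rangle$, anticanonical class $-K$ and finite set of classes of $(-1)$-curves, depends up to isomorphism only on $d$: it is the lattice with basis $\ell,e_1,\dots,e_{9-d}$, orthogonal with $\langle \ell,\ell\rangle=1$, $\langle e_i,e_i\rangle=-1$, with $-K=3\ell-e_1-\dots-e_{9-d}$, and the classes of $(-1)$-curves are exactly the $E\in\Lambda_d$ with $\langle E,E\rangle=-1$, $\langle -K,E\rangle=1$. The elements $L \in \Lambda_d$ with $\langle -K,L\rangle=0$, $\langle L,L\rangle=-2$ form a root system $R_d$, of type $\mathbf{E}_7$ for $d=2$ and $\mathbf{E}_8$ for $d=1$; $W(R_d)$ is its Weyl group, acting on $\Lambda_d$ (and on the set of $(-1)$-classes)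 as the group of isometries fixing $-K$. For a surface $S$, $W(S)\subseteq W(R_d)$ denotes the image of $\operatorname{Gal}(\overline{k}/k)$ acting on $\operatorname{Pic}(S_{\overline{k}})\cong\Lambda_d$, well defined up to conjugacy. If $S(k)\neq\emptyset$, then $\operatorname{Pic}(S)=\Lambda_d^{W(S)}$. For a subgroup $G\subseteq W(R_d)$, its Picard rank is $\varrho=\operatorname{rk}\Lambda_d^G$. A subgroup $G\subseteq W(R_d)$ is called $\varrho$-maximal if it is the full pointwise stabilizer in $W(R_d)$ of $\Lambda_d^{G}$; equivalently, $G$ is maximal among the subgroups $G'$ of $W(R_d)$ containing $G$ with $\operatorname{rk}\Lambda_d^{G'}=\operatorname{rk}\Lambda_d^{G}$. The value of $\alpha$ for a subgroup $G$ with Picard rank $\varrho$: let $C_G\subset\Lambda_d^G\otimes\mathbb{R}$ be the cone generated by the sums $\sum_{E\in O}E$ over the $G$-orbits $O$ on the set of classes of $(-1)$-curves. Then $$\alpha=\varrho\cdot\operatorname{vol}\{\varphi\in\operatorname{Hom}(\Lambda_d^G,\mathbb{R}) \mid \varphi\ge 0\text{ on }C_G,\ \varphi(-K)\le 1\},$$ where the volume is normalized such that the lattice $\operatorname{Hom}(\Lambda_d^G,\mathbb{Z})$ has covolume $1$. For a del Pezzo surface $S$ with $\varrho(S)=\operatorname{rk}\operatorname{Pic}(S)$, $$\alpha(S)=\varrho(S)\cdot\operatorname{vol}\{x\in\Lambda_{\rm eff}^\vee(S)\mid\langle x,-K_S\rangle\le1\},$$ where $\Lambda_{\rm eff}(S)\subset\operatorname{Pic}(S)\otimes\mathbb{R}$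 is the effective cone (generated by classes of effective divisors), $\Lambda_{\rm eff}^\vee(S)$ its dual cone with respect to the intersection form, and the volume is normalized such that the lattice $\{x\in\operatorname{Pic}(S)\otimes\mathbb{R}\mid\langle x,y\rangle\in\mathbb{Z}\text{ for all }y\in\operatorname{Pic}(S)\}$ has covolume $1$. When $S(k)\neq\emptyset$, the cone $\Lambda_{\rm eff}(S)$ equals $C_{W(S)}$, so $\alpha(S)$ is the value of $\alpha$ for the subgroup $G=W(S)$. *)

(* Defs.v *)
From HB Require Import structures.
From mathcomp Require Import all_boot all_order all_algebra.
From mathcomp Require Import all_classical all_reals all_analysis.

Set Implicit Arguments.
Unset Strict Implicit.
Unset Printing Implicit Defensive.

Import Order.TTheory GRing.Theory Num.Theory.

Local Open Scope classical_set_scope.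
Local Open Scope ring_scope.

(** * The lattice Lambda_d *)

(* Row vectors in the basis l, e_1, ..., e_(9-d): coordinate 0 is that of l. *)
Notation Lambda d := 'rV[int]_((9 - d).+1).

Definition gram (A : comNzRingType) (n : nat) : 'M[A]_n.+1 :=
  diag_mx (\row_j (if j == ord0 then 1 else -1)).

Definition pairing (A : comNzRingType) (n : nat) (u v : 'rV[A]_n.+1) : A :=
  (u *m gram A n *m v^T) 0 0.

Definition antiK (d : nat) : Lambda d := \row_j (if j == ord0 then 3 else -1).

Definition minus_one_class (d : nat) : set (Lambda d) :=
  [set E | pairing E E = -1 /\ pairing (antiK d) E = 1].
Arguments minus_one_class : clear implicits.

Definition is_root (d : nat) : set (Lambda d) :=
  [set L | pairing (antiK d) L = 0 /\ pairing L L = -2].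
Arguments is_root : clear implicits.

(** * The Weyl group, acting on row vectors from the right *)

(* For <L, L> = -2 the reflection v - 2 <v, L> / <L, L> L is v + <v, L> L. *)
Definition reflection (d : nat) (L : Lambda d) : 'M[int]_((9 - d).+1) :=
  1%:M + gram int (9 - d) *m L^T *m L.

(* Reflections are involutions, so their products form the generated group. *)
Definition weyl (d : nat) : set 'M[int]_((9 - d).+1) :=
  [set w | exists2 s : seq (Lambda d),
     (forall L, L \in s -> is_root d L) & w = \prod_(L <- s) reflection L].
Arguments weyl : clear implicits.

Definition weyl_subgroup (d : nat) (G : set 'M[int]_((9 - d).+1)) : Prop :=
  [/\ G `<=` weyl d, G 1%:M,
      (forall g h, G g -> G h -> G (g *m h)) &
      (forall g, G g -> G (invmx g))].

Definition invariants (d : nat) (G : set 'M[int]_((9 - d).+1)) : set (Lambda d) :=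
  [set v | forall g, G g -> v *m g = v].

Definition rho_maximal (d : nat) (G : set 'M[int]_((9 - d).+1)) : Prop :=
  weyl_subgroup G /\
  G = [set w | weyl d w /\ forall v, invariants G v -> v *m w = v].

Definition conjugates (d : nat) (G : set 'M[int]_((9 - d).+1)) :
    set (set 'M[int]_((9 - d).+1)) :=
  [set [set w *m g *m invmx w | g in G] | w in weyl d].

Definition rho_maximal_classes (d : nat) :
    set (set (set 'M[int]_((9 - d).+1))) :=
  [set conjugates G | G in @rho_maximal d].
Arguments rho_maximal_classes : clear implicits.

(** * Real lattices and volumes *)

Definition toR (R : realType) (m n : nat) (A : 'M[int]_(m, n)) : 'M[R]_(m, n) :=
  map_mx intr A.
Arguments toR R {m n} A.

(* Linear combinations of elements of X with coefficients in P. *)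
Definition combinations (R : realType) (n : nat) (P : set R)
    (X : set 'rV[int]_n) : set 'rV[R]_n :=
  [set x | exists2 s : seq (R * 'rV[int]_n),
     (forall p, p \in s -> P p.1 /\ X p.2) &
     x = \sum_(p <- s) p.1 *: toR R p.2].

Definition cone (R : realType) (n : nat) (X : set 'rV[int]_n) : set 'rV[R]_n :=
  combinations [set c | 0 <= c] X.
Arguments cone R {n} X.

Definition real_span (R : realType) (n : nat) (X : set 'rV[int]_n) :
    set 'rV[R]_n := combinations setT X.
Arguments real_span R {n} X.

(* The rows of B are a Z-basis of the lattice M in R^n. *)
Definition lattice_basis (R : realType) (n : nat) (M : set 'rV[R]_n)
    (r : nat) (B : 'M[R]_(r, n)) : Prop :=
  row_free B /\ M = [set toR R c *m B | c in [set: 'rV[int]_r]].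

Definition lat_rank (R : realType) (n : nat) (M : set 'rV[R]_n) : nat :=
  xget 0%N [set r | exists B : 'M[R]_(r, n), lattice_basis M B].

Definition lat_basis (R : realType) (n : nat) (M : set 'rV[R]_n) :
    'M[R]_(lat_rank M, n) :=
  xget 0 [set B | lattice_basis M B].

(* Lebesgue measure on R^n, as the iterated product measure
   (vol_(n+1) A is the integral over t of vol_n of the section of A at t);
   in dimension 0 it is the Dirac mass. *)
Fixpoint vol (R : realType) (n : nat) : set 'rV[R]_n -> \bar R :=
  match n with
  | 0 => fun A => (\1_A 0)%:E
  | n'.+1 => fun A =>
      (\int[@lebesgue_measure R]_t
         vol [set v : 'rV[R]_n' | A (row_mx (t : R)%:M v : 'rV[R]_(1 + n'))])%E
  end.

(** * alpha of a subgroup of the Weyl group *)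

Definition orbit_sum (d : nat) (G : set 'M[int]_((9 - d).+1)) (E : Lambda d) :
    Lambda d :=
  \sum_(F \in [set E *m g | g in G]) F.

Definition orbit_cone (R : realType) (d : nat) (G : set 'M[int]_((9 - d).+1)) :
    set 'rV[R]_((9 - d).+1) :=
  cone R [set orbit_sum G E | E in minus_one_class d].
Arguments orbit_cone R {d} G.

Definition inv_lattice (R : realType) (d : nat) (G : set 'M[int]_((9 - d).+1)) :
    set 'rV[R]_((9 - d).+1) :=
  [set toR R v | v in invariants G].
Arguments inv_lattice R {d} G.

Definition picard_rank (R : realType) (d : nat) (G : set 'M[int]_((9 - d).+1)) :
    nat := lat_rank (inv_lattice R G).
Arguments picard_rank R {d} G.

(* A homomorphism phi from the invariant lattice to R is given by the row c of
   its values on the Z-basis B; its linear extension sends x *m B to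
   (x *m c^T) 0 0. The homomorphisms to Z become Z^rho, of covolume 1. *)
Definition alpha (R : realType) (d : nat) (G : set 'M[int]_((9 - d).+1)) :
    \bar R :=
  let B := lat_basis (inv_lattice R G) in
  ((picard_rank R G)%:R%:E *
   vol [set c : 'rV[R]_(picard_rank R G) |
     (forall x, orbit_cone R G (x *m B) -> (0 <= (x *m c^T) 0 0)%R) /\
     (forall x, x *m B = toR R (antiK d) -> ((x *m c^T) 0 0 <= 1)%R)])%E.
Arguments alpha R {d} G.

Definition alpha_values (d r : nat) : seq rat :=
  match d, r with
  | 2, 1 => [:: 1]
  | 2, 2 => [:: 1; 2; 2; 7 / 3; 3; 3; 4]
  | 2, 3 => [:: 1; 5 / 3; 11 / 6; 2; 9 / 4; 5 / 2; 8 / 3; 3; 3]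
  | 2, 4 => [:: 2 / 3; 11 / 12; 11 / 9; 13 / 9; 19 / 12; 5 / 3; 2]
  | 2, 5 => [:: 17 / 36; 2 / 3; 13 / 18; 1]
  | 2, 6 => [:: 7 / 30; 13 / 45]
  | 2, 7 => [:: 1 / 10]
  | 2, 8 => [:: 1 / 30]
  | 1, 1 => [:: 1]
  | 1, 2 => [:: 2; 4; 4; 16 / 3; 6; 7; 8; 10]
  | 1, 3 => [:: 3; 4; 6; 77 / 12; 23 / 3; 26 / 3; 9; 32 / 3; 11; 11; 14]
  | 1, 4 => [:: 4; 35 / 6; 20 / 3; 31 / 4; 85 / 9; 92 / 9; 31 / 3; 13]
  | 1, 5 => [:: 4; 355 / 72; 41 / 6; 31 / 4; 103 / 12; 92 / 9]
  | 1, 6 => [:: 178 / 45; 16 / 3; 94 / 15]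
  | 1, 7 => [:: 59 / 20; 18 / 5]
  | 1, 8 => [:: 29 / 15]
  | 1, 9 => [:: 1]
  | _, _ => [::]
  end.

Definition alpha_list (R : realType) (d r : nat) : seq (\bar R) :=
  [seq (ratr q)%:E | q <- alpha_values d r].

(** * Del Pezzo surfaces *)

(* For k -> K an algebraic closure, the group Gal(K/k). *)
Definition galois_group (k : fieldType) (K : closedFieldType)
    (iota : {rmorphism k -> K}) : set (K -> K) :=
  [set s | [/\ bijective s, exists f : {rmorphism K -> K}, s =1 f &
               forall a, s (iota a) = iota a]].

(* The Picard-theoretic data of a smooth del Pezzo surface S of degree d over k,
   Pic(S_kbar) being identified with Lambda_d: the Galois action on it (through
   W(R_d)), the subgroup Pic(S), the classes of effective divisors on S, and the
   set S(k). The last two fields are the standard descriptions of Pic(S) and of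
   the effective cone in the presence of a rational point. *)
Record delPezzo (R : realType) (k : fieldType) (d : nat) := DelPezzo {
  kbar : closedFieldType;
  kbar_emb : {rmorphism k -> kbar};
  kbar_algebraic : forall x : kbar,
    exists2 p : {poly k}, p != 0 & root (map_poly kbar_emb p) x;
  galois_act : (kbar -> kbar) -> 'M[int]_((9 - d).+1);
  galois_act_weyl : forall s, galois_group kbar_emb s -> weyl d (galois_act s);
  (* s is applied after t; matrices act on row vectors. *)
  galois_act_comp : forall s t, galois_group kbar_emb s ->
    galois_group kbar_emb t ->
    galois_act (s \o t) = galois_act t *m galois_act s;
  Pic : set (Lambda d);
  Pic_invariant :
    Pic `<=` invariants [set galois_act s | s in galois_group kbar_emb];
  effective_class : set (Lambda d);
  effective_class_Pic : effective_class `<=` Pic;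
  rational_point : Type;
  Pic_of_point : inhabited rational_point ->
    Pic = invariants [set galois_act s | s in galois_group kbar_emb];
  effective_cone_of_point : inhabited rational_point ->
    cone R effective_class =
      orbit_cone R [set galois_act s | s in galois_group kbar_emb]
}.

Section Surface.
Variables (R : realType) (k : fieldType) (d : nat) (S : delPezzo R k d).

Definition Pic_lattice : set 'rV[R]_((9 - d).+1) := [set toR R v | v in Pic S].

Definition surface_rank : nat := lat_rank Pic_lattice.

Definition dual_Pic_lattice : set 'rV[R]_((9 - d).+1) :=
  [set x | real_span R (Pic S) x /\
           forall y, Pic S y -> exists m : int, pairing x (toR R y) = m%:~R].

(* x = c *m B' runs through Pic(S) (x) R; the volume in the coordinates c is the
   one for which the lattice dual to Pic(S) has covolume 1. *)
Definition surface_alpha : \bar R :=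
  let B' := lat_basis dual_Pic_lattice in
  (surface_rank%:R%:E *
   vol [set c : 'rV[R]_(lat_rank dual_Pic_lattice) |
     (forall y, cone R (effective_class S) y ->
        (0 <= pairing (c *m B') y)%R) /\
     (pairing (c *m B') (toR R (antiK d)) <= 1)%R])%E.

End Surface.

(* Main.v *)
From mathcomp Require Import perm.
Require Import Defs.
From Stdlib Require Import ZArith Lia.
From Stdlib Require QArith_base Qreduction List.
From HB Require Import structures.
From mathcomp Require Import all_boot all_order all_algebra.
From mathcomp Require Import all_classical all_reals all_analysis.
From mathcomp Require Import measurable_realfun lebesgue_integral_fubini.
From mathcomp Require Import lra zify ssrZ.

(* A vector of Lambda^G lying on as few root hyperplanes as possible, moved into the dominant
   chamber, shows that Lambda^G is conjugate to the orthogonal complement of a set J of simple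
   roots; so a rho-maximal class is a set J up to conjugacy. The products w_J w_(J + i) of longest
   elements of parabolic subgroups connect all subsets J to 32, respectively 41, representatives,
   which rank, alpha and the number of roots orthogonal to Lambda^G tell apart.

   For a basis b of Lambda^G with Gram matrix Q, writing a functional as <-, y b> turns alpha into
   rk * |det Q| times the volume of {y | <E, y b> >= 0 for all (-1)-classes E, <-K, y b> <= 1};
   an orbit sum pairs with invariant vectors as a multiple of any of its members. The dual basis
   in the definition of alpha(S) gives the same polytope. The polytope is dissected into
   cones over facets from an apex, one facet per orbit of symmetries being treated, recursively
   down to simplicial cones; a simplicial cone with rays v_1, ..., v_r contributes
   |det v| / (r! <-K, v_1> ... <-K, v_r>). *)

Set Implicit Arguments.
Unset Strict Implicit.
Unset Printing Implicit Defensive.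

Import Order.TTheory GRing.Theory Num.Theory.
Import numFieldNormedType.Exports.

Local Open Scope classical_set_scope.
Local Open Scope ring_scope.

(** * Volume *)

(** A rho-maximal group is the pointwise stabilizer of its invariants, which turns the
    classification of groups into one of sublattices. Alpha also depends on the invariants alone,
    and this covers the Galois image of an arbitrary surface, maximal or not. Conjugacy is certified
    by explicit words: w_J takes J to -J and w_(J + i) takes J + i to its negative, so their product
    moves J into J + i. Non-conjugacy rests on numerical invariants, and the two together give the
    count. The facts about reflection groups come from dominance arguments over a finite list of
    properties of the positive roots, checked by evaluation. The polytopes have up to 240
    inequalities in dimension 9; one subtree serves a whole orbit of facets, and a symmetry group
    enters through generators only. As involutions these have determinant 1 or -1 without further
    computation. Since [vol] is an iterated integral over row vectors, its behaviour under linear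
    maps is obtained by elimination from Tonelli, translations and substitutions in one variable. *)

Section ProductSigmaFinite.
Local Open Scope ereal_scope.
Context d1 d2 (T1 : measurableType d1) (T2 : measurableType d2) (R : realType).
Variable m1 : {sigma_finite_measure set T1 -> \bar R}.
Variable m2 : {sigma_finite_measure set T2 -> \bar R}.

(** Rectangles on two exhausting sequences of finite measure exhaust the product. [euclid] iterates
    the product, so each stage has to be sigma-finite again. *)
Lemma product_measure1_sigma_finite : sigma_finite setT (m1 \x m2).
Proof.
have /sigma_finiteP[F [TF ndF Ffin]] := sigma_finiteT m1.
have /sigma_finiteP[G [TG ndG Gfin]] := sigma_finiteT m2.
exists (fun n => F n `*` G n) => [|n].
  apply/seteqP; split=> [[x y] _|//].
  have [[i _ Fx] [j _ Gy]] : (\bigcup_n F n) x /\ (\bigcup_n G n) y.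
    by rewrite -TF -TG.
  exists (maxn i j) => //; split.
    by move: x Fx; apply/subsetPset/ndF/leq_maxl.
  by move: y Gy; apply/subsetPset/ndG/leq_maxr.
have [[mF Fn] [mG Gn]] := (Ffin n, Gfin n).
split; first exact: measurableX.
by rewrite /= product_measure1E// lte_mul_pinfty// ge0_fin_numE.
Qed.

Definition product_sigma_finite : {sigma_finite_measure set (T1 * T2)%type -> \bar R} :=
  HB.pack_for {sigma_finite_measure set (T1 * T2)%type -> \bar R} (m1 \x m2)
    (Measure_isSigmaFinite.Build _ _ _ (m1 \x m2) product_measure1_sigma_finite).

End ProductSigmaFinite.

Section Volume.
Variable R : realType.
Notation leb := (@lebesgue_measure R).

(* [vol] integrates over the first coordinate, so measurability is tested on nested pairs,
   where the iterated product measure lives. *)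
Record mspace := MSpace {
  ms_d : measure_display;
  ms_T : measurableType ms_d;
  ms_mu : {sigma_finite_measure set ms_T -> \bar R} }.

Fixpoint euclid (n : nat) : mspace :=
  match n with
  | 0 => @MSpace _ unit (\d_tt)
  | n'.+1 => @MSpace _ (measurableTypeR R * ms_T (euclid n'))%type
               (@product_sigma_finite _ _ (measurableTypeR R) _ R leb (ms_mu (euclid n')))
  end.

Notation mu n := (ms_mu (euclid n)).

Fixpoint coord (n : nat) : ms_T (euclid n) -> 'rV[R]_n :=
  match n with
  | 0 => fun=> 0
  | n'.+1 => fun x => row_mx (x.1 : R)%:M (coord x.2) : 'rV[R]_(1 + n')
  end.

Fixpoint uncoord (n : nat) : 'rV[R]_n -> ms_T (euclid n) :=
  match n with
  | 0 => fun=> tt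
  | n'.+1 => fun v => ((v : 'rV_(1 + n')) 0 0, uncoord (rsubmx (v : 'rV[R]_(1 + n'))))
  end.

Lemma uncoordK n : cancel (@uncoord n) (@coord n).
Proof.
elim: n => [v|n IH v]; first by apply/rowP => -[].
rewrite /= IH; have -> : ((v : 'rV_(1 + n)) 0 0)%:M = lsubmx (v : 'rV_(1 + n)).
  apply/rowP => i; rewrite !mxE !ord1 eqxx mulr1n; congr (v _ _); exact: val_inj.
exact: (@hsubmxK _ 1 1 n).
Qed.

Definition vmeas n (A : set 'rV[R]_n) := measurable (@coord n @^-1` A).

Lemma vmeas_section n (A : set 'rV[R]_n.+1) (t : R) : vmeas A ->
  vmeas [set v : 'rV[R]_n | A (row_mx (t : R)%:M v : 'rV[R]_(1 + n))].
Proof. by move=> mA; rewrite /vmeas; have := measurable_xsection t mA; rewrite xsectionE. Qed.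

(** The product measure integrates the measures of sections, which is the recursion of [vol];
    through this identity [vol] inherits additivity and monotonicity on measurable sets. *)
Lemma volE n (A : set 'rV[R]_n) : vmeas A -> vol A = mu n (@coord n @^-1` A).
Proof.
elim: n A => [A _|n IH A mA] /=.
  by rewrite diracE indicE; congr (_%:R%:E); apply/idP/idP; rewrite !inE.
apply: eq_integral => t _ /=; rewrite IH; last exact: vmeas_section.
by rewrite xsectionE.
Qed.

Lemma measurable_vol_section n (A : set 'rV[R]_n.+1) : vmeas A ->
  @measurable_fun _ _ (measurableTypeR R) (\bar R) setT (fun t =>
    vol [set v : 'rV[R]_n | A (row_mx (t : R)%:M v : 'rV[R]_(1 + n))]).
Proof.
move=> mA; have := measurable_fun_xsection (mu n) mA.
congr (measurable_fun _ _); apply/funext => t /=.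
by rewrite volE ?xsectionE //; exact: vmeas_section.
Qed.

Lemma vol_ge0 n (A : set 'rV[R]_n) : (0 <= vol A)%E.
Proof. by elim: n A => [A|n IH A] /=; [rewrite lee_fin | apply: integral_ge0]. Qed.

Definition cmeas n (f : 'rV[R]_n -> R) :=
  measurable_fun [set: ms_T (euclid n)] (f \o @coord n : _ -> measurableTypeR R).

Lemma cmeas_coord n i : @cmeas n (fun v => v 0 i).
Proof.
rewrite /cmeas; elim: n i => [[]//|n IH i]; have [j ->|j ->] := split_ordP (i : 'I_(1 + n)).
  rewrite (_ : _ \o _ = fst); first exact: measurable_fst.
  by apply/funext => -[t x] /=; rewrite (row_mxEl _ _ 0 j) mxE ord1 eqxx mulr1n.
rewrite (_ : _ \o _ = ((fun v : 'rV_n => v 0 j) \o @coord n) \o snd).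
  by apply: measurableT_comp; [exact: IH|exact: measurable_snd].
by apply/funext => -[t x] /=; rewrite mxE (unsplitK (inr j)).
Qed.

Lemma measurable_to_coord d (T : measurableType d) n (f : T -> 'rV[R]_n) :
  (forall i, measurable_fun setT (fun x => f x 0 i : measurableTypeR R)) ->
  measurable_fun setT (@uncoord n \o f).
Proof.
elim: n f => [f _|n IH f mf] /=; first exact: measurable_cst.
apply/measurable_fun_pairP; split; first exact: mf.
rewrite (_ : _ \o _ = @uncoord n \o (fun x => rsubmx (f x : 'rV_(1 + n)))) //.
apply: IH => i; rewrite (_ : (fun _ => _) = (fun x => f x 0 (rshift 1 i))) //.
by apply/funext => x; rewrite mxE.
Qed.

(** The preimage is taken through nested pairs by means of [uncoord], and a map into nested pairs is
    measurable as soon as its coordinates are. *)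
Lemma vmeas_preimage m n (f : 'rV[R]_m -> 'rV[R]_n) (A : set 'rV[R]_n) :
  (forall i, cmeas (fun v => f v 0 i)) -> vmeas A -> vmeas (f @^-1` A).
Proof.
move=> mf mA; rewrite /vmeas.
rewrite (_ : _ @^-1` _ = (@uncoord n \o (f \o @coord m)) @^-1` (@coord n @^-1` A)).
  by rewrite -[X in measurable X]setTI; apply: (measurable_to_coord mf).
by apply/seteqP; split => x /=; rewrite uncoordK.
Qed.

Lemma cmeas_cst n (a : R) : @cmeas n (fun=> a).
Proof. exact: measurable_cst. Qed.

Lemma cmeas_lin n (f : 'rV[R]_n -> R) (a : 'I_n -> R) :
  (forall v, f v = \sum_j v 0 j * a j) -> cmeas f.
Proof.
move=> fE; rewrite /cmeas (_ : _ \o _ = fun x => \sum_(j <- index_enum 'I_n) coord x 0 j * a j).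
  apply: (@measurable_sum _ _ _ _ _ _ (fun j x => coord x 0 j * a j)) => j.
  by apply: measurable_funM; [exact: cmeas_coord|exact: measurable_cst].
by apply/funext => x /=; rewrite fE.
Qed.

Lemma cmeasD n (f g : 'rV[R]_n -> R) : cmeas f -> cmeas g -> cmeas (fun v => f v + g v).
Proof. by move=> mf mg; apply: (measurable_funD mf mg). Qed.

Lemma vmeas_mulmx m n (T : 'M[R]_(m, n)) (b : 'rV_n) (A : set 'rV[R]_n) :
  vmeas A -> vmeas [set v | A (v *m T + b)].
Proof.
apply: (@vmeas_preimage m n (fun v => v *m T + b)) => i.
rewrite (_ : (fun _ => _) = (fun v => (v *m T) 0 i + b 0 i)); last by apply/funext => v; rewrite mxE.
by apply: cmeasD; [apply: (@cmeas_lin _ _ (T^~ i)) => v; rewrite mxE | exact: cmeas_cst].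
Qed.

Lemma vmeas_le n (f g : 'rV[R]_n -> R) : cmeas f -> cmeas g -> vmeas [set v | f v <= g v].
Proof.
move=> mf mg; rewrite /vmeas.
have mT : measurable [set: ms_T (euclid n)] by exact: measurableT.
by have /(_ [set true] I) := measurable_fun_ler mf mg mT; rewrite setTI.
Qed.

Lemma vmeasI n (A B : set 'rV[R]_n) : vmeas A -> vmeas B -> vmeas (A `&` B).
Proof. exact: measurableI. Qed.

Lemma vmeasU n (A B : set 'rV[R]_n) : vmeas A -> vmeas B -> vmeas (A `|` B).
Proof. exact: measurableU. Qed.

Lemma vmeas0 n : vmeas (set0 : set 'rV[R]_n).
Proof. exact: measurable0. Qed.

Lemma vmeasT n : vmeas (setT : set 'rV[R]_n).
Proof. exact: measurableT. Qed.

Lemma volU n (A B : set 'rV[R]_n) : vmeas A -> vmeas B -> vol (A `&` B) = 0%E ->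
  vol (A `|` B) = (vol A + vol B)%E.
Proof.
move=> mA mB; have mU := vmeasU mA mB; have mI := vmeasI mA mB; rewrite !volE //.
rewrite preimage_setI preimage_setU.
set A' := coord (n:=n) @^-1` A; set B' := coord (n:=n) @^-1` B => AB0.
rewrite (_ : A' `|` B' = A' `|` (B' `\` A')); last by rewrite setUDr setDv setD0.
rewrite measureU //; last 2 first.
- exact: measurableD.
- by rewrite setDE setICA setICr setI0.
congr (_ + _)%E; rewrite [RHS](@measureDI _ _ _ (mu n) _ A') //.
rewrite [X in (_ + X)%E](_ : _ = 0%E) ?adde0 // setIC; exact: AB0.
Qed.

End Volume.

(** * Affine substitution on the real line *)

Section Affine.
Variable R : realType.
Notation leb := (@lebesgue_measure R).

Lemma measurable_affine (a b : R) :
  @measurable_fun _ _ (measurableTypeR R) (measurableTypeR R) setT (fun t : R => a * t + b).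
Proof. by apply: measurable_funD => //; apply: measurable_funM. Qed.

(** Lebesgue measure is [|a|] times its image under t -> a t + b, since the two agree on half-open
    intervals. *)
Lemma ge0_integral_affine (a b : R) (f : R -> \bar R) : a != 0 ->
  @measurable_fun _ _ (measurableTypeR R) _ setT f -> (forall t, (0 <= f t)%E) ->
  (\int[leb]_t f (a * t + b)%R = `|a|^-1%:E * \int[leb]_t f t)%E.
Proof.
move=> a0 mf f0; pose phi (t : R) : measurableTypeR R := a * t + b.
have mphi : @measurable_fun _ _ (measurableTypeR R) (measurableTypeR R) setT phi.
  exact: measurable_affine.
pose k := NngNum (normr_ge0 a).
pose pf : {measure set (measurableTypeR R) -> \bar R} :=
  measure_function_pushforward__canonical__measure_function_Measure leb mphi.
pose nu := mscale k pf.
have nuE A : measurable A -> leb A = nu A.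
  apply: lebesgue_measure_unique => _ [[x y] _ <-] /=.
  rewrite /nu /mscale /= /pushforward.
  (* A negative slope turns an interval closed on the right into one closed on the left, hence the
     two cases. *)
  rewrite (_ : phi @^-1` _ =
      [set` if 0 < a then `](x - b) / a, (y - b) / a] else `[(y - b) / a, (x - b) / a[]); last first.
    apply/seteqP; split => t; rewrite /phi /= in_itv /=.
      case: ifPn => [a_gt0|/negPf aN]; rewrite in_itv /=.
        by rewrite ltr_pdivrMr // ler_pdivlMr // ltrBlDr lerBrDr mulrC.
      have a_lt0 : a < 0 by rewrite lt_neqAle a0 leNgt aN.
      by rewrite ltr_ndivlMr // ler_ndivrMr // ltrBlDr lerBrDr mulrC andbC.
    case: ifPn => [a_gt0|/negPf aN]; rewrite in_itv /=.
      by rewrite ltr_pdivrMr // ler_pdivlMr // ltrBlDr lerBrDr mulrC.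
    have a_lt0 : a < 0 by rewrite lt_neqAle a0 leNgt aN.
    by rewrite ltr_ndivlMr // ler_ndivrMr // ltrBlDr lerBrDr mulrC andbC.
  case: ifPn => [a_gt0|/negPf aN]; rewrite !lebesgue_measure_itv /= !lte_fin.
    rewrite ltr_pdivrMr // divfK // ltrD2r; case: ifPn => // _; last by rewrite mule0.
    by rewrite -!EFinB -EFinM gtr0_norm // -mulrBl mulrC divfK //; congr _%:E; lra.
  have a_lt0 : a < 0 by rewrite lt_neqAle a0 leNgt aN.
  rewrite ltr_ndivrMr // divfK // ltrD2r; case: ifPn => // _; last by rewrite mule0.
  rewrite -!EFinB -EFinM ltr0_norm // -mulrBl mulNr mulrC divfK //.
  by congr _%:E; lra.
have -> : (\int[leb]_t f t = \int[nu]_t f t)%E.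
  by apply: eq_measure_integral => A mA _; exact: nuE.
rewrite ge0_integral_mscale // ge0_integral_pushforward //.
rewrite muleA -EFinM /= mulVf ?normr_eq0 // mul1e.
by [].
Qed.
End Affine.

(** * Linear change of variables *)

Section ChangeOfVariables.
Variable R : realType.
Notation leb := (@lebesgue_measure R).
Notation mu n := (ms_mu (euclid R n)).

Definition rcons0 n (t : R) (v : 'rV[R]_n) : 'rV[R]_n.+1 := row_mx t%:M v : 'rV_(1 + n).

Lemma rcons0_ord0 n t (v : 'rV_n) : rcons0 t v 0 ord0 = t.
Proof. by rewrite mxE; case: splitP => // j _; rewrite mxE ord1 eqxx mulr1n. Qed.

Lemma rcons0_lift n t (v : 'rV_n) j : rcons0 t v 0 (lift ord0 j) = v 0 j.
Proof.
rewrite mxE; case: splitP => [k|k /= E]; first by rewrite ord1.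
by congr (v _ _); apply: val_inj; move: E; rewrite /= /bump /= add1n => -[].
Qed.

Lemma volS n (A : set 'rV[R]_n.+1) :
  vol A = (\int[leb]_t vol [set v | A (rcons0 t v)])%E.
Proof. by []. Qed.

(** The first coordinate is moved by the substitution of slope 1, the others by induction on the
    sections. *)
Lemma vol_shift n (A : set 'rV[R]_n) (b : 'rV_n) : vmeas A ->
  vol [set v | A (v + b)] = vol A.
Proof.
elim: n A b => [A b _|n IH A b mA].
  congr (vol _); apply/seteqP; split => v /=; suff -> : v + b = v by [].
    by apply/rowP => -[].
  by apply/rowP => -[].
pose f (t : R) := vol [set v | A (rcons0 t v)].
have mf : @measurable_fun _ _ (measurableTypeR R) (\bar R) setT f.
  exact: measurable_vol_section.
rewrite !volS.
transitivity (\int[leb]_t f (1 * t + b 0 ord0)%R)%E.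
  apply: eq_integral => t _; rewrite mul1r /f -[RHS](IH _ (\row_j b 0 (lift ord0 j))).
    congr vol; apply/funext => v; congr (A _); apply/rowP => j.
    by rewrite mxE; case: (unliftP ord0 j) => [k|] ->;
       rewrite ?rcons0_ord0 ?rcons0_lift ?mxE.
  exact: vmeas_section.
rewrite ge0_integral_affine ?oner_neq0 //; last by move=> t; exact: vol_ge0.
by rewrite normr1 invr1 mul1e.
Qed.

(** [A] is pulled back along [T], hence the inverse determinant. In this form the property passes to
    products of matrices. *)
Definition volume_scales n (T : 'M[R]_n) := forall A, vmeas A ->
  vol [set v | A (v *m T)] = ((`|\det T|^-1)%R%:E * vol A)%E.

Lemma vmeas_mulmx0 m n (T : 'M[R]_(m, n)) (A : set 'rV[R]_n) :
  vmeas A -> vmeas [set v | A (v *m T)].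
Proof.
move=> /(vmeas_mulmx T 0); congr vmeas; apply/funext => v /=.
by rewrite addr0.
Qed.

Lemma volume_scales1 n : @volume_scales n 1%:M.
Proof.
move=> A mA; rewrite det1 normr1 invr1 mul1e; congr vol.
by apply/funext => v /=; rewrite mulmx1.
Qed.

Lemma volume_scalesM n (T U : 'M[R]_n) :
  volume_scales T -> volume_scales U -> volume_scales (T *m U).
Proof.
move=> hT hU A mA.
rewrite (_ : [set v | _] = [set v | [set u | A (u *m U)] (v *m T)]); last first.
  by apply/funext => v /=; rewrite mulmxA.
rewrite hT; last exact: vmeas_mulmx0.
by rewrite hU // muleA -EFinM det_mulmx normrM invfM.
Qed.

Definition ublock n (a : R) (b : 'rV[R]_n) (T : 'M[R]_n) : 'M[R]_n.+1 :=
  block_mx a%:M b 0 T : 'M[R]_(1 + n).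

Lemma det_ublock1 n a b (T : 'M[R]_n) : \det (ublock a b T) = a * \det T.
Proof. by rewrite -[in RHS](det_scalar1 a); exact: (@det_ublock _ 1 n). Qed.

Lemma mul_rcons0_ublock n t (v : 'rV_n) a b (T : 'M[R]_n) :
  rcons0 t v *m ublock a b T = rcons0 (t * a) (t *: b + v *m T).
Proof.
rewrite /rcons0 /ublock (@mul_row_block _ 1 1 n 1 n) mulmx0 addr0 -scalar_mxM.
by rewrite mul_scalar_mx.
Qed.

(** The section over t of the preimage is the section of [A] over a t, translated by t b and pulled
    back along [T]. Translations preserve volume, and the factor a is absorbed by a substitution in
    t. *)
Lemma volume_scales_ublock n a b (T : 'M[R]_n) : a != 0 ->
  volume_scales T -> volume_scales (ublock a b T).
Proof.
move=> a0 hT A mA; rewrite !volS.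
pose f (t : R) := vol [set v | A (rcons0 t v)].
have mf : @measurable_fun _ _ (measurableTypeR R) (\bar R) setT f.
  exact: measurable_vol_section.
transitivity (\int[leb]_t ((`|\det T|^-1)%R%:E * f (a * t + 0)%R))%E.
  apply: eq_integral => t _ /=.
  pose At := [set v | A (rcons0 (a * t) v)].
  have mAt : vmeas At by exact: vmeas_section.
  rewrite addr0 /f -/At -(@vol_shift _ At (t *: b)) // -hT.
    by congr vol; apply/funext => v /=; rewrite mul_rcons0_ublock mulrC addrC.
  have := vmeas_mulmx 1%:M (t *: b) mAt; congr vmeas.
  by apply/funext => v /=; rewrite mulmx1.
rewrite ge0_integralZl_EFin //; last 2 first.
- by move=> t _; exact: vol_ge0.
- by apply: (measurableT_comp mf); exact: measurable_affine.
rewrite ge0_integral_affine //; last by move=> t; exact: vol_ge0.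
by rewrite muleA -EFinM det_ublock1 normrM invfM [X in X%:E]mulrC.
Qed.

(** Tonelli for the two outermost integrals. *)
Lemma volume_scales_swap n :
  @volume_scales n.+2 (tperm_mx ord0 (lift ord0 ord0)).
Proof.
move=> A mA; rewrite det_perm odd_tperm /= expr1 normrN normr1 invr1 mul1e.
pose f (x : measurableTypeR R * measurableTypeR R) : \bar R :=
  vol [set w : 'rV[R]_n | A (rcons0 x.1 (rcons0 x.2 w))].
have mf : measurable_fun setT f.
  (* Regrouping the nested pairs makes the volume of a double section measurable jointly in both
     coordinates. *)
  pose g (x : (measurableTypeR R * measurableTypeR R) * ms_T (euclid R n)) :
    ms_T (euclid R n.+2) := (x.1.1, (x.1.2, x.2)).
  have mg : measurable_fun setT g.
    apply/measurable_fun_pairP; split.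
      exact: (measurableT_comp measurable_fst measurable_fst).
    apply/measurable_fun_pairP; split; last exact: measurable_snd.
    exact: (measurableT_comp measurable_snd measurable_fst).
  have mB : measurable (g @^-1` (@coord R n.+2 @^-1` A)).
    by have := mg measurableT _ mA; rewrite setTI.
  have := measurable_fun_xsection (mu n) mB.
  congr measurable_fun; apply/funext => -[s t] /=.
  rewrite /f volE /=; last by exact: vmeas_section (vmeas_section _ mA).
  by rewrite xsectionE.
have swapE s t (w : 'rV_n) : rcons0 s (rcons0 t w) *m tperm_mx ord0 (lift ord0 ord0)
    = rcons0 t (rcons0 s w).
  rewrite -xcolE; apply/rowP => j; rewrite mxE.
  case: (unliftP ord0 j) => [k ->|->]; last by rewrite tpermL rcons0_lift !rcons0_ord0.
  case: (unliftP ord0 k) => [l ->|->]; last by rewrite tpermR rcons0_lift !rcons0_ord0.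
  by rewrite tpermD ?rcons0_lift // -val_eqE.
have fub := @fubini_tonelli _ _ _ _ R leb leb f mf (fun x => vol_ge0 _).
refine (etrans _ (esym fub)).
rewrite /fubini_G.
apply: eq_integral => t _; apply: eq_integral => s _.
by congr vol; apply/funext => w /=; rewrite swapE.
Qed.

End ChangeOfVariables.

(** * Invertible linear maps by Gaussian elimination *)

Section GL.
Variable R : realType.

Section Step.
Variable n : nat.
Hypothesis IH : forall T : 'M[R]_n, T \in unitmx -> volume_scales T.

Let scales_ulblock (M : 'M[R]_n.+1) : M \in unitmx ->
  (forall i, M (lift ord0 i) ord0 = 0) -> volume_scales M.
Proof.
move=> uM M0.
have ME : M = ublock (M ord0 ord0) (ursubmx (M : 'M[R]_(1 + n)))
                     (drsubmx (M : 'M[R]_(1 + n))).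
  have E1 : ulsubmx (M : 'M[R]_(1 + n)) = (M ord0 ord0)%:M.
    by apply/matrixP => i j; rewrite !mxE !ord1 eqxx; congr (M _ _); apply: val_inj.
  have E2 : dlsubmx (M : 'M[R]_(1 + n)) = 0.
    by apply/matrixP => i j; rewrite !mxE ord1 -(M0 i); congr (M _ _); apply: val_inj.
  by rewrite /ublock -E1 -E2; exact: esym (@submxK _ 1 n 1 n M).
move: uM; rewrite unitmxE ME det_ublock1 unitrM => /andP[a0 uS].
by apply: volume_scales_ublock; [rewrite -unitfE | apply: IH; rewrite unitmxE].
Qed.

Let unit_perm m (s : 'S_m) : (perm_mx s : 'M[R]_m) \in unitmx.
Proof. exact: unitmx_perm. Qed.

Let scales_perm0 (s : 'S_n.+1) : s ord0 = ord0 -> volume_scales (perm_mx s : 'M[R]__).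
Proof.
move=> s0; apply: scales_ulblock => // i.
by rewrite mxE mxE -[X in _ == X]s0 (inj_eq perm_inj).
Qed.

Let tperm_mxK m (i j : 'I_m) : tperm_mx i j *m tperm_mx i j = 1%:M :> 'M[R]_m.
Proof. by rewrite -perm_mxM tperm2 perm_mx1. Qed.

(** The swap of the first two coordinates, conjugated by a transposition that fixes the first
    one. *)
Let scales_tperm (j : 'I_n) : volume_scales (tperm_mx ord0 (lift ord0 j) : 'M[R]_n.+1).
Proof.
case: n scales_perm0 j => [_ []//|m hp j].
case: (eqVneq j ord0) => [->|j0]; first exact: volume_scales_swap.
pose s := tperm (lift ord0 ord0) (lift ord0 j) : 'S_m.+2.
have s0 : s ord0 = ord0 by rewrite tpermD.
rewrite (_ : tperm_mx _ _ = perm_mx s *m tperm_mx ord0 (lift ord0 ord0) *m perm_mx s).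
  exact: volume_scalesM (volume_scalesM (hp s s0) (@volume_scales_swap R m)) (hp s s0).
rewrite -!perm_mxM; congr perm_mx.
by rewrite -[X in (X * _ * _)%g]tpermV -mulgA -/(conjg _ _) tpermJ s0 tpermL.
Qed.

(** A transposition makes the corner entry nonzero and a lower shear clears the column below it;
    what remains has the block form accessible to the induction hypothesis. *)
Lemma volume_scales_step (T : 'M[R]_n.+1) : T \in unitmx -> volume_scales T.
Proof.
have unit_tperm i j : (tperm_mx i j : 'M[R]_n.+1) \in unitmx by exact: unit_perm.
have lower (c : 'cV[R]_n) :
    volume_scales (block_mx 1%:M 0 c 1%:M : 'M[R]_(1 + n)).
  set L := block_mx _ _ _ _.
  have uL : L \in unitmx by rewrite unitmxE (@det_lblock _ 1 n) !det1 mulr1 unitr1.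
  case: n IH unit_tperm scales_ulblock scales_tperm c @L uL =>
      [_ _ _ _ c L uL|m _ uT hU hT c L uL].
    rewrite (_ : L = 1%:M); first exact: volume_scales1.
    by rewrite /L (_ : c = 0) -?(@scalar_mx_block _ 1 0) //; apply/matrixP => -[].
  have Lmax x : L x ord_max = (x == ord_max)%:R.
    have -> : ord_max = rshift 1 ord_max :> 'I_(1 + m.+1) by apply: val_inj.
    case: (split_ordP (x : 'I_(1 + m.+1))) => k ->.
      by rewrite block_mxEur mxE eq_lrshift.
    by rewrite block_mxEdr mxE eq_rshift.
  pose X : 'M[R]_m.+2 := tperm_mx ord0 (lift ord0 ord_max).
  have maxE : ord_max = lift ord0 ord_max :> 'I_m.+2 by apply: val_inj.
  (* The last column of a lower shear is a unit vector, so exchanging the first and last coordinates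
     makes the first column vanish below the corner. *)
  rewrite (_ : L = X *m (X *m L *m X) *m X); last first.
    by rewrite !mulmxA tperm_mxK mul1mx -mulmxA tperm_mxK mulmx1.
  suff hB : volume_scales (X *m L *m X).
    exact: volume_scalesM (volume_scalesM (hT ord_max) hB) (hT ord_max).
  apply: hU => [|i]; first by rewrite !unitmx_mul uL !uT.
  rewrite -xcolE -xrowE mxE mxE tpermL -maxE Lmax -[X in _ == X](tpermL ord0 ord_max).
  by rewrite (inj_eq perm_inj).
have pivot (M : 'M[R]_n.+1) : M \in unitmx -> M ord0 ord0 != 0 -> volume_scales M.
  move=> uM a0; pose a := M ord0 ord0.
  pose c := a^-1 *: dlsubmx (M : 'M[R]_(1 + n)).
  pose L := block_mx 1%:M 0 (- c) 1%:M : 'M[R]_(1 + n).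
  pose L' := block_mx 1%:M 0 c 1%:M : 'M[R]_(1 + n).
  have uL : L \in unitmx by rewrite unitmxE (@det_lblock _ 1 n) !det1 mulr1 unitr1.
  have LL : L' *m L = 1%:M.
    rewrite (@mulmx_block _ 1 n 1 n 1 n) !mulmx0 !mul0mx !mulmx1 !mul1mx !addr0 subrr add0r.
    by rewrite -scalar_mx_block.
  rewrite -[M]mul1mx -LL -mulmxA; apply: volume_scalesM; first exact: lower.
  apply: scales_ulblock => [|i]; first by rewrite unitmx_mul uL.
  rewrite -[M in L *m M](@submxK _ 1 n 1 n) (@mulmx_block _ 1 n 1 n 1 n).
  have E1 : ulsubmx (M : 'M[R]_(1 + n)) = a%:M.
    by apply/matrixP => k j; rewrite !mxE !ord1 eqxx; congr (M _ _); apply: val_inj.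
  have -> : lift ord0 i = rshift 1 i by apply: val_inj.
  have -> : ord0 = lshift n ord0 :> 'I_(1 + n) by apply: val_inj.
  rewrite (@block_mxEdl _ 1 n 1 n) E1 mulNmx mul_mx_scalar mul1mx /c scalerA mulfV // scale1r.
  by rewrite addNr mxE.
move=> uT; have [T0|/existsNP[i Ti]] := pselect (forall i, T i ord0 = 0).
  suff : \det T = 0 by move: uT; rewrite unitmxE unitfE => /eqP.
  by rewrite (expand_det_col _ ord0) big1 // => i _; rewrite T0 mul0r.
case: (unliftP ord0 i) Ti => [j ->|-> /eqP]; last exact: pivot.
move=> /eqP Tj; rewrite -[T]mul1mx -(tperm_mxK ord0 (lift ord0 j)) -mulmxA.
apply: volume_scalesM; first exact: scales_tperm.
apply: pivot; first by rewrite unitmx_mul unit_tperm.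
by rewrite -xrowE mxE tpermL.
Qed.

End Step.

Theorem volume_scales_unit n (T : 'M[R]_n) : T \in unitmx -> volume_scales T.
Proof.
elim: n T => [T _ A mA|n IH]; last exact: volume_scales_step.
rewrite det_mx00 normr1 invr1 mul1e; congr vol; apply/funext => v /=.
by congr (A _); apply/rowP => -[].
Qed.
End GL.

(** * Hyperplanes and standard simplices *)

Section Simplex.
Variable R : realType.
Notation leb := (@lebesgue_measure R).

Lemma vol_set0 n : vol (set0 : set 'rV[R]_n) = 0%E.
Proof. by rewrite volE ?preimage_set0 ?measure0 //; exact: vmeas0. Qed.

Lemma dot_rcons0 n t (v : 'rV[R]_n) (h : 'rV_n.+1) :
  \sum_j rcons0 t v 0 j * h 0 j = t * h 0 ord0 + \sum_j v 0 j * h 0 (lift ord0 j).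
Proof.
rewrite big_ord_recl rcons0_ord0; congr (_ + _).
by apply: eq_bigr => j _; rewrite rcons0_lift.
Qed.

(** A section is a hyperplane in the remaining coordinates. If all their coefficients vanish, the
    sections are empty for every t but one. *)
Lemma vol_hyperplane n (h : 'rV[R]_n) (b : R) : h != 0 ->
  vol [set v : 'rV_n | \sum_j v 0 j * h 0 j = b] = 0%E.
Proof.
elim: n h b => [h b|n IH h b h0]; first by case/eqP; apply/rowP => -[].
rewrite volS; pose h' := \row_j h 0 (lift ord0 j).
have sec t : [set v | [set v : 'rV_n.+1 | \sum_j v 0 j * h 0 j = b] (rcons0 t v)]
    = [set v | \sum_j v 0 j * h' 0 j = b - t * h 0 ord0].
  apply/seteqP; split => v /=; rewrite dot_rcons0 => E.
    rewrite -E addrC addKr; apply: eq_bigr => j _; by rewrite mxE.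
  suff -> : \sum_j v 0 j * h 0 (lift ord0 j) = b - t * h 0 ord0 by rewrite addrC subrK.
  by rewrite -E; apply: eq_bigr => j _; rewrite mxE.
have [h'0|h'0] := eqVneq h' 0; last first.
  by apply: integral0_eq => t _; rewrite sec IH.
have h00 : h 0 ord0 != 0.
  apply: contraNneq h0 => h00; apply/eqP/rowP => j; rewrite [RHS]mxE.
  case: (unliftP ord0 j) => [k|] -> //.
  by have /rowP/(_ k) := h'0; rewrite !mxE.
rewrite -[RHS](integral_set1 (fun t =>
  vol [set v | [set v : 'rV_n.+1 | \sum_j v 0 j * h 0 j = b] (rcons0 t v)]) (b / h 0 ord0)).
rewrite [RHS]integral_mkcond; apply: eq_integral => t _; rewrite patchE.
case: ifPn => // tb; rewrite sec.
rewrite (_ : [set v | _] = set0) ?vol_set0 //; apply/seteqP; split => // v /=.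
rewrite h'0 big1 => [E|j _]; last by rewrite mxE mulr0.
by move/negP: tb; apply; rewrite inE /=; apply: (canRL (mulfK h00)); apply/eqP;
   rewrite eq_sym -subr_eq0 -E.
Qed.

Lemma integral_pow n (s : R) : 0 <= s ->
  (\int[leb]_(t in `[0%R, s]) (n.+1%:R * t ^+ n)%R%:E = (s ^+ n.+1)%:E)%E.
Proof.
rewrite le_eqVlt => /predU1P[<-|s0].
  by rewrite set_itv1 integral_set1 expr0n.
rewrite (@continuous_FTC2 _ (fun t : R => n.+1%:R * t ^+ n) (fun x => x ^+ n.+1)) //.
- by rewrite expr0n sube0.
- apply/continuous_subspaceT => x.
  by apply: cvgM; [exact: cvg_cst|exact: exprn_continuous].
- split.
  + by move=> x x01; exact: exprn_derivable.
  + exact/cvg_at_right_filter/exprn_continuous.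
  + exact/cvg_at_left_filter/exprn_continuous.
- by move=> x x01; rewrite derive1E exp_derive scaler1.
Qed.

Definition corner n (s : R) : set 'rV[R]_n :=
  [set v | (forall j, 0 <= v 0 j) /\ \sum_j v 0 j <= s].

Lemma vmeas_all n (I : eqType) (s : seq I) (P : I -> set 'rV[R]_n) :
  (forall i, i \in s -> vmeas (P i)) -> vmeas [set v | forall i, i \in s -> P i v].
Proof.
elim: s => [_|i s IH mP].
  by rewrite (_ : [set _ | _] = setT); [exact: vmeasT | apply/seteqP; split].
rewrite (_ : [set _ | _] = P i `&` [set v | forall j, j \in s -> P j v]).
  apply: vmeasI; first by apply: mP; exact: mem_head.
  by apply: IH => j js; apply: mP; rewrite inE js orbT.
apply/seteqP; split=> [v h|v [hi hs] j].
  by split=> [|j js]; apply: h; rewrite inE ?eqxx ?js ?orbT.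
by rewrite inE => /predU1P[->|/hs].
Qed.

Lemma vmeas_corner n s : vmeas (@corner n s).
Proof.
apply: vmeasI; last first.
  apply: vmeas_le; last exact: cmeas_cst.
  by apply: (@cmeas_lin _ _ _ (fun=> 1)) => v; apply: eq_bigr => j _; rewrite mulr1.
have mj j : vmeas [set v : 'rV[R]_n | 0 <= v 0 j].
  by apply: vmeas_le; [exact: cmeas_cst | exact: cmeas_coord].
rewrite (_ : (fun v => _) =
    [set v : 'rV[R]_n | forall j, j \in index_enum 'I_n -> 0 <= v 0 j]).
  by apply: vmeas_all => j _; exact: mj.
by apply/seteqP; split => [v h j _|v h j]; apply: h; rewrite mem_index_enum.
Qed.

(** The section over t of a corner of size s is a corner of size s - t; with u = s - t the volume is
    the integral of u^n / n! over [0, s]. *)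
Lemma vol_corner n (s : R) : 0 <= s -> vol (@corner n s) = (s ^+ n / n`!%:R)%:E.
Proof.
elim: n s => [s s0|n IH s s0].
  rewrite expr0 fact0 divr1 /= indicE mem_set //; split; first by case.
  by rewrite big_ord0.
rewrite volS.
have sec t : [set v | @corner n.+1 s (rcons0 t v)] =
    if 0 <= t then @corner n (s - t) else set0.
  apply/seteqP; split => v.
    move=> [h1 h2]; have := h1 ord0; rewrite rcons0_ord0 => ->; split => [j|].
      by have := h1 (lift ord0 j); rewrite rcons0_lift.
    move: h2; rewrite big_ord_recl rcons0_ord0 addrC -lerBrDr.
    by under eq_bigr do rewrite rcons0_lift.
  case: ifP => // t0 [h1 h2]; split=> [j|].
    by case: (unliftP ord0 j) => [k|] ->; rewrite ?rcons0_lift ?rcons0_ord0.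
  rewrite big_ord_recl rcons0_ord0 addrC -lerBrDr.
  by under eq_bigr do rewrite rcons0_lift.
pose g (u : R) : \bar R := if (0 <= u) && (u <= s) then (u ^+ n / n`!%:R)%:E else 0%E.
transitivity (\int[leb]_t g (- 1 * t + s)%R)%E.
  apply: eq_integral => t _; rewrite sec /g mulN1r [- _ + s]addrC subr_ge0 gerBl.
  have [t0|t0] := leP 0 t; last by rewrite andbF vol_set0.
  rewrite andbT; have [ts|ts] := leP t s; first by rewrite IH // subr_ge0.
  rewrite (_ : @corner n (s - t) = set0) ?vol_set0 //; apply/seteqP; split => // v [h1 h2].
  by have := le_trans (sumr_ge0 _ (fun j _ => h1 j)) h2; rewrite subr_ge0 leNgt ts.
have gE : g = (fun u : R => (n.+1%:R * u ^+ n * n.+1`!%:R^-1)%:E) \_ `[0, s].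
  apply/funext => u; rewrite patchE /g mem_setE in_itv /=; case: ifP => // _.
  rewrite factS natrM invfM; congr _%:E.
  by rewrite mulrACA mulfV ?mul1r // pnatr_eq0.
rewrite (@ge0_integral_affine R (-1) s g) ?oppr_eq0 ?oner_neq0 //; last 2 first.
- rewrite gE; apply: (measurable_restrictT _ _).1 => //.
  apply/measurable_EFinP; apply: measurable_funM => //; apply: measurable_funM => //.
- move=> t; rewrite /g; case: ifP => // /andP[t0 _].
  by rewrite lee_fin mulr_ge0 ?exprn_ge0 // invr_ge0.
rewrite normrN normr1 invr1 mul1e gE -integral_mkcond.
under eq_integral do rewrite EFinM.
rewrite ge0_integralZr //.
- by rewrite integral_pow // -EFinM.
- by apply/measurable_EFinP; apply: measurable_funM.
- move=> t; rewrite /= in_itv /= => /andP[t0 _].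
  by rewrite lee_fin mulr_ge0 ?exprn_ge0.
Qed.

End Simplex.

(** * Integer and rational computations *)

Notation vecZ := (seq Z).
Notation matZ := (seq (seq Z)).

Fixpoint dotz (a b : vecZ) : Z :=
  match a, b with
  | x :: a', y :: b' => Z.add (Z.mul x y) (dotz a' b')
  | _, _ => Z0
  end.

(** The shorter list counts as padded by zeros, in accordance with the default value of [nth] in
    [vecz]. *)
Fixpoint subz (a b : vecZ) : vecZ :=
  match a, b with
  | x :: a', y :: b' => Z.sub x y :: subz a' b'
  | _, [::] => a
  | [::], _ => map Z.opp b
  end.

Definition scalez (m : Z) (a : vecZ) : vecZ := map (Z.mul m) a.

(* [cols] lists the columns of the matrix. *)
Definition vmz (a : vecZ) (cols : matZ) : vecZ := map (dotz a) cols.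

(** [if] in place of [&&] lets call-by-value evaluation stop at the first difference. *)
Fixpoint eqvz (a b : vecZ) : bool :=
  match a, b with
  | x :: a', y :: b' => if Z.eqb x y then eqvz a' b' else false
  | [::], [::] => true
  | _, _ => false
  end.

Fixpoint memz (a : vecZ) (A : matZ) : bool :=
  match A with
  | b :: A' => if eqvz a b then true else memz a A'
  | [::] => false
  end.

Fixpoint uniqz (A : matZ) : bool :=
  match A with
  | a :: A' => if memz a A' then false else uniqz A'
  | [::] => true
  end.

Lemma eqvzE a b : eqvz a b = (a == b).
Proof.
elim: a b => [|x a IH] [|y b] //=; rewrite eqseq_cons -IH -[x == y]/(Z.eqb x y).
by case: Z.eqb.
Qed.

Lemma memzE a A : memz a A = (a \in A).
Proof. by elim: A => //= b A ->; rewrite inE eqvzE; case: eqP. Qed.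

Lemma uniqzE A : uniqz A = uniq A.
Proof. by elim: A => //= a A ->; rewrite memzE; case: (_ \in _). Qed.

Section Cast.
Variable A : nzRingType.

Definition zr (z : Z) : A := (int_of_Z z)%:~R.

Lemma zr0 : zr Z0 = 0. Proof. by []. Qed.
Lemma zr1 : zr (Zpos xH) = 1. Proof. by []. Qed.
Lemma zrD a b : zr (Z.add a b) = zr a + zr b.
Proof. by rewrite /zr -rmorphD -rmorphD. Qed.
Lemma zrN a : zr (Z.opp a) = - zr a.
Proof. by rewrite /zr -rmorphN -rmorphN. Qed.
Lemma zrB a b : zr (Z.sub a b) = zr a - zr b.
Proof. by rewrite /Z.sub zrD zrN. Qed.
Lemma zrM a b : zr (Z.mul a b) = zr a * zr b.
Proof. by rewrite /zr -rmorphM -rmorphM. Qed.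

Definition vecz n (a : vecZ) : 'rV[A]_n := \row_j zr (nth Z0 a j).

Definition mxz m n (L : matZ) : 'M[A]_(m, n) :=
  \matrix_(i, j) zr (nth Z0 (nth [::] L i) j).

Lemma nth_subz a b j : nth Z0 (subz a b) j = Z.sub (nth Z0 a j) (nth Z0 b j).
Proof.
elim: a b j => [|x a IH] [|y b] [|j] //=; rewrite ?nth_nil ?Z.sub_0_r //.
by elim: b j => [|z b IHb] [|j] //=; rewrite ?nth_nil.
Qed.

Lemma nth_scalez m a j : nth Z0 (scalez m a) j = Z.mul m (nth Z0 a j).
Proof. by elim: a j => [|x a IH] [|j] //=; rewrite ?nth_nil ?Z.mul_0_r. Qed.

Lemma size_scalez m a : size (scalez m a) = size a.
Proof. exact: size_map. Qed.

End Cast.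

Lemma zr_dotz (A : comNzRingType) n a b : (size a <= n)%N ->
  zr A (dotz a b) = \sum_(j < n) zr A (nth Z0 a j) * zr A (nth Z0 b j).
Proof.
elim: a b n => [|x a IH] b n; first by move=> _; rewrite big1 // => j _; rewrite ?nth_nil zr0 mul0r.
case: n => // n; rewrite ltnS => sa; rewrite big_ord_recl.
case: b => [|y b] /=; first by rewrite mulr0 add0r big1 // => j _; rewrite ?nth_nil zr0 mulr0.
by rewrite zrD zrM (IH _ n).
Qed.

Lemma dotzC a b : dotz a b = dotz b a.
Proof. by elim: a b => [|x a IH] [|y b] //=; rewrite IH Z.mul_comm. Qed.

Lemma zr_eq (a b : Z) : zr int a = zr int b -> a = b.
Proof. by rewrite /zr !intz => /(can_inj int_of_ZK). Qed.

Section CastNum.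
Variable F : numDomainType.

Lemma zr_inj : injective (zr F).
Proof. by move=> a b /intr_inj /(can_inj int_of_ZK). Qed.

Lemma zr_ge0 a : (0 <= zr F a) = Z.leb 0 a.
Proof. by rewrite ler0z; case: a => //= p; case: (Pos.to_nat p). Qed.

Lemma zr_gt0 a : (0 < zr F a) = Z.ltb 0 a.
Proof.
rewrite ltr0z; case: a => //= p; first by have := Pos2Nat.is_pos p; case: (Pos.to_nat p) => // H; inversion H.
Qed.

Lemma vecz_inj n a b : size a = n -> size b = n -> vecz F n a = vecz F n b -> a = b.
Proof.
move=> sa sb E; apply: (@eq_from_nth _ Z0); rewrite sa // => j jn.
by have /rowP/(_ (Ordinal jn)) := E; rewrite !mxE => /zr_inj.
Qed.

End CastNum.

Notation Q := QArith_base.Q.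
Notation Qmake := QArith_base.Qmake.
(** Reducing after every operation keeps the fractions small and puts results in normal form, so
    that they can be compared with literals by plain equality. *)
Definition qadd (p q : Q) : Q := Qreduction.Qred (QArith_base.Qplus p q).
Definition qmul (p q : Q) : Q := Qreduction.Qred (QArith_base.Qmult p q).
Definition qopp (p : Q) : Q := QArith_base.Qopp p.
Definition qinv (p : Q) : Q := QArith_base.Qinv p.
Definition qz (z : Z) : Q := Qmake z xH.
Definition eq0q (p : Q) : bool := Z.eqb (QArith_base.Qnum p) Z0.
Definition qabs (p : Q) : Q := Qmake (Z.abs (QArith_base.Qnum p)) (QArith_base.Qden p).

Section CastQ.
Variable F : numFieldType.

Definition qr (q : Q) : F := zr F (QArith_base.Qnum q) / zr F (Zpos (QArith_base.Qden q)).

Lemma zr_pos_neq0 p : zr F (Zpos p) != 0.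
Proof. by rewrite gt_eqF // zr_gt0. Qed.

Lemma qr_eq p q : QArith_base.Qeq p q -> qr p = qr q.
Proof.
move=> E; apply/eqP; rewrite /qr eqr_div ?zr_pos_neq0 // -!zrM; apply/eqP; exact: congr1 E.
Qed.

Lemma qr_red p : qr (Qreduction.Qred p) = qr p.
Proof. exact/qr_eq/Qreduction.Qred_correct. Qed.

Lemma qrD p q : qr (qadd p q) = qr p + qr q.
Proof.
rewrite /qadd qr_red /qr /= addf_div ?zr_pos_neq0 //.
by rewrite -!zrM -zrD.
Qed.

Lemma qrM p q : qr (qmul p q) = qr p * qr q.
Proof. by rewrite /qmul qr_red /qr /= mulf_div -!zrM. Qed.

Lemma qrN p : qr (qopp p) = - qr p.
Proof. by rewrite /qr /= zrN mulNr. Qed.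

Lemma qr_qz z : qr (qz z) = zr F z.
Proof. by rewrite /qr divr1. Qed.

Lemma qrV p : qr (qinv p) = (qr p)^-1.
Proof.
case: p => [[|n|n] d]; rewrite /qr /= ?mul0r ?invr0 ?invf_div //.
by rewrite -[Zneg n]/(Z.opp (Zpos n)) -[Zneg d]/(Z.opp (Zpos d)) !zrN invrN mulrN mulNr.
Qed.

Lemma qr_eq0 p : eq0q p -> qr p = 0.
Proof. by move=> /Z.eqb_spec E; rewrite /qr E mul0r. Qed.

Lemma eq0qF p : eq0q p = false -> qr p != 0.
Proof.
move=> /Z.eqb_neq E; rewrite mulf_neq0 ?invr_eq0 ?zr_pos_neq0 //.
by apply/eqP => /(@zr_inj F _ Z0).
Qed.
End CastQ.

Lemma qr_abs (F : numFieldType) p : qr F (qabs p) = `|qr F p|.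
Proof.
rewrite /qr normf_div [`|zr F (Zpos _)|]gtr0_norm ?zr_gt0 //; congr (_ / _).
case: p => [[|n|n] d] /=; [by rewrite normr0|by rewrite gtr0_norm ?zr_gt0|].
by rewrite (_ : Zneg n = Z.opp (Zpos n)) // zrN normrN gtr0_norm ?zr_gt0.
Qed.

Fixpoint qsub (a b : seq Q) : seq Q :=
  match a, b with
  | x :: a', y :: b' => qadd x (qopp y) :: qsub a' b'
  | _, _ => [::]
  end.

(* Gaussian elimination without pivoting; the result 0 is also returned when a pivot vanishes. *)
Fixpoint detq (n : nat) (L : seq (seq Q)) : Q :=
  match n with
  | 0 => qz (Zpos xH)
  | n'.+1 =>
    match L with
    | (p :: row) :: rest =>
        if eq0q p then qz Z0
        else qmul p (detq n' (map (fun r =>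
               match r with
               | c :: r' => let m := qmul c (qinv p) in qsub r' (map (qmul m) row)
               | [::] => [::]
               end) rest))
    | _ => qz Z0
    end
  end.

Definition mxq (F : numFieldType) n (L : seq (seq Q)) : 'M[F]_n :=
  \matrix_(i, j) qr F (nth (qz Z0) (nth [::] L i) j).

(** The matrix on the right is the Schur complement of the corner; a lower shear of determinant 1
    clears the first column. *)
Lemma det_pivot (F : fieldType) n (M : 'M[F]_n.+1) : M ord0 ord0 != 0 ->
  \det M = M ord0 ord0 * \det (\matrix_(i, j)
    (M (lift ord0 i) (lift ord0 j) - M (lift ord0 i) ord0 / M ord0 ord0 * M ord0 (lift ord0 j))).
Proof.
move=> a0; pose a := M ord0 ord0.
pose L : 'M[F]_(1 + n) := block_mx 1%:M 0 (- (a^-1 *: dlsubmx (M : 'M[F]_(1 + n)))) 1%:M.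
have dL : \det L = 1 by rewrite (@det_lblock _ 1 n) !det1 mulr1.
have E1 : ulsubmx (M : 'M[F]_(1 + n)) = a%:M.
  by apply/matrixP => k j; rewrite !mxE !ord1 eqxx; congr (M _ _); apply: val_inj.
rewrite -[LHS]mul1r -dL -det_mulmx -[M in L *m M](@submxK _ 1 n 1 n).
rewrite (@mulmx_block _ 1 n 1 n 1 n) E1 !mul0mx !mul1mx !addr0.
rewrite mulNmx mul_mx_scalar scalerA mulfV // scale1r addNr.
rewrite [LHS](@det_ublock _ 1 n) det_scalar1; congr (_ * \det _).
apply/matrixP => i j; rewrite !mxE big_ord1 !mxE addrC mulNr.
have -> : rshift 1 i = lift ord0 i by apply: val_inj.
have -> : rshift 1 j = lift ord0 j by apply: val_inj.
have -> : lshift n (0 : 'I_1) = ord0 by apply: val_inj.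
by rewrite [a^-1 * _]mulrC.
Qed.

(** A computed 0 may stem from a vanishing pivot and is excluded; a nonzero result forces nonzero
    pivots all the way down the recursion. *)
Lemma det_mxq (F : numFieldType) n L : size L = n -> all (fun r => size r == n) L ->
  eq0q (detq n L) = false -> \det (mxq F n L) = qr F (detq n L).
Proof.
elim: n L => [|n IH] L sL aL; first by rewrite det_mx00 qr_qz.
case: L sL aL => [|[|p row] rest] //= [sr] /andP[/eqP[srow] arest].
case p0: (eq0q p) => //= dn.
have pn0 := eq0qF F p0.
rewrite det_pivot; last by rewrite mxE.
rewrite mxE /= qrM; congr (_ * _).
rewrite -IH ?size_map //.
- congr (\det _); apply/matrixP => i j; rewrite !mxE /=.
  rewrite (nth_map [::]) ?sr //.
  have := all_nthP [::] arest i; rewrite sr ltn_ord => /(_ isT).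
  case: (nth [::] rest i) => // c r /eqP[sz] /=.
  rewrite -qrV -qrM; set m := qmul c _.
  have jn := ltn_ord j; move: {+}(j : nat) jn => {}j.
  clear -sz srow; elim: r row n sz srow j => [|x r IHr] [|y row] [|n] //= [sz] [srow] [|j] // jn.
    by rewrite qrD qrN qrM.
  exact: (IHr row n).
- rewrite all_map; apply: sub_all arest => -[//|c r] /eqP[sz] /=; set m := qmul c _; apply/eqP.
  clear -sz srow; elim: r row n sz srow => [|x r IHr] [|y row] [|n] //= [sz] [srow].
  by rewrite (IHr row n).
- move: dn; set d := detq _ _; case E: (eq0q d) => // dn.
  by have := eq0qF F dn; rewrite qrM (qr_eq0 F E) mulr0 eqxx.
Qed.

(** * Volumes of polytopes by symmetric dissection *)

(* A certificate for the volume of the polytope given by a y >= 0 (a in A) and k y <= 1.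
   A leaf lists the rays of a simplicial cone. A node lists involutions preserving A and k, by
   their columns, and for each orbit of certain facets a triple (m, a, t): rescaled by m these
   facets take equal values at an apex, the polytope is cut according to which of the rescaled
   facets is the least, and t certifies the piece of a. *)
Inductive tree := Leaf of matZ | Node of seq matZ & seq (Z * vecZ * tree).

(* With too little fuel the orbit is incomplete and [node_ok] fails. *)
Fixpoint orbz (fuel : nat) (gens : seq matZ) (s : matZ * matZ) : matZ :=
  match fuel, s with
  | f.+1, (acc, x :: todo) =>
      orbz f gens (foldl (fun s g =>
        let y := vmz x g in if memz y s.1 then s else (y :: s.1, y :: s.2)) (acc, todo) gens)
  | _, _ => s.1
  end.

(** Each step uses up one member of the orbit. At the root of a tree an orbit has at most 240
    members, the number of (-1)-classes for d = 1. *)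
Definition orbitz gens a := orbz 400 gens ([:: a], [:: a]).

Definition unitz (n i : nat) : vecZ := mkseq (fun j => if j == i then Zpos xH else Z0) n.

Fixpoint factz (n : nat) : Z :=
  if n is n'.+1 then Z.mul (Z.of_nat n) (factz n') else Zpos xH.

(** The rays lie in the cone of [A], and for each ray some inequality is strict on it and an
    equality on all the others. So [A] contains the facets of the simplicial cone on the rays, and
    the two cones agree. *)
Definition leaf_ok (r : nat) (k : vecZ) (A V : matZ) : bool :=
  [&& size V == r, all (fun v => size v == r) V,
      all (fun v => Z.ltb Z0 (dotz v k)) V,
      all (fun a => all (fun v => Z.leb Z0 (dotz v a)) V) A &
      let P := map (fun a => map (dotz^~ a) V) A in
      all (fun i => has (fun p => all (fun j =>
        let x := nth Z0 p j in if j == i then Z.ltb Z0 x else Z.eqb x Z0) (iota 0 r)) P)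
        (iota 0 r)].

Definition leaf_vol (r : nat) (k : vecZ) (V : matZ) : Q :=
  qmul (qabs (detq r (map (map qz) V)))
    (qinv (foldr qmul (qz (factz r)) (map (fun v => qz (dotz v k)) V))).

(** Distinctness in [G] makes two pieces meet inside a hyperplane. The generators are involutions
    that map [A] and [G] to themselves and fix [k], so they permute the pieces and preserve
    volume. *)
Definition node_ok (r : nat) (k : vecZ) (A : matZ) (gens : seq matZ)
    (ms : seq Z) (O : seq matZ) (G U : matZ) : bool :=
  [&& all (fun m => Z.ltb Z0 m) ms,
      all (fun g => [&& size g == r, all (fun c => size c == r) g,
             eqvz (vmz k g) k,
             all (fun c => memz (vmz c g) A) A & all (fun x => memz (vmz x g) G) G]) gens,
      all (fun g => all (fun j => eqvz (vmz (vmz (unitz r j) g) g) (unitz r j)) (iota 0 r)) gens,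
      all (memz^~ A) U, uniqz G, all (fun a => size a == r) G & (0 < size G)%N].

(** Where f is the least of the rescaled facets, f >= 0 implies the inequalities of all facets in
    [U]; these are therefore replaced by f and the differences g - f. Each child is weighted by the
    size of its orbit. *)
Fixpoint tvol (r : nat) (k : vecZ) (A : matZ) (t : tree) : option Q :=
  match t with
  | Leaf V =>
      let d := detq r (map (map qz) V) in
      if leaf_ok r k A V && ~~ eq0q d then Some (leaf_vol r k V) else None
  | Node gens ch =>
      let O := map (fun c => orbitz gens c.1.2) ch in
      let ms := map (fun c => c.1.1) ch in
      let G := flatten (map (fun p => map (scalez p.1) p.2) (zip ms O)) in
      let U := flatten O in
      if node_ok r k A gens ms O G U then
        let Ar := seq.filter (fun a => ~~ memz a U) A in
        foldr (fun p acc =>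
          match p.2, acc with
          | Some x, Some y => Some (qadd (qmul (qz (Z.of_nat (size p.1))) x) y)
          | _, _ => None
          end) (Some (qz Z0)) (zip O (map (fun c => let f := scalez c.1.1 c.1.2 in
            tvol r k (f :: Ar ++ map (fun g => subz g f) G) c.2) ch))
      else None
  end.

(** * Finite unions with null overlaps *)

Section UnionVolume.
Variables (R : realType) (n : nat).
Implicit Types A B : set 'rV[R]_n.

Lemma vol_le A B : vmeas A -> vmeas B -> A `<=` B -> (vol A <= vol B)%E.
Proof.
move=> mA mB AB; rewrite !volE //; apply: le_measure; rewrite ?inE //.
exact: preimage_subset.
Qed.

Lemma vol_null_sub A B : vmeas A -> vmeas B -> A `<=` B -> vol B = 0%E -> vol A = 0%E.
Proof.
by move=> mA mB AB B0; apply/eqP; rewrite eq_le vol_ge0 andbT -B0 vol_le.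
Qed.

Lemma vmeas_ex (I : eqType) (s : seq I) (P : I -> set 'rV[R]_n) :
  (forall i, i \in s -> vmeas (P i)) -> vmeas [set v | exists2 i, i \in s & P i v].
Proof.
elim: s => [_|i s IH mP].
  by rewrite (_ : [set _ | _] = set0); [exact: vmeas0 | apply/seteqP; split => // v []].
rewrite (_ : [set _ | _] = P i `|` [set v | exists2 j, j \in s & P j v]).
  apply: vmeasU; first by apply: mP; exact: mem_head.
  by apply: IH => j js; apply: mP; rewrite inE js orbT.
apply/seteqP; split=> [v [j]|v [Pi|[j js Pj]]].
- by rewrite inE => /predU1P[->|js] Pj; [left|right; exists j].
- by exists i => //; rewrite mem_head.
- by exists j => //; rewrite inE js orbT.
Qed.

Lemma vol_null_ex (I : eqType) (s : seq I) (P : I -> set 'rV[R]_n) :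
  (forall i, i \in s -> vmeas (P i)) -> (forall i, i \in s -> vol (P i) = 0%E) ->
  vol [set v | exists2 i, i \in s & P i v] = 0%E.
Proof.
elim: s => [_ _|i s IH mP P0].
  by rewrite (_ : [set _ | _] = set0) ?vol_set0 //; apply/seteqP; split => // v [].
have mi : vmeas (P i) by apply: mP; exact: mem_head.
have ms : vmeas [set v | exists2 j, j \in s & P j v].
  by apply: vmeas_ex => j js; apply: mP; rewrite inE js orbT.
have i0 : vol (P i) = 0%E by apply: P0; exact: mem_head.
rewrite (_ : [set _ | _] = P i `|` [set v | exists2 j, j \in s & P j v]).
  rewrite volU //; last first.
    by apply: (vol_null_sub (vmeasI mi ms) mi) => // v [].
  by rewrite i0 add0e; apply: IH => j js; [apply: mP|apply: P0]; rewrite inE js orbT.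
apply/seteqP; split=> [v [j]|v [Pi|[j js Pj]]].
- by rewrite inE => /predU1P[->|js] Pj; [left|right; exists j].
- by exists i => //; rewrite mem_head.
- by exists j => //; rewrite inE js orbT.
Qed.

Lemma vol_ex (I : eqType) (s : seq I) (P : I -> set 'rV[R]_n) : uniq s ->
  (forall i, i \in s -> vmeas (P i)) ->
  (forall i j, i \in s -> j \in s -> i != j -> vol (P i `&` P j) = 0%E) ->
  vol [set v | exists2 i, i \in s & P i v] = (\sum_(i <- s) vol (P i))%E.
Proof.
elim: s => [_ _ _|i s IH /= /andP[nis us] mP P0].
  rewrite big_nil (_ : [set _ | _] = set0) ?vol_set0 //.
  by apply/seteqP; split => // v [].
have mi : vmeas (P i) by apply: mP; exact: mem_head.
have mj j : j \in s -> vmeas (P j) by move=> js; apply: mP; rewrite inE js orbT.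
have ms := vmeas_ex mj.
rewrite big_cons -IH //; last first.
  by move=> j k js ks; apply: P0; rewrite inE ?js ?ks orbT.
rewrite -volU //.
  congr vol; apply/seteqP; split=> [v [j]|v [Pi|[j js Pj]]].
  - by rewrite inE => /predU1P[->|js] Pj; [left|right; exists j].
  - by exists i => //; rewrite mem_head.
  - by exists j => //; rewrite inE js orbT.
rewrite (_ : _ `&` _ = [set v | exists2 j, j \in s & (P i `&` P j) v]).
  apply: vol_null_ex => j js; first by apply: vmeasI => //; exact: mj.
  by apply: P0; rewrite ?inE ?eqxx ?js ?orbT //; apply: contraNneq nis => ->.
by apply/seteqP; split=> [v [Pi [j js Pj]]|v [j js [Pi Pj]]]; [exists j|split=> //; exists j].
Qed.

End UnionVolume.

(** * Regions cut out by integral functionals *)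

Section Region.
Variables (R : realType) (r : nat).
Implicit Types (y : 'rV[R]_r) (a k : vecZ) (A : matZ).

Definition ev a y : R := \sum_j y 0 j * zr R (nth Z0 a j).

Lemma ev_subz a b y : ev (subz a b) y = ev a y - ev b y.
Proof.
by rewrite /ev -sumrB; apply: eq_bigr => j _; rewrite nth_subz zrB mulrBr.
Qed.

Lemma ev_scalez m a y : ev (scalez m a) y = zr R m * ev a y.
Proof.
by rewrite /ev mulr_sumr; apply: eq_bigr => j _; rewrite nth_scalez zrM mulrCA.
Qed.

(** The same list acts on functionals when read as columns and on points when read as rows; the two
    actions are transposes of each other. *)
Lemma ev_vmz a g y : size g = r -> all (fun c => size c == r) g ->
  ev (vmz a g) y = ev a (y *m mxz R r r g).
Proof.
move=> sg ag; rewrite /ev; under [RHS]eq_bigr do rewrite mxE mulr_suml.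
rewrite exchange_big; apply: eq_bigr => j _ /=.
rewrite /vmz (nth_map [::]) ?sg // dotzC (@zr_dotz _ r); last first.
  by have /allP/(_ (nth [::] g j)) := ag; rewrite mem_nth ?sg // => /(_ isT)/eqP->.
by rewrite mulr_sumr; apply: eq_bigr => i _; rewrite mxE mulrA.
Qed.

Lemma cmeas_ev a : cmeas (ev a).
Proof. exact: (@cmeas_lin _ _ _ (fun j => zr R (nth Z0 a j))). Qed.

Definition region A k : set 'rV[R]_r :=
  [set y | (forall a, a \in A -> 0 <= ev a y) /\ ev k y <= 1].

Lemma vmeas_region A k : vmeas (region A k).
Proof.
apply: vmeasI; last by apply: vmeas_le; [exact: cmeas_ev|exact: cmeas_cst].
apply: vmeas_all => a _; apply: vmeas_le; [exact: cmeas_cst|exact: cmeas_ev].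
Qed.

Definition piece A k (G : matZ) (g : vecZ) : set 'rV[R]_r :=
  region A k `&` [set y | forall h, h \in G -> ev g y <= ev h y].

Lemma vmeas_piece A k G g : vmeas (piece A k G g).
Proof.
apply: vmeasI; first exact: vmeas_region.
by apply: vmeas_all => h _; apply: vmeas_le; exact: cmeas_ev.
Qed.

(** At every point some member of [G] is least, and two pieces overlap only where two distinct
    functionals agree. *)
Lemma vol_region_pieces A k G : uniq G -> all (fun a => size a == r) G ->
  (0 < size G)%N ->
  vol (region A k) = (\sum_(g <- G) vol (piece A k G g))%E.
Proof.
move=> uG sG G0; rewrite -vol_ex //; last 2 first.
- by move=> *; exact: vmeas_piece.
- move=> g h gG hG gh; pose H := vecz R r g - vecz R r h.
  have H0 : H != 0.
    rewrite subr_eq0; apply: contraNneq gh; move/vecz_inj => -> //; apply/eqP;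
      exact: (allP sG).
  have HE y : \sum_j y 0 j * H 0 j = ev g y - ev h y.
    by rewrite -sumrB; apply: eq_bigr => j _; rewrite !mxE mulrBr.
  apply: vol_null_sub (vol_hyperplane 0 H0).
  + by apply: vmeasI; exact: vmeas_piece.
  + have : vmeas ([set y | ev g y <= ev h y] `&` [set y | ev h y <= ev g y]).
      by apply: vmeasI; apply: vmeas_le; exact: cmeas_ev.
    congr vmeas; apply/seteqP; split=> y /=; rewrite HE.
      by move=> [le1 le2]; apply/eqP; rewrite subr_eq0 eq_le le1 le2.
    by move/eqP; rewrite subr_eq0 eq_le => /andP.
  + move=> y [[_ gy] [_ hy]] /=; rewrite HE.
    by apply/eqP; rewrite subr_eq0 eq_le gy // hy.
congr vol; apply/seteqP; split=> [y Ky|y [g _ []]] //.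
have [g gG gmin] : exists2 g, g \in G & forall h, h \in G -> ev g y <= ev h y.
  elim: (G) G0 => // g [|g' G'] IH _.
    by exists g => [|h]; rewrite inE // => /eqP->.
  have [//|h hG hmin] := IH _.
  have [gh|hg] := leP (ev g y) (ev h y).
    exists g; first exact: mem_head.
    by move=> x; rewrite inE => /predU1P[->//|/hmin]; exact: le_trans.
  exists h; first by rewrite inE hG orbT.
  by move=> x; rewrite inE => /predU1P[->|/hmin //]; exact: ltW.
by exists g.
Qed.

(** The matrix squares to 1, so its determinant has absolute value 1, and it pulls the piece of f
    back to the piece of the transformed functional. *)
Lemma vol_piece_sym A k G g f : size g = r -> all (fun c => size c == r) g ->
  (forall i, (i < r)%N -> vmz (vmz (unitz r i) g) g = unitz r i) ->
  vmz k g = k -> (forall a, a \in A -> vmz a g \in A) ->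
  (forall a, a \in G -> vmz a g \in G) ->
  vol (piece A k G (vmz f g)) = vol (piece A k G f).
Proof.
move=> sg ag invol kg Ag Gg; set T := mxz R r r g.
have evT a y : ev (vmz a g) y = ev a (y *m T) by exact: ev_vmz.
have TT : T *m T = 1%:M.
  apply/matrixP => i j.
  have ev_unit (l : 'I_r) y : ev (unitz r l) y = y 0 l.
    rewrite /ev (bigD1 l) //= nth_mkseq // eqxx zr1 mulr1 big1 ?addr0 // => j' jl.
    by rewrite nth_mkseq // -[(j' == l :> nat)]/(j' == l) (negbTE jl) zr0 mulr0.
  have : ((delta_mx 0 i : 'rV[R]_r) *m (T *m T)) 0 j = (delta_mx 0 i : 'rV[R]_r) 0 j.
    by rewrite -(ev_unit j (_ *m _)) mulmxA -evT -evT invol // ev_unit.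
  by rewrite -rowE mxE => ->; rewrite !mxE eqxx eq_sym.
have gg a : ev (vmz (vmz a g) g) =1 ev a.
  by move=> y; rewrite !evT -mulmxA TT mulmx1.
have uT : T \in unitmx by case/mulmx1_unit: TT.
have dT : `|\det T| = 1.
  apply/eqP; rewrite -(@pexpr_eq1 _ _ 2) // -normrX expr2 -det_mulmx TT.
  by rewrite det1 normr1.
have -> : piece A k G (vmz f g) = [set y | piece A k G f (y *m T)].
  have regT y : region A k (y *m T) <-> region A k y.
    have half z : region A k z -> region A k (z *m T).
      move=> [h1 h2]; split=> [a aA|]; rewrite -evT ?kg //; exact/h1/Ag.
    by split=> /half //; rewrite -mulmxA TT mulmx1.
  apply/seteqP; split=> y [Ky hy]; split; try exact/regT.
    move=> h hG; rewrite -!evT; exact/hy/Gg.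
  move=> h hG; rewrite evT -(gg h) evT; exact/hy/Gg.
rewrite (volume_scales_unit uT); last exact: vmeas_piece.
by rewrite dT invr1 mul1e.
Qed.

End Region.

Lemma zr_nat (F : nzRingType) n : zr F (Z.of_nat n) = n%:R.
Proof. by rewrite /zr (_ : int_of_Z _ = n%:Z) // -[RHS]Z_of_intK. Qed.

Lemma zr_factz (F : nzRingType) n : zr F (factz n) = n`!%:R.
Proof. by elim: n => // n IH; rewrite factS natrM -IH -zr_nat -zrM. Qed.

Section Leaf.
Variables (R : realType) (r : nat) (k : vecZ) (A V : matZ).

(** The rays, rescaled to the hyperplane k = 1, form the rows of [P']; in the coordinates they
    define, the region is the standard simplex. *)
Lemma vol_leaf : leaf_ok r k A V -> eq0q (detq r (map (map qz) V)) = false ->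
  vol (@region R r A k) = (qr R (leaf_vol r k V))%:E.
Proof.
case/and5P => /eqP sV aV kV AV facets d0.
pose v (i : 'I_r) := nth [::] V i.
have vV i : v i \in V by rewrite mem_nth ?sV.
pose P := mxz R r r V.
have detP : \det P = qr R (detq r (map (map qz) V)).
  rewrite -det_mxq ?size_map ?all_map //; last by apply: sub_all aV => u /=; rewrite size_map.
  suff -> : P = mxq R r (map (map qz) V) by [].
  apply/matrixP => i j; rewrite !mxE (nth_map [::]) ?sV //.
  by rewrite (nth_map Z0) ?qr_qz // (eqP (allP aV _ (vV i))).
pose x i a := zr R (dotz (v i) a); pose kap i := x i k.
have kap0 i : 0 < kap i by rewrite zr_gt0; exact: (allP kV _ (vV i)).
pose P' := diag_mx (\row_i (kap i)^-1) *m P.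
have evP a t : ev a (t *m P') = \sum_i t 0 i * ((kap i)^-1 * x i a).
  rewrite /ev; under eq_bigr do rewrite mxE mulr_suml.
  rewrite exchange_big; apply: eq_bigr => i _ /=.
  rewrite /x (@zr_dotz _ r) ?(eqP (allP aV _ (vV i))) // 2!mulr_sumr.
  by apply: eq_bigr => j _; rewrite /P' mul_diag_mx !mxE -!mulrA.
have detP' : \det P' = (\prod_i kap i)^-1 * \det P.
  by rewrite det_mulmx det_diag -prodfV; congr (_ * _); apply: eq_bigr => i' _; rewrite mxE.
have K0 : 0 < \prod_i kap i by exact: prodr_gt0.
have uP : P' \in unitmx.
  by rewrite unitmxE detP' unitfE detP mulf_neq0 ?eq0qF // invr_eq0 gt_eqF.
have mem (u : 'rV[R]_r) : @region R r A k (u *m P') <-> corner 1 u.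
  split=> [[hA hk]|[t0 t1]]; split.
  (* The inequality that singles out ray i is a positive multiple of the i-th coordinate. *)
  - move=> i; have := allP facets i; rewrite mem_iota leq0n add0n ltn_ord => /(_ isT).
    case/hasP => _ /mapP[a aA ->] /allP hp.
    have := hA a aA; rewrite evP (bigD1 i) //= big1 ?addr0 => [|j ji].
      rewrite pmulr_lge0 // mulr_gt0 ?invr_gt0 //; have := hp i.
      rewrite mem_iota leq0n add0n ltn_ord eqxx => /(_ isT).
      by rewrite (nth_map [::]) ?sV // /x zr_gt0.
    have := hp j; rewrite mem_iota leq0n add0n ltn_ord => /(_ isT).
    rewrite (nth_map [::]) ?sV // -[(j == i :> nat)]/(j == i) (negbTE ji) => /Z.eqb_spec E.
    by rewrite /x /v E zr0 !mulr0.
  - move: hk; rewrite evP; congr (_ <= _); apply: eq_bigr => i _.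
    by rewrite mulVf ?mulr1 // gt_eqF.
  - move=> a aA; rewrite evP sumr_ge0 // => i _; rewrite !mulr_ge0 ?invr_ge0 ?(ltW (kap0 i)) //.
    by rewrite zr_ge0; exact: (allP (allP AV a aA) _ (vV i)).
  - rewrite evP; apply: le_trans t1; rewrite le_eqVlt; apply/orP; left; apply/eqP.
    by apply: eq_bigr => i _; rewrite mulVf ?mulr1 // gt_eqF.
have -> : @region R r A k = [set y | corner 1 (y *m invmx P')].
  by apply/seteqP; split=> y /=; rewrite -mem mulmxKV.
rewrite (volume_scales_unit (T := invmx P')) ?unitmx_inv //; last exact: vmeas_corner.
rewrite vol_corner // expr1n -EFinM det_inv normfV invrK detP' normrM normfV.
have fE W : qr R (foldr qmul (qz (factz r)) (map (fun v => qz (dotz v k)) W)) =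
    (\prod_(w <- W) zr R (dotz w k)) * r`!%:R.
  elim: W => [|w W IH]; first by rewrite big_nil mul1r qr_qz zr_factz.
  by rewrite /= qrM IH qr_qz big_cons mulrA.
have kapE : \prod_(w <- V) zr R (dotz w k) = \prod_i kap i.
  by rewrite (big_nth [::]) sV big_mkord.
rewrite detP -qr_abs /leaf_vol qrM qrV fE kapE [`|\prod_i _|]gtr0_norm //; congr _%:E.
by set D := qr R (qabs _); move: D => D; rewrite invfM mul1r [RHS]mulrA [D * _]mulrC.
Qed.

End Leaf.

Section Orbit.

(** Members of a computed orbit are reached by generators step by step, which is the form in which
    invariance of volume propagates along the orbit. *)
Inductive reach (gens : seq matZ) (a : vecZ) : vecZ -> Prop :=
  | reach_refl : reach gens a a
  | reach_step b g : reach gens a b -> g \in gens -> reach gens a (vmz b g).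

Lemma foldl_reach gens a y gs s : {subset gs <= gens} -> reach gens a y ->
  (forall x, x \in s.1 -> reach gens a x) -> (forall x, x \in s.2 -> reach gens a x) ->
  let s' := foldl (fun s g =>
        let y := vmz y g in if memz y s.1 then s else (y :: s.1, y :: s.2)) s gs in
  (forall x, x \in s'.1 -> reach gens a x) /\ (forall x, x \in s'.2 -> reach gens a x).
Proof.
elim: gs s => [//|g gs IH] s sub ry h1 h2 /=.
have rg : reach gens a (vmz y g) by apply: reach_step => //; apply: sub; exact: mem_head.
apply: IH => // [h hgs|x|x]; first by apply: sub; rewrite inE hgs orbT.
  by case: memz => [/h1//|]; rewrite inE => /predU1P[->|/h1].
by case: memz => [/h2//|]; rewrite inE => /predU1P[->|/h2].
Qed.

Lemma orbitz_reach gens a b : b \in orbitz gens a -> reach gens a b.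
Proof.
rewrite /orbitz.
suff H f s : (forall x, x \in s.1 -> reach gens a x) ->
    (forall x, x \in s.2 -> reach gens a x) ->
    forall x, x \in orbz f gens s -> reach gens a x.
  by apply: H => x; rewrite inE => /eqP ->; exact: reach_refl.
elim: f s => [|f IH] [acc [|y todo]] //= hacc htodo.
have ry : reach gens a y by apply: htodo; exact: mem_head.
have htodo' x : x \in todo -> reach gens a x by move=> xt; apply: htodo; rewrite inE xt orbT.
have [h1 h2] := @foldl_reach gens a y gens (acc, todo) (fun=> id) ry hacc htodo'.
exact: IH.
Qed.

Lemma orbitz_id gens a : a \in orbitz gens a.
Proof.
have mono f s : {subset s.1 <= orbz f gens s}.
  elim: f s => [|f IH] [acc [|y todo]] //= x xacc; apply: IH => /=.
  suff H gs s : x \in s.1 -> x \in (foldl (fun s g =>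
        let y := vmz y g in if memz y s.1 then s else (y :: s.1, y :: s.2)) s gs).1.
    exact: H.
  elim: gs s => [//|g gs IHg] s xs /=; apply: IHg.
  by case: memz; rewrite //= inE xs orbT.
exact: (mono 400 ([:: a], [:: a])) (mem_head _ _).
Qed.

End Orbit.

Section Tree.
Variables (R : realType) (r : nat).

Section TreeInd.
Variable P : tree -> Prop.
Hypothesis PLeaf : forall V, P (Leaf V).
Hypothesis PNode : forall gens ch,
  (forall c, List.In c ch -> P c.2) -> P (Node gens ch).

(** Supplies an induction hypothesis for every subtree in the list of children, inside which [tree]
    is nested. *)
Fixpoint tree_ind' (t : tree) : P t :=
  match t with
  | Leaf V => PLeaf V
  | Node gens ch =>
      PNode gens ((fix go ch : forall c, List.In c ch -> P c.2 :=
        match ch with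
        | [::] => fun c (h : False) => match h with end
        | c0 :: ch' => fun c h =>
            match h with
            | or_introl e => match e in _ = c' return P c'.2 with
                             | erefl => tree_ind' c0.2
                             end
            | or_intror h' => go ch' c h'
            end
        end) ch)
  end.
End TreeInd.

Lemma scalez_vmz m a g : scalez m (vmz a g) = vmz (scalez m a) g.
Proof.
rewrite /scalez /vmz -map_comp; apply: eq_map => c /=.
elim: a c => [|x a IH] [|y c] //=; rewrite ?Z.mul_0_r //.
by rewrite Z.mul_add_distr_l IH Z.mul_assoc.
Qed.

Theorem tvol_sound k A t q : tvol r k A t = Some q ->
  vol (@region R r A k) = (qr R q)%:E.
Proof.
elim/tree_ind': t k A q => [V|gens ch IH] k A q /=.
  by case: ifP => // /andP[ok /negPf d0] [<-]; exact: vol_leaf.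
set O := map (fun c => orbitz gens c.1.2) ch.
set G := flatten _; set U := flatten O; set ms := map _ ch.
case: ifP => //; rewrite /node_ok.
case/andP => msP /andP[gensP /and5P[invP UA uG sG G0]].
set Ar := seq.filter _ A.
rewrite (@vol_region_pieces _ _ A k G) -?uniqzE //.
have sym g f : g \in gens -> vol (@piece R r A k G (vmz f g)) = vol (@piece R r A k G f).
  move=> gin; have /and5P[/eqP sg cg kg Ag Gg] := allP gensP g gin.
  apply: vol_piece_sym => //.
  - move=> i ir; have := allP invP g gin => /allP/(_ i).
    by rewrite mem_iota ir => /(_ isT); rewrite eqvzE => /eqP.
  - by move: kg; rewrite eqvzE => /eqP.
  - by move=> a aA; have := allP Ag a aA; rewrite memzE.
  - by move=> a aG; have := allP Gg a aG; rewrite memzE.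
(* All pieces belonging to one orbit have the volume of the piece that the subtree certifies. *)
have orb m a b : b \in orbitz gens a ->
    vol (@piece R r A k G (scalez m b)) = vol (@piece R r A k G (scalez m a)).
  move/orbitz_reach; elim=> // c g _ <- gin.
  by rewrite scalez_vmz sym.
have GE : G = flatten (map (fun c => map (scalez c.1.1) (orbitz gens c.1.2)) ch).
  rewrite /G /ms /O; congr flatten; elim: (ch) => //= c ch' ->; by [].
have inO c b : List.In c ch -> b \in orbitz gens c.1.2 -> b \in U.
  rewrite /U /O; elim: (ch) => //= c' ch' IHc [->|cin] bin; rewrite mem_cat ?bin //.
  by rewrite IHc ?orbT.
have inG c b : List.In c ch -> b \in orbitz gens c.1.2 -> scalez c.1.1 b \in G.
  rewrite GE; elim: (ch) => //= c' ch' IHc [->|cin] bin; rewrite mem_cat ?map_f //.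
  by rewrite IHc ?orbT.
have mpos c : List.In c ch -> 0 < zr R c.1.1.
  move: msP; rewrite /ms zr_gt0; elim: (ch) => //= c' ch' IHc /andP[m0 mch] [<-//|cin].
  exact: IHc.
have Uex b : b \in U -> exists2 c, List.In c ch & b \in orbitz gens c.1.2.
  rewrite /U /O; elim: (ch) => //= c ch' IHc; rewrite mem_cat => /orP[bin|/IHc[c' cin bin]].
    by exists c => //; left.
  by exists c' => //; right.
have child c : List.In c ch ->
    @piece R r A k G (scalez c.1.1 c.1.2) =
    @region R r (scalez c.1.1 c.1.2 :: Ar ++ map (fun g => subz g (scalez c.1.1 c.1.2)) G) k.
  move=> cin; set f := scalez _ _.
  have aA : c.1.2 \in A.
    by have := allP UA _ (inO c _ cin (orbitz_id _ _)); rewrite memzE.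
  apply/seteqP; split=> y.
    move=> [[hA hk] hG]; split=> // b; rewrite inE mem_cat => /orP[/eqP->|/orP[]].
    - by rewrite ev_scalez mulr_ge0 ?hA ?ltW ?mpos.
    - by rewrite mem_filter => /andP[_ /hA].
    - by move=> /mapP[g gG ->]; rewrite ev_subz subr_ge0 hG.
  move=> [h hk]; have hG g : g \in G -> ev f y <= ev g y.
    move=> gG; rewrite -subr_ge0 -ev_subz; apply: h.
    by rewrite inE mem_cat; apply/orP; right; apply/orP; right; apply/mapP; exists g.
  (* For b in [U] a positive multiple of b lies in [G], hence is at least f, which is nonnegative on
     the region of the child. *)
  split=> //; split=> // b bA; case bU: (b \in U).
    have [c' c'in bin] := Uex b bU.
    rewrite -(pmulr_rge0 _ (mpos _ c'in)) -ev_scalez.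
    by apply: le_trans (hG _ (inG _ _ c'in bin)); apply: h; rewrite mem_head.
  by apply: h; rewrite inE mem_cat mem_filter memzE bU bA orbT.
move=> E; rewrite [X in (\sum_(g <- X) _)%E]GE big_flatten big_map /=.
have {}E : foldr (fun (p : matZ * option Q) acc =>
    match p.2, acc with
    | Some x, Some y => Some (qadd (qmul (qz (Z.of_nat (size p.1))) x) y)
    | _, _ => None
    end) (Some (qz Z0)) (map (fun c => (orbitz gens c.1.2, let f := scalez c.1.1 c.1.2 in
            tvol r k (f :: Ar ++ map (fun g => subz g f) G) c.2)) ch) = Some q.
  rewrite -E; congr (foldr _ _ _); rewrite /O.
  by elim: (ch) => //= c ch' ->.
have H c x : List.In c ch -> (let f := scalez c.1.1 c.1.2 in
    tvol r k (f :: Ar ++ map (fun g => subz g f) G) c.2) = Some x ->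
    (\sum_(g <- [seq scalez c.1.1 b | b <- orbitz gens c.1.2]) vol (@piece R r A k G g))%E =
    (qr R (qmul (qz (Z.of_nat (size (orbitz gens c.1.2)))) x))%:E.
  move=> cin /= tv; rewrite big_map.
  rewrite (eq_big_seq (fun=> (qr R x)%:E)); last first.
    by move=> b /orb ->; rewrite child // (IH _ cin _ _ _ tv).
  rewrite big_const_seq count_predT qrM qr_qz zr_nat; elim: (size _) => [|n IHn] /=.
    by rewrite mul0r.
  by rewrite IHn -EFinD mulrS mulrDl mul1r.
move: E H; elim: (ch) (q) => [|c ch' IHc] q' /=.
  by case=> <- _; rewrite big_nil qr_qz.
set acc := foldr _ _ _; case tv: tvol => [x|//]; case accE: acc => [y|//] [<-] H.
rewrite big_cons (H c x) //; last by left.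
rewrite (IHc y) //; last by move=> c' x' cin; apply: H; right.
by rewrite qrD EFinD.
Qed.

End Tree.

(** * The Weyl group *)

Section Pairing.
Variables (A : comNzRingType) (n : nat).
Implicit Types x y z : 'rV[A]_n.+1.

Lemma pairingE x y : pairing x y =
  x 0 ord0 * y 0 ord0 - \sum_(j < n) x 0 (lift ord0 j) * y 0 (lift ord0 j).
Proof.
rewrite /pairing /gram mul_mx_diag mxE big_ord_recl !mxE eqxx mulr1; congr (_ + _).
by rewrite -sumrN; apply: eq_bigr => j _; rewrite !mxE /= mulrN1 mulNr.
Qed.

Lemma pairingC x y : pairing x y = pairing y x.
Proof.
by rewrite !pairingE mulrC; congr (_ - _); apply: eq_bigr => j _; rewrite mulrC.
Qed.

Lemma pairingDl x y z : pairing (x + y) z = pairing x z + pairing y z.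
Proof. by rewrite /pairing !mulmxDl mxE. Qed.

Lemma pairingZl a x y : pairing (a *: x) y = a * pairing x y.
Proof. by rewrite /pairing -!scalemxAl mxE. Qed.

Lemma pairingDr x y z : pairing x (y + z) = pairing x y + pairing x z.
Proof. by rewrite pairingC pairingDl !(pairingC x). Qed.

Lemma pairingZr a x y : pairing x (a *: y) = a * pairing x y.
Proof. by rewrite pairingC pairingZl pairingC. Qed.

Lemma pairingNl x y : pairing (- x) y = - pairing x y.
Proof. by rewrite -scaleN1r pairingZl mulN1r. Qed.

Lemma pairingNr x y : pairing x (- y) = - pairing x y.
Proof. by rewrite pairingC pairingNl pairingC. Qed.

Lemma pairingBl x y z : pairing (x - y) z = pairing x z - pairing y z.
Proof. by rewrite pairingDl pairingNl. Qed.

Lemma pairing0l x : pairing 0 x = 0.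
Proof. by rewrite -(scale0r 0) pairingZl mul0r. Qed.

Lemma pairing_suml (I : Type) (s : seq I) (P : pred I) (F : I -> 'rV[A]_n.+1) x :
  pairing (\sum_(i <- s | P i) F i) x = \sum_(i <- s | P i) pairing (F i) x.
Proof.
by elim/big_rec2: _ => [|i u v _ <-]; rewrite ?pairing0l ?pairingDl.
Qed.

End Pairing.

Section WeylGroup.
Variable d : nat.
Notation L := (Lambda d).
Implicit Types (x y z : L) (w : 'M[int]_((9 - d).+1)).

Definition refl (r x : L) : L := x + pairing x r *: r.

Lemma mul_reflection x r : x *m reflection r = refl r x.
Proof.
rewrite /reflection mulmxDr mulmx1 !mulmxA; congr (_ + _).
by apply/rowP => j; rewrite [LHS]mxE big_ord1 [RHS]mxE.
Qed.

Lemma refl_pairing r x y : is_root d r -> pairing (refl r x) (refl r y) = pairing x y.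
Proof.
move=> [_ rr]; rewrite /refl !pairingDl !pairingDr !pairingZl !pairingZr rr.
by rewrite (pairingC r y); lia.
Qed.

Lemma reflK r : is_root d r -> involutive (refl r).
Proof.
move=> [_ rr] x; rewrite /refl pairingDl pairingZl rr -addrA -scalerDl.
by rewrite [X in X *: r](_ : _ = 0) ?scale0r ?addr0 //; lia.
Qed.

Lemma refl_adj r x y : pairing (refl r x) y = pairing x (refl r y).
Proof.
by rewrite /refl pairingDl pairingDr pairingZl pairingZr (pairingC r y); lia.
Qed.

Lemma refl_root r x : is_root d r -> is_root d x -> is_root d (refl r x).
Proof.
move=> hr hx; split; last by rewrite refl_pairing //; case: hx.
by rewrite -refl_adj /refl hr.1 scale0r addr0; case: hx.
Qed.

Lemma reflectionK r : is_root d r -> reflection r *m reflection r = 1%:M.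
Proof.
move=> hr; apply/row_matrixP => i.
by rewrite !rowE mulmxA !mul_reflection reflK // mulmx1.
Qed.

Lemma weyl1 : weyl d 1%:M.
Proof. by exists [::] => //; rewrite big_nil. Qed.

Lemma weylM w w' : weyl d w -> weyl d w' -> weyl d (w *m w').
Proof.
move=> [s hs ->] [s' hs' ->]; exists (s ++ s'); last by rewrite big_cat.
by move=> r; rewrite mem_cat => /orP[/hs|/hs'].
Qed.

Lemma weyl_reflection r : is_root d r -> weyl d (reflection r).
Proof.
move=> hr; exists [:: r]; last by rewrite big_seq1.
by move=> r'; rewrite inE => /eqP ->.
Qed.

Lemma weyl_ind (P : 'M[int]_((9 - d).+1) -> Prop) : P 1%:M ->
  (forall r w, is_root d r -> weyl d w -> P w -> P (reflection r *m w)) ->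
  forall w, weyl d w -> P w.
Proof.
move=> P1 PM w [s hs ->]; elim: s hs => [|r s IH] hs; first by rewrite big_nil.
rewrite big_cons; apply: PM; first by apply: hs; exact: mem_head.
  by exists s => // r' r's; apply: hs; rewrite inE r's orbT.
by apply: IH => r' r's; apply: hs; rewrite inE r's orbT.
Qed.

Lemma weyl_pairing w x y : weyl d w -> pairing (x *m w) (y *m w) = pairing x y.
Proof.
move=> hw; elim/weyl_ind: w / hw x y => [|r w hr _ IH] x y; first by rewrite !mulmx1.
by rewrite !mulmxA IH !mul_reflection refl_pairing.
Qed.

Lemma weyl_antiK w : weyl d w -> antiK d *m w = antiK d.
Proof.
elim/weyl_ind: w / => [|r w hr _ IH]; first by rewrite mulmx1.
by rewrite mulmxA mul_reflection /refl hr.1 scale0r addr0.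
Qed.

(** The reversed product of reflections; having a two-sided inverse at hand shows that [invmx] is
    meaningful on the group. *)
Lemma weyl_inv w : weyl d w -> exists2 w', weyl d w' & w *m w' = 1%:M /\ w' *m w = 1%:M.
Proof.
elim/weyl_ind: w / => [|r w hr hw [w' hw' [E1 E2]]].
  by exists 1%:M; rewrite ?mulmx1; [exact: weyl1|].
exists (w' *m reflection r); first by apply: weylM => //; exact: weyl_reflection.
split; first by rewrite mulmxA -[_ *m w *m w']mulmxA E1 mulmx1 reflectionK.
by rewrite mulmxA -(mulmxA w') reflectionK // mulmx1.
Qed.

Lemma weyl_unitmx w : weyl d w -> w \in unitmx.
Proof. by move=> /weyl_inv[w' _ [/mulmx1_unit[]]]. Qed.

Lemma weylV w : weyl d w -> weyl d (invmx w).
Proof.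
move=> hw; have [w' hw' [E1 E2]] := weyl_inv hw.
suff -> : invmx w = w' by [].
by rewrite -[LHS]mulmx1 -E1 mulmxA mulVmx ?mul1mx // weyl_unitmx.
Qed.

Lemma weyl_root w r : weyl d w -> is_root d r -> is_root d (r *m w).
Proof.
move=> hw [h1 h2]; split; last by rewrite weyl_pairing.
by rewrite -(weyl_antiK hw) weyl_pairing.
Qed.

Lemma weyl_curve w E : weyl d w -> minus_one_class d E -> minus_one_class d (E *m w).
Proof.
move=> hw [h1 h2]; split; first by rewrite weyl_pairing.
by rewrite -(weyl_antiK hw) weyl_pairing.
Qed.

Lemma weyl_adj w x y : weyl d w -> pairing (x *m w) y = pairing x (y *m invmx w).
Proof. by move=> hw; rewrite -[in LHS](mulmxKV (weyl_unitmx hw) y) weyl_pairing. Qed.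

End WeylGroup.

Lemma sub_in_count (T : eqType) (a b : pred T) (s : seq T) :
  {in s, forall x, a x -> b x} -> (count a s <= count b s)%N.
Proof.
elim: s => //= x s IH ab; apply: leq_add; last by apply: IH => y ys; apply: ab; rewrite inE ys orbT.
by have := ab x (mem_head _ _); case: (a x) => // ->.
Qed.

(** * Simple roots, dominant vectors and their stabilizers *)

Section RootSystem.
Variables (d m : nat).
Notation L := (Lambda d).
Notation M := ('M[int]_((9 - d).+1)).
Variables (al P : 'I_m -> L) (pos : seq L).
Implicit Types (x y z b : L) (w : M).

(** [P] will be dual to the simple roots, so on the orthogonal complement of [antiK d] this means
    nonnegative coefficients along the simple roots. *)
Definition nonneg y := [forall i, 0 <= pairing y (P i)].
Definition dominant x := forall i, 0 <= pairing x (al i).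
(* Iterating this map tells the simple roots apart: the Dynkin diagram has no symmetry. *)
Definition dynkin_step v := \sum_i pairing (al i) v *: al i.
Definition dynkin_vec k := iter k dynkin_step (\sum_i al i).
Definition perp (J : {set 'I_m}) : set L :=
  [set u | forall i, i \in J -> pairing u (al i) = 0].

(** [rb_span] expands z rationally in -K and the simple roots, multiplied by d = (-K, -K) to stay
    integral. [rb_height] recognizes the simple roots among the positive ones by their pairing with
    the sum of all positive roots. [rb_rigid] excludes nontrivial diagram automorphisms. *)
Record root_base : Prop := RootBase {
  rb_d : (0 < d)%N;
  rb_root : forall i, is_root d (al i);
  rb_dual : forall i j, pairing (al i) (P j) = (i == j)%:R;
  rb_span : forall z, d%:R *: z = pairing z (antiK d) *: antiK d +
    \sum_j (d%:R * pairing z (P j) - pairing z (antiK d) * pairing (antiK d) (P j)) *: al j;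
  rb_pos : forall b, (b \in pos) <-> is_root d b /\ nonneg b;
  rb_sign : forall b, is_root d b -> nonneg b \/ nonneg (- b);
  rb_uniq : uniq pos;
  rb_simple : forall i b, b \in pos -> b != al i -> nonneg (refl (al i) b);
  rb_height : exists c, (forall i, pairing (al i) (\sum_(b <- pos) b) = c) /\
    forall b, b \in pos -> pairing b (\sum_(b <- pos) b) = c -> exists i, b = al i;
  rb_rigid : exists k, injective (fun i => pairing (al i) (dynkin_vec k))
}.

Hypothesis rb : root_base.

Let refl_al i x : refl (al i) x = x *m reflection (al i).
Proof. by rewrite mul_reflection. Qed.

Let d0 : d%:R != 0 :> int.
Proof. by rewrite pnatr_eq0 -lt0n (rb_d rb). Qed.

Lemma scale_row_inj n (a : int) : a != 0 -> injective (fun x : 'rV[int]_n => a *: x).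
Proof.
move=> a0 x y /rowP E; apply/rowP => j; have := E j; rewrite !mxE; exact: mulfI.
Qed.

Lemma root_expand b : is_root d b -> b = \sum_j pairing b (P j) *: al j.
Proof.
move=> hb; have bK : pairing b (antiK d) = 0 by rewrite pairingC hb.1.
apply: (scale_row_inj d0); rewrite (rb_span rb) bK scale0r add0r scaler_sumr.
by apply: eq_bigr => j _; rewrite mul0r subr0 scalerA.
Qed.

Lemma nonneg0 y : pairing y (antiK d) = 0 -> nonneg y -> nonneg (- y) -> y = 0.
Proof.
move=> yK /forallP h1 /forallP h2; apply: (scale_row_inj d0).
rewrite (rb_span rb) yK scale0r add0r scaler0 big1 // => j _.
have := h2 j; rewrite pairingNl oppr_ge0 => h3.
have -> : pairing y (P j) = 0 by apply/eqP; rewrite eq_le h1 h3.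
by rewrite mulr0 mul0r subr0 scale0r.
Qed.

Lemma nonnegN_root b : is_root d b -> nonneg b -> nonneg (- b) = false.
Proof.
move=> hb h1; apply/negP => h2.
have b0 : b = 0 by apply: nonneg0 => //; rewrite pairingC hb.1.
by have := hb.2; rewrite b0 pairing0l.
Qed.

Lemma al_pos i : al i \in pos.
Proof.
apply/(rb_pos rb); split; first exact: rb_root.
by apply/forallP => j; rewrite (rb_dual rb).
Qed.

(** A simple reflection keeps every other positive root positive and cannot send one to [al i],
    whose preimage is negative; an injective self-map of a finite list is a permutation. *)
Lemma perm_simple i :
  perm_eq [seq b *m reflection (al i) | b <- rem (al i) pos] (rem (al i) pos).
Proof.
have hi := rb_root rb i.
have inj : injective (fun b => b *m reflection (al i)).
  by move=> b b'; rewrite -!refl_al; exact: (inv_inj (reflK hi)).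
have ur : uniq (rem (al i) pos) by apply: rem_uniq; exact: rb_uniq.
have um : uniq [seq b *m reflection (al i) | b <- rem (al i) pos] by rewrite map_inj_uniq.
apply: uniq_perm => //.
have sub : {subset [seq b *m reflection (al i) | b <- rem (al i) pos] <= rem (al i) pos}.
  move=> _ /mapP[b + ->]; rewrite !mem_rem_uniq ?(rb_uniq rb) // !inE -refl_al.
  move=> /andP[bi bp]; have [hb nb] := (rb_pos rb b).1 bp.
  apply/andP; split; last first.
    by apply/(rb_pos rb); split; [exact: refl_root|exact: rb_simple].
  apply: contraTneq nb => /(canRL (reflK hi)) ->.
  have -> : refl (al i) (al i) = - al i by rewrite /refl hi.2 -[X in X + _]scale1r -scalerDl -scaleN1r.
  by rewrite nonnegN_root // ((rb_pos rb _).1 (al_pos i)).2.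
by have [] := uniq_min_size um sub; rewrite ?size_map.
Qed.

Lemma weyl_al i : weyl d (reflection (al i)).
Proof. exact/weyl_reflection/rb_root. Qed.

(** Reindexes a count of positive roots by a simple reflection, isolating [al i]. The inductions
    below measure progress by such counts. *)
Lemma count_simple (p : pred L) i :
  count p pos = (p (al i) + count (fun b => p (b *m reflection (al i))) (rem (al i) pos))%N.
Proof.
rewrite (seq.permP (perm_to_rem (al_pos i))) /=; congr (_ + _)%N.
by rewrite -(seq.permP (perm_simple i)) count_map.
Qed.

Lemma al_reflection i : al i *m reflection (al i) = - al i.
Proof.
by rewrite mul_reflection /refl (rb_root rb i).2 -[X in X + _]scale1r -scalerDl -scaleN1r.
Qed.

Lemma reflectionKm n i (A : 'M[int]_(n, _)) : A *m reflection (al i) *m reflection (al i) = A.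
Proof. by rewrite -mulmxA reflectionK ?mulmx1 //; exact: rb_root. Qed.

(** Reflecting at a simple root with negative pairing lowers the number of positive roots that pair
    negatively with v. *)
Lemma dominant_conj v : exists2 w, weyl d w & dominant (v *m w).
Proof.
have [n le_n] := ubnP (count (fun b => pairing v b < 0) pos).
elim: n v le_n => // n IH v; rewrite ltnS => le_n.
have [dom|/existsNP[i /negP]] := pselect (dominant v).
  by exists 1%:M; [exact: weyl1|rewrite mulmx1].
rewrite -ltNge => vi.
have [|w hw dw] := IH (v *m reflection (al i)).
  apply: leq_trans le_n.
  rewrite (count_simple (fun b => pairing v b < 0) i) vi add1n ltnS.
  rewrite (seq.permP (perm_to_rem (al_pos i))) /=.
  rewrite -refl_al refl_adj refl_al al_reflection pairingNr oppr_lt0 ltNge (ltW vi) add0n.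
  by apply: sub_count => b /=; rewrite -refl_al refl_adj refl_al.
exists (reflection (al i) *m w); last by rewrite mulmxA.
by apply: weylM => //; exact: weyl_al.
Qed.

Lemma nonnegD x y : nonneg x -> nonneg y -> nonneg (x + y).
Proof.
move=> /forallP hx /forallP hy; apply/forallP => i.
by rewrite pairingDl addr_ge0.
Qed.

Lemma nonnegZ (a : int) x : 0 <= a -> nonneg x -> nonneg (a *: x).
Proof. by move=> a0 /forallP hx; apply/forallP => i; rewrite pairingZl mulr_ge0. Qed.

Lemma nonneg_sum (I : Type) (s : seq I) (F : I -> L) :
  (forall i, nonneg (F i)) -> nonneg (\sum_(i <- s) F i).
Proof.
move=> hF; elim/big_ind: _ => //; last exact: nonnegD.
by apply/forallP => j; rewrite pairing0l.
Qed.

Lemma perm_weyl_uniq w (s : seq L) : weyl d w -> uniq s ->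
  {subset [seq b *m w | b <- s] <= s} -> perm_eq [seq b *m w | b <- s] s.
Proof.
move=> hw us sub.
have inj : injective (mulmx^~ w : L -> L) by apply: can_inj (mulmxK (weyl_unitmx hw)).
have um : uniq [seq b *m w | b <- s] by rewrite map_inj_uniq.
by apply: uniq_perm => //; have [] := uniq_min_size um sub; rewrite ?size_map.
Qed.

Lemma weyl_sum w (s : seq L) : perm_eq [seq b *m w | b <- s] s ->
  (\sum_(b <- s) b) *m w = \sum_(b <- s) b.
Proof. by move=> hs; rewrite mulmx_suml -[RHS](perm_big _ hs) big_map. Qed.

Lemma al_inj : injective al.
Proof.
move=> i j E; have := rb_dual rb i i; rewrite {1}E rb_dual // eqxx.
by case: eqVneq.
Qed.

(** Such an element permutes the positive roots and fixes their sum, hence permutes the simple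
    roots, which the sum recognizes. It then fixes every [dynkin_vec], and one of these takes
    different pairings with different simple roots. *)
Lemma weyl_rigid w : weyl d w -> (forall i, nonneg (al i *m w)) -> w = 1%:M.
Proof.
move=> hw hal.
have hpos b : b \in pos -> b *m w \in pos.
  move=> /(rb_pos rb)[hb nb]; apply/(rb_pos rb); split; first exact: weyl_root.
  rewrite {1}(root_expand hb) mulmx_suml; apply: nonneg_sum => j.
  by rewrite -scalemxAl; apply: nonnegZ => //; move/forallP: nb.
have rho_w : (\sum_(b <- pos) b) *m w = \sum_(b <- pos) b.
  apply: weyl_sum; apply: perm_weyl_uniq => //; first exact: rb_uniq.
  by move=> _ /mapP[b bp ->]; exact: hpos.
have [c [c1 c2]] := rb_height rb.
have simple_w i : exists j, al i *m w = al j.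
  apply: c2; first exact/hpos/al_pos.
  by rewrite -rho_w weyl_pairing // c1.
pose s := [seq al i | i <- enum 'I_m].
have sw : perm_eq [seq b *m w | b <- s] s.
  apply: perm_weyl_uniq => //; first by rewrite map_inj_uniq ?enum_uniq //; exact: al_inj.
  move=> _ /mapP[_ /mapP[i _ ->] ->]; have [j ->] := simple_w i.
  by rewrite map_f // mem_enum.
have sumE (F : L -> L) : \sum_i F (al i) = \sum_(b <- s) F b by rewrite big_map big_enum.
have Sw k : dynkin_vec k *m w = dynkin_vec k.
  elim: k => [|k IH] /=; first by rewrite (sumE id) weyl_sum.
  rewrite -/(dynkin_vec k) /dynkin_step (sumE (fun b => pairing b (dynkin_vec k) *: b)).
  rewrite mulmx_suml -[RHS](perm_big _ sw) [RHS]big_map; apply: eq_bigr => b _.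
  by rewrite -{2}IH weyl_pairing // scalemxAl.
have [k injk] := rb_rigid rb.
have al_w i : al i *m w = al i.
  have [j E] := simple_w i; rewrite E; congr al; apply: injk.
  by rewrite -E -{1}(Sw k) weyl_pairing.
(* The anticanonical class and the simple roots are fixed, and together they span the lattice
   rationally. *)
apply/row_matrixP => i; rewrite !rowE mulmx1; move: (delta_mx 0 i) => z.
apply: (scale_row_inj d0); rewrite scalemxAl (rb_span rb z) mulmxDl -scalemxAl weyl_antiK //.
congr (_ + _); rewrite mulmx_suml; apply: eq_bigr => j _.
by rewrite -scalemxAl al_w.
Qed.

(* Dominant vectors are the lowest in their orbit, the form being negative on roots. *)
Lemma dominant_low x w : dominant x -> weyl d w -> nonneg (x *m w - x).
Proof.
move=> dx; have [n le_n] := ubnP (count (fun b => ~~ nonneg (b *m w)) pos).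
elim: n w le_n => // n IH w; rewrite ltnS => le_n hw.
have [hal|/existsNP[i /negP hi]] := pselect (forall i, nonneg (al i *m w)).
  by rewrite (weyl_rigid hw hal) mulmx1 subrr; apply/forallP => j; rewrite pairing0l.
pose w' := reflection (al i) *m w.
have hw' : weyl d w' by apply: weylM => //; exact: weyl_al.
have nneg : nonneg (al i *m w').
  rewrite mulmxA al_reflection mulNmx.
  by case: (rb_sign rb (weyl_root hw (rb_root rb i))) => //; rewrite (negbTE hi).
have hx : nonneg (x *m w' - x).
  apply: IH => //; apply: leq_trans le_n.
  rewrite (count_simple (fun b => ~~ nonneg (b *m w)) i) hi add1n ltnS.
  rewrite (seq.permP (perm_to_rem (al_pos i))) /= nneg add0n.
  by apply: sub_count => b /=; rewrite mulmxA.
(* w is the reflection in [al i] followed by w', so x w exceeds x w' by a nonnegative multiple of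
   the positive root to which w' sends [al i]. *)
have -> : x *m w - x = (x *m w' - x) + pairing x (al i) *: (al i *m w').
  rewrite addrAC; congr (_ - _).
  have -> : x *m w = x *m reflection (al i) *m w' by rewrite /w' !mulmxA reflectionKm.
  by rewrite mul_reflection mulmxDl -scalemxAl.
by apply: nonnegD => //; apply: nonnegZ.
Qed.

(** For v orthogonal to J and N large, N x + v is dominant, so its image under w is no lower; as w
    fixes x, this says that v w - v is nonnegative. The same holds for -v, whence equality. *)
Lemma stabilizer_perp x w (J : {set 'I_m}) : dominant x -> weyl d w -> x *m w = x ->
  (forall i, i \notin J -> pairing x (al i) != 0) ->
  forall u, perp J u -> u *m w = u.
Proof.
move=> dx hw xw xJ u uJ.
suff low v : perp J v -> nonneg (v *m w - v).
  apply/eqP; rewrite -subr_eq0; apply/eqP; apply: nonneg0; last 1 first.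
  - rewrite (_ : - _ = (- u) *m w - - u); last by rewrite mulNmx opprB opprK addrC.
    by apply: low => i iJ; rewrite pairingNl uJ ?oppr0.
  - by rewrite pairingBl -{1}(weyl_antiK hw) weyl_pairing // subrr.
  - exact: low.
(* Outside J the integer pairing of x with a simple root is at least 1, so N times it outweighs any
   pairing of v; on J the pairing of v is zero. *)
move=> vJ; pose N : int := \sum_i `|pairing v (al i)|.
have N0 : 0 <= N by apply: sumr_ge0.
have dom : dominant (N *: x + v).
  move=> i; rewrite pairingDl pairingZl; have [iJ|iJ] := boolP (i \in J).
    by rewrite vJ // addr0 mulr_ge0.
  have xi : 1 <= pairing x (al i) by rewrite -gtz0_ge1 lt_neqAle eq_sym xJ //= dx.
  have vi : - N <= pairing v (al i).
    rewrite lerNl; apply: le_trans (ler_norm _) _; rewrite normrN /N (bigD1 i) //=.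
    by rewrite lerDl sumr_ge0.
  have : N * 1 <= N * pairing x (al i) by rewrite ler_wpM2l.
  rewrite mulr1 => h; have := lerD h vi; rewrite subrr //.
have := dominant_low dom hw.
by rewrite mulmxDl -scalemxAl xw opprD addrACA subrr add0r.
Qed.

(* The point v of M lying on the fewest root hyperplanes is generic in M; moved into the
   dominant chamber it shows that M is conjugate to the span of a face. *)
Theorem invariants_conj (G : set M) : G `<=` weyl d ->
  exists J : {set 'I_m}, exists2 w, weyl d w &
    forall u, invariants G u <-> perp J (u *m w).
Proof.
move=> GW; pose M0 := invariants G.
have M00 : M0 0 by move=> g _; rewrite mul0mx.
pose cnt v := count (fun b => pairing v b == 0) pos.
have [v Mv vmin] : exists2 v, M0 v & forall u, M0 u -> (cnt v <= cnt u)%N.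
  have ex : exists n, `[< exists2 v, M0 v & cnt v = n >] by exists (cnt 0); apply/asboolP; exists 0.
  case: (ex_minnP ex) => n /asboolP[v Mv <-] hmin; exists v => // u Mu.
  by apply: hmin; apply/asboolP; exists u.
have generic b u : b \in pos -> M0 u -> pairing v b = 0 -> pairing u b = 0.
  move=> bp Mu vb; apply: contrapT => ub.
  (* N exceeds all pairings of u with positive roots, so N v + u is orthogonal to a positive root
     only if v is. Being not orthogonal to b, it would lie on fewer hyperplanes than v. *)
  pose N : int := 1 + \sum_(b <- pos) `|pairing u b|.
  have Mz : M0 (N *: v + u) by move=> g Gg; rewrite mulmxDl -scalemxAl Mv // Mu.
  have Nb b' : b' \in pos -> `|pairing u b'| < N.
    move=> b'p; rewrite /N (perm_big _ (perm_to_rem b'p)) big_cons.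
    by rewrite addrCA ltrDl ltr_pwDl // sumr_ge0.
  have := vmin _ Mz; rewrite leqNgt => /negP; apply.
  rewrite /cnt !(seq.permP (perm_to_rem bp)) /= pairingDl pairingZl vb mulr0 add0r eqxx.
  rewrite (introF eqP ub) add0n add1n ltnS; apply: sub_in_count => b' /mem_rem b'p /=.
  rewrite pairingDl pairingZl addr_eq0 => /eqP E.
  have := Nb b' b'p; rewrite -normrN -E normrM; apply: contraTT => vb'.
  have : 1 <= `|pairing v b'| by rewrite -gtz0_ge1 normr_gt0.
  rewrite -leNgt => h; rewrite -[X in X <= _]mulr1; apply: ler_pM => //.
    by rewrite /N addr_ge0 // sumr_ge0.
  exact: ler_norm.
have [w hw dw] := dominant_conj v; exists [set i | pairing (v *m w) (al i) == 0]%SET, w => // u.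
split=> [Mu i|uJ g Gg].
  rewrite inE weyl_adj // => /eqP vb; rewrite weyl_adj //.
  have hb := weyl_root (weylV hw) (rb_root rb i).
  have [nb|nb] := rb_sign rb hb.
    by apply: generic vb => //; apply/(rb_pos rb).
  apply/eqP; rewrite -oppr_eq0 -pairingNr; apply/eqP.
  have hNb : is_root d (- (al i *m invmx w)).
    by split; rewrite ?pairingNl ?pairingNr ?hb.1 ?oppr0 // opprK hb.2.
  by apply: generic; rewrite ?pairingNr ?vb ?oppr0 //; apply/(rb_pos rb).
(* The conjugate of g fixes the dominant vector v w, hence the whole face orthogonal to J. *)
pose g' := invmx w *m g *m w.
have hg' : weyl d g' by exact: weylM (weylM (weylV hw) (GW _ Gg)) hw.
have uw := weyl_unitmx hw.
have fix_v : v *m w *m g' = v *m w by rewrite /g' !mulmxA mulmxK // Mv.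
have := stabilizer_perp dw hg' fix_v _ uJ; rewrite /g' !mulmxA mulmxK // => h.
apply: (can_inj (mulmxK uw)); apply: h => i; by rewrite inE.
Qed.

End RootSystem.

(** * Enumeration of roots and (-1)-classes *)

Definition addz (a b : vecZ) : vecZ := subz a (map Z.opp b).

Definition pairz (u v : vecZ) : Z :=
  match u, v with
  | x :: u', y :: v' => Z.sub (Z.mul x y) (dotz u' v')
  | _, _ => Z0
  end.

Definition reflz (r x : vecZ) : vecZ := addz x (scalez (pairz x r) r).

Definition lst n (x : 'rV[int]_n) : vecZ := [seq Z_of_int (x 0 i) | i <- enum 'I_n].

Section Lists.
Variable n : nat.
Notation vz := (vecz int n).

Lemma size_lst (x : 'rV[int]_n) : size (lst x) = n.
Proof. by rewrite size_map size_enum_ord. Qed.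

Lemma lstK : cancel (@lst n) vz.
Proof.
move=> x; apply/rowP => j; rewrite mxE (nth_map j) ?size_enum_ord // nth_ord_enum.
by rewrite /zr Z_of_intK intz.
Qed.

Lemma veczK a : size a = n -> lst (vz a) = a.
Proof. by move=> sa; apply: (@vecz_inj int n) => //; rewrite ?size_lst ?lstK. Qed.

Lemma vz_sub a b : vz (subz a b) = vz a - vz b.
Proof. by apply/rowP => j; rewrite !mxE nth_subz zrB. Qed.

Lemma nth_opp b j : nth Z0 (map Z.opp b) j = Z.opp (nth Z0 b j).
Proof. by elim: b j => [|x b IH] [|j] //=; rewrite ?nth_nil. Qed.

Lemma vz_add a b : vz (addz a b) = vz a + vz b.
Proof. by rewrite vz_sub; apply/rowP => j; rewrite !mxE nth_opp zrN opprK. Qed.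

Lemma vz_opp a : vz (map Z.opp a) = - vz a.
Proof. by apply/rowP => j; rewrite !mxE nth_opp zrN. Qed.

Lemma vz_scale m a : vz (scalez m a) = zr int m *: vz a.
Proof. by apply/rowP => j; rewrite !mxE nth_scalez zrM. Qed.

Lemma vz_sum (l : matZ) : vz (foldr addz [::] l) = \sum_(b <- map vz l) b.
Proof.
elim: l => [|a l IH]; first by rewrite big_nil; apply/rowP => j; rewrite !mxE nth_nil.
by rewrite big_cons /= vz_add IH.
Qed.

Lemma vz_inj a b : size a = n -> size b = n -> vz a = vz b -> a = b.
Proof. exact: vecz_inj. Qed.

End Lists.

Lemma vz_pairing n a b : size a = n.+1 ->
  pairing (vecz int n.+1 a) (vecz int n.+1 b) = zr int (pairz a b).
Proof.
case: a => [//|x a] [sa]; rewrite pairingE !mxE.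
case: b => [|y b] /=.
  rewrite big1 ?mulr0 ?subr0 // => i _; by rewrite !mxE nth_nil mulr0.
rewrite zrB zrM (@zr_dotz _ n) ?sa //; congr (_ - _); apply: eq_bigr => j _.
by rewrite !mxE /= add0n.
Qed.

Fixpoint sumz (a : vecZ) : Z := if a is x :: a' then Z.add x (sumz a') else Z0.
Fixpoint sqz (a : vecZ) : Z := if a is x :: a' then Z.add (Z.mul x x) (sqz a') else Z0.

Definition zrange (b : nat) : vecZ := mkseq (fun i => Z.sub (Z.of_nat i) (Z.of_nat b)) (b.*2.+1).

Lemma zrangeP b x : Z.le (Z.abs x) (Z.of_nat b) -> x \in zrange b.
Proof.
move=> hx; apply/mapP; exists (Z.to_nat (Z.add x (Z.of_nat b))).
  rewrite mem_iota; lia.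
lia.
Qed.

(** The integer vectors of length n with coordinate sum s and square sum q. Branches that violate
    the Cauchy-Schwarz inequality are cut off, and entries from -8 to 8 suffice as long as q <=
    64. *)
Fixpoint enumz (n : nat) (s q : Z) : matZ :=
  match n with
  | 0 => if Z.eqb s Z0 && Z.eqb q Z0 then [:: [::]] else [::]
  | n'.+1 => flatten (map (fun x =>
      let q' := Z.sub q (Z.mul x x) in let s' := Z.sub s x in
      if Z.leb (Z.mul s' s') (Z.mul (Z.of_nat n') q') then map (cons x) (enumz n' s' q') else [::])
      (zrange 8))
  end.

Lemma sqz_ge0 a : Z.le Z0 (sqz a).
Proof. elim: a => [|x a IH] /=; nia. Qed.

(** Cauchy-Schwarz against the all-ones vector. Passing from length N to N + 1, N times the new gap
    is (N x - s)^2 + (N + 1)(N q - s^2). *)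
Lemma sumz_sqz a : Z.le (Z.mul (sumz a) (sumz a)) (Z.mul (Z.of_nat (size a)) (sqz a)).
Proof.
elim: a => [//|x a IH]; have h := @sqz_ge0 a.
rewrite -[sumz _]/(Z.add x (sumz a)) -[sqz _]/(Z.add (Z.mul x x) (sqz a)) -[size _]/(size a).+1.
have [s0|s0] := posnP (size a).
  by case: a s0 {IH h} => // _; rewrite -[sumz [::]]/Z0 -[sqz [::]]/Z0 -[size [::]]/O; nia.
rewrite Nat2Z.inj_succ; move: (sumz a) (sqz a) IH h => s q IH h.
have n0 : Z.lt Z0 (Z.of_nat (size a)) by lia.
move: (Z.of_nat (size a)) IH n0 => N IH n0.
have h1 : Z.le Z0 (Z.mul (Z.sub s (Z.mul N x)) (Z.sub s (Z.mul N x))) by exact: Z.square_nonneg.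
have h2 : Z.le Z0 (Z.mul N (Z.sub (Z.mul N q) (Z.mul s s))) by apply: Z.mul_nonneg_nonneg; lia.
apply/Z.le_0_sub; apply: (proj1 (Z.mul_nonneg_cancel_l N _ n0)).
lia.
Qed.

Lemma enumzS n s q : enumz n.+1 s q = flatten (map (fun x =>
  let q' := Z.sub q (Z.mul x x) in let s' := Z.sub s x in
  if Z.leb (Z.mul s' s') (Z.mul (Z.of_nat n) q') then map (cons x) (enumz n s' q') else [::])
  (zrange 8)).
Proof. by []. Qed.

Lemma enumzP a s q : sumz a = s -> sqz a = q -> Z.le q (Zpos 64) ->
  a \in enumz (size a) s q.
Proof.
elim: a s q => [|x a IH] s q; first by move=> <- <- _; rewrite inE.
rewrite -[sumz _]/(Z.add x (sumz a)) -[sqz _]/(Z.add (Z.mul x x) (sqz a)) -[size _]/(size a).+1.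
move=> <- <- qle; have h := @sqz_ge0 a; have hx := Z.square_nonneg x; rewrite enumzS.
apply/flattenP; exists (map (cons x) (enumz (size a) (sumz a) (sqz a))); last first.
  by rewrite map_f // IH //; lia.
apply/mapP; exists x.
  apply: zrangeP; apply: Z.square_le_simpl_nonneg; first by [].
  by rewrite Z.abs_square; lia.
cbv beta zeta; rewrite (_ : Z.sub (Z.add x _) x = sumz a); last by lia.
rewrite (_ : Z.sub (Z.add _ (sqz a)) _ = sqz a); last by lia.
by case: Z.leb_spec0 => // /(_ (@sumz_sqz a)).
Qed.

Notation m1z := (Zneg xH).
Notation p1z := (Zpos xH).

Definition Kz (n : nat) : vecZ := Zpos 3 :: nseq n m1z.

(** The chain e_1 - e_2, ..., e_(n-1) - e_n, followed by l - e_1 - e_2 - e_3, which attaches to e_3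
    - e_4: the diagram of E_n. *)
Definition simplez (n : nat) : matZ :=
  rcons (mkseq (fun i => Z0 :: mkseq (fun j =>
           if j == i then p1z else if j == i.+1 then m1z else Z0) n) n.-1)
        (p1z :: m1z :: m1z :: m1z :: nseq (n - 3) Z0).

(** The vectors min(3, i) l - e_1 - ... - e_i for 0 < i < n, and l: dual to the simple roots under
    the intersection form. *)
Definition coweightz (n : nat) : matZ :=
  rcons (mkseq (fun i => Z.of_nat (minn 3 i.+1) :: mkseq (fun j =>
           if (j <= i)%N then m1z else Z0) n) n.-1)
        (p1z :: nseq n Z0).

(** For a root with l-coordinate a the other coordinates have sum -3a and square sum a^2 + 2;
    Cauchy-Schwarz with n <= 8 gives a^2 <= 16, whence the range 4. *)
Definition rootz (n : nat) : matZ :=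
  flatten (map (fun a => map (cons a)
    (enumz n (Z.mul (Zneg 3) a) (Z.add (Z.mul a a) (Zpos 2)))) (zrange 4)).

(** Here Cauchy-Schwarz with n <= 8 reads (1 - 3a)^2 <= 8 (a^2 + 1), that is (a + 1)(a - 7) <= 0,
    whence the range 7. *)
Definition curvez (n : nat) : matZ :=
  flatten (map (fun a => map (cons a)
    (enumz n (Z.sub p1z (Z.mul (Zpos 3) a)) (Z.add (Z.mul a a) p1z))) (zrange 7)).

Definition nonnegz (cow : matZ) (b : vecZ) : bool := all (fun p => Z.leb Z0 (pairz b p)) cow.

Definition spanz (d n : nat) (sim cow : matZ) (z : vecZ) : vecZ :=
  let K := Kz n in let zK := pairz z K in
  foldr addz (scalez zK K) (map (fun ap =>
    scalez (Z.sub (Z.mul (Z.of_nat d) (pairz z ap.2)) (Z.mul zK (pairz K ap.2))) ap.1)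
    (zip sim cow)).

Definition dynkin_stepz (sim : matZ) (v : vecZ) : vecZ :=
  foldr addz [::] (map (fun a => scalez (pairz a v) a) sim).

(** The decidable form of [root_base]; [k] is the number of iterations in [rb_rigid]. *)
Definition base_ok (d : nat) (roots : matZ) (k : nat) : bool :=
  let n := (9 - d)%N in
  let sim := simplez n in let cow := coweightz n in
  let pos := seq.filter (nonnegz cow) roots in
  let rho := foldr addz [::] pos in
  let c := pairz (nth [::] sim 0) rho in
  let v := iter k (dynkin_stepz sim) (foldr addz [::] sim) in
  [&& all (fun b => size b == n.+1) (sim ++ cow ++ roots),
      all (fun b => memz b roots) sim,
      all (fun b => if Z.eqb (pairz (Kz n) b) Z0 then Z.eqb (pairz b b) (Zneg 2) else false) roots,
      all (fun i => all (fun j => Z.eqb (pairz (nth [::] sim i) (nth [::] cow j))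
         (if i == j then p1z else Z0)) (iota 0 n)) (iota 0 n) &
      all (fun i => eqvz (scalez (Z.of_nat d) (unitz n.+1 i))
         (spanz d n sim cow (unitz n.+1 i))) (iota 0 n.+1)] &&
  [&& all (fun b => if nonnegz cow b then true else nonnegz cow (map Z.opp b)) roots,
      uniqz roots,
      all (fun a => all (fun b => if eqvz b a then true else nonnegz cow (reflz a b)) pos) sim,
      all (fun a => Z.eqb (pairz a rho) c) sim &
      all (fun b => if Z.eqb (pairz b rho) c then memz b sim else true) pos &&
      uniqz (map (fun a => [:: pairz a v]) sim)].

Section Enumeration.
Variable d : nat.
Hypothesis d12 : (d = 1 \/ d = 2)%N.
Notation n := (9 - d)%N.
Notation vz := (vecz int n.+1).

Lemma antiK_vz : antiK d = vz (Kz n).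
Proof.
apply/rowP => j; rewrite !mxE; case: (unliftP ord0 j) => [i|] -> //=.
by rewrite add0n nth_nseq ltn_ord.
Qed.

Lemma pairz_Kz a v : size v = n -> pairz (Kz n) (a :: v) = Z.add (Z.mul (Zpos 3) a) (sumz v).
Proof.
move=> sv; rewrite /Kz /pairz.
suff -> : dotz (nseq n m1z) v = Z.opp (sumz v) by lia.
rewrite -sv; elim: v {sv} => [//|x v IH].
rewrite -[dotz _ _]/(Z.add (Z.mul m1z x) (dotz (nseq (size v) m1z) v)) IH.
by rewrite -[sumz (x :: v)]/(Z.add x (sumz v)); lia.
Qed.

Lemma pairz_self a v : pairz (a :: v) (a :: v) = Z.sub (Z.mul a a) (sqz v).
Proof.
by rewrite /pairz; congr (Z.sub _); elim: v => [|x v IH] //=; rewrite IH.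
Qed.

Lemma lst_cons (x : Lambda d) : exists a v, size v = n /\ lst x = a :: v.
Proof.
have := size_lst x; case: (lst x) => [//|a v] [sv]; by exists a, v.
Qed.

Lemma rootzP (x : Lambda d) : is_root d x -> lst x \in rootz n.
Proof.
rewrite -[x]lstK; have [a [v [sv ->]]] := lst_cons x.
have sz : size (a :: v) = n.+1 by rewrite /= sv.
have sK : size (Kz n) = n.+1 by rewrite /= size_nseq.
case; rewrite antiK_vz !vz_pairing //.
rewrite pairz_Kz // pairz_self.
rewrite (_ : 0 = zr int Z0) // (_ : -2 = zr int (Zneg 2)) // => /zr_eq hK /zr_eq hS.
rewrite veczK //; apply/flattenP.
exists (map (cons a) (enumz n (Z.mul (Zneg 3) a) (Z.add (Z.mul a a) (Zpos 2)))).
  apply/mapP; exists a => //; apply: zrangeP.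
  apply: Z.square_le_simpl_nonneg; first by [].
  rewrite Z.abs_square; have := @sumz_sqz v; rewrite sv.
  have : Z.le (Z.of_nat n) (Zpos 8) by lia.
  have := @sqz_ge0 v; nia.
rewrite map_f // -sv; apply: enumzP; try lia.
have := @sumz_sqz v; rewrite sv.
have : Z.le (Z.of_nat n) (Zpos 8) by lia.
have := @sqz_ge0 v; nia.
Qed.

Lemma curvezP (x : Lambda d) : minus_one_class d x -> lst x \in curvez n.
Proof.
rewrite -[x]lstK; have [a [v [sv ->]]] := lst_cons x.
have sz : size (a :: v) = n.+1 by rewrite /= sv.
have sK : size (Kz n) = n.+1 by rewrite /= size_nseq.
case; rewrite antiK_vz !vz_pairing //.
rewrite pairz_Kz // pairz_self.
rewrite (_ : 1 = zr int p1z) // (_ : -1 = zr int m1z) // => /zr_eq hS /zr_eq hK.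
rewrite veczK //; apply/flattenP.
have n8 : Z.le (Z.of_nat n) (Zpos 8) by lia.
have h0 := @sqz_ge0 v; have := @sumz_sqz v; rewrite sv => h1.
have h2 : Z.le (Z.mul (sumz v) (sumz v)) (Z.mul (Zpos 8) (sqz v)) by nia.
have a7 : Z.le (Zneg 1) a /\ Z.le a (Zpos 7) by nia.
exists (map (cons a) (enumz n (Z.sub p1z (Z.mul (Zpos 3) a)) (Z.add (Z.mul a a) p1z))).
  by apply/mapP; exists a => //; apply: zrangeP; lia.
by rewrite map_f // -sv; apply: enumzP; [lia|lia|nia].
Qed.

Lemma size_simplez : size (simplez n) = n.
Proof. by rewrite size_rcons size_mkseq; lia. Qed.

Lemma size_coweightz : size (coweightz n) = n.
Proof. by rewrite size_rcons size_mkseq; lia. Qed.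

Lemma pairzC a b : pairz a b = pairz b a.
Proof. by case: a b => [|x a] [|y b] //=; rewrite Z.mul_comm dotzC. Qed.

Lemma vz_pairing_r m a b : size b = m.+1 ->
  pairing (vecz int m.+1 a) (vecz int m.+1 b) = zr int (pairz a b).
Proof. by move=> sb; rewrite pairingC vz_pairing // pairzC. Qed.

Lemma vz_foldr m (a : vecZ) (l : matZ) :
  vecz int m (foldr addz a l) = vecz int m a + \sum_(b <- l) vecz int m b.
Proof.
elim: l => [|b l IH]; first by rewrite big_nil addr0.
by rewrite big_cons /= vz_add IH addrCA.
Qed.

Lemma vz_unitz m (i : 'I_m) : vecz int m (unitz m i) = delta_mx 0 i.
Proof.
apply/rowP => j; rewrite !mxE nth_mkseq //= -[(j == i :> nat)]/(j == i).
by case: (j == i).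
Qed.

(** Writes a rank-one map as a matrix, so that identities between linear maps can be tested on unit
    vectors. *)
Lemma scale_pairing m (x r s : 'rV[int]_m.+1) :
  pairing x r *: s = x *m (gram int m *m r^T *m s).
Proof. by rewrite !mulmxA; apply/rowP => j; rewrite [RHS]mxE big_ord1 [LHS]mxE. Qed.

Definition al (i : 'I_n) : Lambda d := vz (nth [::] (simplez n) i).
Definition cow (i : 'I_n) : Lambda d := vz (nth [::] (coweightz n) i).

Variables (roots : matZ) (k : nat).
Hypothesis rootsE : rootz n = roots.

Definition posroots : seq (Lambda d) :=
  map vz (seq.filter (nonnegz (coweightz n)) roots).

Theorem root_base_of_check : base_ok d roots k -> root_base al cow posroots.
Proof.
rewrite /base_ok; set pos := seq.filter _ roots; set rho := foldr addz _ pos.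
set c := pairz _ rho; set v := iter k _ _.
case/andP=> /and5P[szs simR rootR dual span] /and5P[sgn uniR refR htR /andP[htP rig]].
move: szs; rewrite !all_cat => /and3P[sz_sim sz_cow sz_root].
have ssim i : (i < n)%N -> nth [::] (simplez n) i \in simplez n.
  by move=> i_n; rewrite mem_nth ?size_simplez.
have scow i : (i < n)%N -> nth [::] (coweightz n) i \in coweightz n.
  by move=> i_n; rewrite mem_nth ?size_coweightz.
have szsim i : (i < n)%N -> size (nth [::] (simplez n) i) = n.+1.
  by move=> /ssim /(allP sz_sim) /eqP.
have szcow i : (i < n)%N -> size (nth [::] (coweightz n) i) = n.+1.
  by move=> /scow /(allP sz_cow) /eqP.
have szroot b : b \in roots -> size b = n.+1 by move=> /(allP sz_root) /eqP.
have ge0E z : (0 <= zr int z) = Z.leb Z0 z by exact: zr_ge0.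
have isroot b : b \in roots -> is_root d (vz b).
  move=> bR; have := allP rootR b bR; case: Z.eqb_spec => // E1 /Z.eqb_spec E2.
  split; first by rewrite antiK_vz vz_pairing ?E1 //= size_nseq.
  by rewrite vz_pairing ?szroot // E2.
have inroots (x : Lambda d) : is_root d x -> lst x \in roots by rewrite -rootsE; exact: rootzP.
have nonnegE b : b \in roots -> nonneg cow (vz b) = nonnegz (coweightz n) b.
  move=> bR; apply/forallP/allP => [h p /(nthP [::])[i]|h i].
    rewrite size_coweightz => i_n <-; have := h (Ordinal i_n).
    by rewrite /cow vz_pairing ?szroot // ge0E.
  by rewrite /cow vz_pairing ?szroot // ge0E; apply/h/scow.
have simroots i : (i < n)%N -> nth [::] (simplez n) i \in roots.
  by move=> /ssim h; have := allP simR _ h; rewrite memzE.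
have sumpos : \sum_(b <- posroots) b = vz rho by rewrite /rho vz_sum.
have zof m : zr int (Z.of_nat m) = m%:R by exact: zr_nat.
split.
- by case: d12 => ->.
- by move=> i; apply/isroot/simroots.
- move=> i j; rewrite /al /cow vz_pairing ?szsim //.
  have := allP dual i; rewrite mem_iota ltn_ord => /(_ isT) /allP /(_ j).
  rewrite mem_iota ltn_ord => /(_ isT) /Z.eqb_spec ->.
  by rewrite -[(i == j :> nat)]/(i == j); case: (i == j).
(* Both sides of [rb_span] are linear in z; T is the matrix of the right-hand side, compared with d
   on the unit vectors. *)
- pose T := gram int n *m (antiK d)^T *m antiK d + \sum_j
    gram int n *m (d%:R *: cow j - pairing (antiK d) (cow j) *: antiK d)^T *m al j.
  have TE z : pairing z (antiK d) *: antiK d + \sum_j (d%:R * pairing z (cow j) -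
      pairing z (antiK d) * pairing (antiK d) (cow j)) *: al j = z *m T.
    rewrite mulmxDr -scale_pairing mulmx_sumr; congr (_ + _); apply: eq_bigr => j _.
    rewrite -scale_pairing pairingDr pairingNr !pairingZr; congr (_ *: _).
    by rewrite [X in _ - X]mulrC.
  suff Td : T = d%:R%:M by move=> z; rewrite TE Td mul_mx_scalar.
  apply/row_matrixP => i; rewrite [LHS]rowE -TE [RHS]rowE mul_mx_scalar -vz_unitz.
  have := allP span i; rewrite mem_iota ltn_ord => /(_ isT); rewrite eqvzE => /eqP E.
  have su : size (unitz n.+1 i) = n.+1 by rewrite size_mkseq.
  have sK : size (Kz n) = n.+1 by rewrite /= size_nseq.
  rewrite -zof -vz_scale E /spanz vz_foldr big_map vz_scale antiK_vz vz_pairing //.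
  congr (_ + _); rewrite (big_nth ([::], [::])) size_zip size_simplez size_coweightz minnn.
  rewrite big_mkord; apply: eq_bigr => j _.
  rewrite nth_zip ?size_simplez ?size_coweightz //; cbv [fst snd]; rewrite vz_scale zrB !zrM.
  by rewrite /cow !vz_pairing.
- move=> b; split=> [/mapP[a]|[hb nb]].
    rewrite mem_filter => /andP[na aR] ->; split; first exact: isroot.
    by rewrite nonnegE.
  rewrite -[b]lstK map_f // mem_filter inroots // andbT -nonnegE ?inroots //.
  by rewrite lstK.
- move=> b hb; have := allP sgn _ (inroots b hb); rewrite -nonnegE ?inroots // lstK.
  case: (nonneg cow b) => [_|h]; first by left.
  right; apply/forallP => i; have := allP h _ (scow i (ltn_ord i)).
  have sN : size (map Z.opp (lst b)) = n.+1 by rewrite size_map size_lst.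
  by rewrite -{2}[b]lstK -vz_opp /cow vz_pairing // ge0E.
- have -> : uniq posroots = uniq pos.
    apply: map_inj_in_uniq => a b; rewrite !mem_filter => /andP[_ aR] /andP[_ bR].
    by apply: vz_inj; apply: szroot.
  by rewrite filter_uniq // -uniqzE.
- move=> i b /mapP[a apos ->] ne; have := allP (allP refR _ (ssim i (ltn_ord i))) a apos.
  move: apos; rewrite mem_filter => /andP[_ aR].
  rewrite eqvzE; case: eqP => [E|_ h]; first by move: ne; rewrite E eqxx.
  apply/forallP => j; have := allP h _ (scow j (ltn_ord j)).
  have -> : refl (al i) (vz a) = vz (reflz (nth [::] (simplez n) i) a).
    by rewrite /reflz vz_add vz_scale /refl /al vz_pairing ?szroot.
  by rewrite /cow vz_pairing_r ?szcow // ge0E.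
- exists (zr int c); split=> [i|b /mapP[a apos ->]]; rewrite sumpos.
    by rewrite /al vz_pairing ?szsim //; have /Z.eqb_spec -> := allP htR _ (ssim i (ltn_ord i)).
  have aR : a \in roots by move: apos; rewrite mem_filter => /andP[].
  rewrite vz_pairing ?szroot // => /zr_eq /Z.eqb_spec E; have := allP htP a apos.
  rewrite E memzE => /(nthP [::])[i]; rewrite size_simplez => i_n <-.
  by exists (Ordinal i_n).
- exists k => i j.
  have dynE l : dynkin_vec al l = vz (iter l (dynkin_stepz (simplez n)) (foldr addz [::] (simplez n))).
    have sumE (F : vecZ -> vecZ) : \sum_(i < n) vz (F (nth [::] (simplez n) i)) =
        vz (foldr addz [::] (map F (simplez n))).
      by rewrite vz_sum -map_comp big_map (big_nth [::]) size_simplez big_mkord.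
    elim: l => [|l IH]; first by rewrite -[simplez n in RHS]map_id -sumE.
    rewrite [LHS]/= -/(dynkin_vec al l) IH [in RHS]/= -sumE; apply: eq_bigr => a _.
    by rewrite vz_scale /al vz_pairing ?szsim.
  rewrite dynE -/v /al !vz_pairing ?szsim // => /zr_eq E.
  move: rig; rewrite uniqzE => rig; apply/ord_inj/eqP.
  rewrite -(nth_uniq [::] _ _ rig) ?size_map ?size_simplez //.
  by rewrite !(nth_map [::]) ?size_simplez // E.
Qed.

End Enumeration.

Definition roots1 : matZ := Eval vm_compute in rootz 8.
Definition roots2 : matZ := Eval vm_compute in rootz 7.
Definition curves1 : matZ := Eval vm_compute in curvez 8.
Definition curves2 : matZ := Eval vm_compute in curvez 7.
Definition rootl (d : nat) : matZ := if d == 1 then roots1 else roots2.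
Definition curvel (d : nat) : matZ := if d == 1 then curves1 else curves2.

Lemma roots1E : rootz 8 = roots1. Proof. by vm_cast_no_check (erefl roots1). Qed.
Lemma roots2E : rootz 7 = roots2. Proof. by vm_cast_no_check (erefl roots2). Qed.
Lemma curves1E : curvez 8 = curves1. Proof. by vm_cast_no_check (erefl curves1). Qed.
Lemma curves2E : curvez 7 = curves2. Proof. by vm_cast_no_check (erefl curves2). Qed.

(** Three iterations of the diagram map already separate the simple roots, here and for d = 2. *)
Lemma base_ok1 : base_ok 1 roots1 3 = true. Proof. by vm_cast_no_check (erefl true). Qed.
Lemma base_ok2 : base_ok 2 roots2 3 = true. Proof. by vm_cast_no_check (erefl true). Qed.

(** * Certificates *)

(** As a map of points, y -> y + (c . y) u, a reflection whenever c . u = -2. *)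
Definition rk1z (c u : vecZ) : matZ :=
  mkseq (fun i => addz (unitz (size u) i) (scalez (nth Z0 c i) u)) (size u).

Definition lookupz (A : Type) (i : nat) (a : A) (s : seq (Z * A)) : A :=
  foldr (fun p acc => if Z.eqb p.1 (Z.of_nat i) then p.2 else acc) a s.

(** The identity with some entries replaced: [P] redirects an index to another unit vector, [F] to
    an arbitrary vector. *)
Definition colz (r : nat) (P : seq (Z * Z)) (F : seq (Z * vecZ)) : matZ :=
  mkseq (fun i => lookupz i (unitz r (Z.to_nat (lookupz i (Z.of_nat i) P))) F) r.

(* The representative of a conjugacy class: the basis of the orthogonal complement of the simple
   roots in [simple_part] is the identity in the columns [pivots]; [fan] refers to the list
   [symmetries] by index. *)
Record datum := Datum {
  simple_part : seq nat;
  pivots : seq nat;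
  zbasis : matZ;
  symmetries : seq matZ;
  fan : (Z -> matZ) -> tree }.

(** * Tables of representatives and dissections *)

Section Data.
Import List.ListNotations.
Local Open Scope list_scope.
Local Open Scope Z_scope.

(** Runs parallel to [subseqs (iota 0 7)]: at a subset J that is not a representative, the node i
    whose move w_J w_(J + i) is the next step on the path to its representative. *)
Definition steps2 : seq nat :=
[0;0;0;0;0;0;0;0;0;0;5;0;3;4;3;0;0;2;0;0;0;0;4;0;3;3;5;3;2;4;2;0;0;1;5;1;0;1;4;1;1;3;5;0;3;4;3;0;2;
2;5;2;0;2;4;2;2;3;2;3;2;4;2;0;0;0;0;0;0;0;0;0;0;0;0;0;0;4;0;0;0;0;5;0;0;0;4;0;0;3;0;3;0;4;0;0;0;1;1;
1;0;1;4;1;1;1;1;1;1;4;1;1;2;2;2;2;0;2;4;2;3;3;2;3;2;4;2;0]%N.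

Definition steps1 : seq nat :=
[0;0;0;0;0;0;0;0;0;0;0;0;5;5;0;0;0;0;6;0;0;0;5;0;3;4;3;4;3;5;3;0;0;2;0;2;0;0;5;0;4;4;0;0;5;5;4;0;3;
3;6;3;3;3;5;3;2;4;2;4;2;5;2;0;0;1;6;1;1;1;5;1;4;1;6;1;4;5;4;1;1;3;6;3;1;0;5;0;3;4;3;4;3;5;3;0;2;2;6;
2;2;2;5;2;4;2;6;2;4;5;4;2;2;3;2;3;2;3;2;3;2;4;2;4;2;5;2;0;0;0;0;0;0;0;0;0;0;0;0;0;5;5;0;0;0;0;0;0;0;
0;0;0;0;4;0;4;0;5;0;0;0;0;6;0;0;0;5;0;4;0;6;0;4;5;4;0;0;3;0;3;0;3;0;3;0;4;0;4;0;5;0;0;1;1;6;1;1;1;1;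
1;4;1;6;1;4;5;4;1;1;1;1;1;1;1;1;1;1;4;1;4;1;5;1;1;2;2;6;2;2;2;2;2;4;2;6;2;4;5;4;2;2;3;3;3;2;3;2;3;4;
4;2;4;2;5;2;0]%N.

(** Sorted by Picard rank and then by alpha, in step with [ranks2] and [values2]. *)
Definition data2 : seq datum := [
Datum [0;1;2;3;4;5;6]%N [1]%N [[-3;1;1;1;1;1;1;1]] []
(fun _ => Leaf [[-1]]);
Datum [0;1;2;3;4;6]%N [1;7]%N [[-3;1;1;1;1;1;1;0];[0;0;0;0;0;0;0;1]] []
(fun _ => Leaf [[-2;-3];[-1;0]]);
Datum [0;1;2;3;5;6]%N [1;6]%N [[-3;1;1;1;1;1;0;0];[0;0;0;0;0;0;1;1]] []
(fun _ => Leaf [[-3;-4];[-1;0]]);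
Datum [1;2;3;4;5;6]%N [2;0]%N [[0;-2;1;1;1;1;1;1];[1;-1;0;0;0;0;0;0]] []
(fun _ => Leaf [[-2;5];[0;1]]);
Datum [0;1;2;3;4;5]%N [0;1]%N [[1;0;0;0;0;0;0;0];[0;1;1;1;1;1;1;1]] []
(fun _ => Leaf [[1;0];[8;-3]]);
Datum [0;1;2;4;5;6]%N [1;5]%N [[-3;1;1;1;1;0;0;0];[0;0;0;0;0;1;1;1]] []
(fun _ => Leaf [[-4;-5];[-1;0]]);
Datum [0;2;3;4;5;6]%N [1;3]%N [[-2;1;1;0;0;0;0;0];[-1;0;0;1;1;1;1;1]] []
(fun _ => Leaf [[-3;-4];[-1;0]]);
Datum [0;1;3;4;5;6]%N [1;4]%N [[-3;1;1;1;0;0;0;0];[0;0;0;0;1;1;1;1]] []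
(fun _ => Leaf [[-5;-6];[-1;0]]);
Datum [0;1;2;3;6]%N [1;6;7]%N [[-3;1;1;1;1;1;0;0];[0;0;0;0;0;0;1;0];[0;0;0;0;0;0;0;1]] [rk1z [0;1;
-1] [0;-1;1];rk1z [2;-1;-1] [1;2;2]]
(fun g => Node [g 0;g 1]
[(1,[-4;1;2],Leaf [[-3;-4;-4];[-1;0;-2];[-1;-1;-1]])]);
Datum [0;1;2;3;4]%N [0;1;7]%N [[1;0;0;0;0;0;0;0];[0;1;1;1;1;1;1;0];[0;0;0;0;0;0;0;1]] [rk1z [1;2;1]
[3;-1;-3];rk1z [2;6;0] [2;-1;0]]
(fun g => Node [g 0;g 1]
[(1,[0;-1;0],Leaf [[1;0;-1];[3;-1;-1];[1;0;0]]);(1,[0;0;-1],Leaf [[1;0;0];[5;-2;0];[3;-1;-1]])]);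
Datum [0;1;2;3;5]%N [0;1;6]%N [[1;0;0;0;0;0;0;0];[0;1;1;1;1;1;0;0];[0;0;0;0;0;0;1;1]] [colz 3 []
[(0,[8;-3;-3]);(1,[15;-6;-5]);(2,[6;-2;-3])]]
(fun g => Node [g 0]
[(1,[0;-1;0],Leaf [[2;0;-1];[3;-1;-1];[1;0;0]]);(1,[0;0;-1],Leaf [[1;0;0];[5;-2;0];[3;-1;-1]]);
(1,[1;0;2],Leaf [[2;0;-1];[10;-3;-5];[3;-1;-1]])]);
Datum [1;2;3;5;6]%N [2;0;6]%N [[0;-2;1;1;1;1;0;0];[1;-1;0;0;0;0;0;0];[0;0;0;0;0;0;1;1]] [rk1z [4;2;
2] [-1;2;-1];rk1z [2;0;-2] [0;-1;1]]
(fun g => Node [g 0;g 1]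
[(1,[2;2;3],Leaf [[-1;4;-2];[-2;5;-2];[-1;3;-1]])]);
Datum [2;3;4;5;6]%N [1;0;3]%N [[0;1;-1;0;0;0;0;0];[1;0;-1;0;0;0;0;0];[0;0;-1;1;1;1;1;1]] [rk1z [0;1;
3] [-1;4;-2];rk1z [1;1;2] [-2;2;-1]]
(fun g => Node [g 0;g 1]
[(1,[1;1;1],Leaf [[-1;1;0];[-2;3;-1];[-1;3;-1]])]);
Datum [0;1;3;4;6]%N [1;4;7]%N [[-3;1;1;1;0;0;0;0];[0;0;0;0;1;1;1;0];[0;0;0;0;0;0;0;1]] [rk1z [2;-1;
-1] [1;1;3];rk1z [2;-2;0] [1;2;0]]
(fun g => Node [g 0;g 1]
[(1,[-6;3;2],Leaf [[-5;-6;-6];[-3;-2;-6];[-1;-1;-1]]);(1,[-6;4;1],Leaf [[-5;-6;-6];[-3;-4;-2];[-1;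
-1;-1]])]);
Datum [0;1;2;4;5]%N [0;1;5]%N [[1;0;0;0;0;0;0;0];[0;1;1;1;1;0;0;0];[0;0;0;0;0;1;1;1]] [rk1z [1;0;3]
[1;0;-1];rk1z [1;2;1] [6;-3;-2]]
(fun g => Node [g 0;g 1]
[(1,[0;-1;0],Leaf [[2;0;-1];[3;-1;-1];[1;0;0]]);(1,[0;0;-1],Leaf [[1;0;0];[2;-1;0];[3;-1;-1]])]);
Datum [0;1;3;5;6]%N [1;4;6]%N [[-3;1;1;1;0;0;0;0];[0;0;0;0;1;1;0;0];[0;0;0;0;0;0;1;1]] [rk1z [3;-1;
-2] [1;1;2];rk1z [0;1;-1] [0;-1;1]]
(fun g => Node [g 0;g 1]
[(1,[0;-1;0],Leaf [[-2;0;-3];[-1;-1;-1];[-1;0;0]])]);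
Datum [0;2;3;5;6]%N [1;3;6]%N [[-2;1;1;0;0;0;0;0];[-1;0;0;1;1;1;0;0];[0;0;0;0;0;0;1;1]] [rk1z [2;0;
-2] [1;1;2];rk1z [2;-2;0] [0;1;0]]
(fun g => Node [g 0;g 1]
[(1,[-4;1;2],Leaf [[-3;-4;-4];[-1;-2;-1];[-1;-1;-1]]);(1,[-4;0;3],Leaf [[-3;-4;-4];[-3;-2;-4];[-1;
-1;-1]])]);
Datum [1;2;3;6]%N [2;0;6;7]%N [[0;-2;1;1;1;1;0;0];[1;-1;0;0;0;0;0;0];[0;0;0;0;0;0;1;0];[0;0;0;0;0;0;
0;1]] [colz 4 [(2,3);(3,2)] [];rk1z [2;0;-1;-1] [0;-1;1;1];rk1z [4;2;1;1] [-1;2;-1;-1]]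
(fun g => Node [g 0;g 1;g 2]
[(1,[-2;0;0;1],Leaf [[-1;4;-2;-2];[0;1;0;0];[-1;3;0;-2];[-1;3;-1;-1]])]);
Datum [0;1;2;3]%N [0;1;6;7]%N [[1;0;0;0;0;0;0;0];[0;1;1;1;1;1;0;0];[0;0;0;0;0;0;1;0];[0;0;0;0;0;0;0;
1]] [rk1z [2;5;0;1] [2;-1;0;-1];colz 4 [] [(0,[4;-1;-1;-3]);(1,[5;-1;0;-5]);(2,[1;0;-1;-1]);(3,[3;
-1;-1;-2])]]
(fun g => Node [g 0;g 1]
[(1,[0;-1;0;0],Leaf [[1;0;0;0];[3;-1;-1;-1];[1;0;-1;0];[1;0;0;-1]]);(1,[0;0;-1;0],Node [g 0]
[(3,[0;-1;1;0],Leaf [[1;0;0;0];[3;-1;-1;-1];[5;-2;0;0];[1;0;0;-1]]);(2,[1;1;1;1],Leaf [[1;0;0;-1];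
[3;-1;0;-2];[3;-1;-1;-1];[5;-2;0;0]])])]);
Datum [0;1;2;4]%N [0;1;5;7]%N [[1;0;0;0;0;0;0;0];[0;1;1;1;1;0;0;0];[0;0;0;0;0;1;1;0];[0;0;0;0;0;0;0;
1]] [rk1z [1;0;2;1] [1;0;-1;-1];rk1z [1;2;0;1] [2;-1;0;-2];rk1z [2;4;2;0] [2;-1;-1;0]]
(fun g => Node [g 0;g 1;g 2]
[(1,[0;-1;0;0],Node [g 0]
[(1,[0;1;0;-1],Leaf [[1;0;0;0];[3;-1;-1;-1];[2;0;-1;0];[1;0;0;-1]])]);(1,[0;0;-1;0],Node [g 1]
[(1,[0;0;1;-1],Leaf [[1;0;0;0];[2;-1;0;0];[3;-1;-1;-1];[1;0;0;-1]])]);(1,[0;0;0;-1],Node [g 2]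
[(2,[0;-1;0;1],Leaf [[1;0;0;0];[3;-1;-1;-1];[2;0;-1;0];[2;-1;0;0]]);(1,[1;0;2;1],Leaf [[2;0;-1;0];
[6;-2;-3;0];[3;-1;-1;-1];[2;-1;0;0]])])]);
Datum [0;1;3;5]%N [0;1;4;6]%N [[1;0;0;0;0;0;0;0];[0;1;1;1;0;0;0;0];[0;0;0;0;1;1;0;0];[0;0;0;0;0;0;1;
1]] [rk1z [1;1;1;1] [6;-2;-3;-3];colz 4 [(2,3);(3,2)] [];rk1z [1;3;0;0] [1;-1;0;0]]
(fun g => Node [g 0;g 1;g 2]
[(1,[0;0;-1;0],Node [g 2]
[(3,[0;-1;1;0],Leaf [[2;0;0;-1];[3;-1;-1;-1];[3;-1;0;0];[1;0;0;0]]);(1,[1;0;1;2],Leaf [[2;0;0;-1];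
[6;-2;0;-3];[3;-1;-1;-1];[3;-1;0;0]])]);(1,[0;-1;0;0],Node [g 1]
[(1,[1;1;0;2],Leaf [[2;0;0;-1];[3;-1;-1;-1];[2;0;-1;-1];[1;0;0;0]])]);(1,[1;0;0;2],Node [g 0]
[(2,[-1;0;-1;-2],Leaf [[2;0;0;-1];[6;-2;0;-3];[3;-1;-1;-1];[2;0;-1;-1]]);(1,[1;3;0;0],Leaf [[6;-2;0;
-3];[2;0;-1;-1];[12;-4;-3;-6];[3;-1;-1;-1]])])]);
Datum [0;1;3;4]%N [0;1;4;7]%N [[1;0;0;0;0;0;0;0];[0;1;1;1;0;0;0;0];[0;0;0;0;1;1;1;0];[0;0;0;0;0;0;0;
1]] [colz 4 [(1,2);(2,1)] [];rk1z [1;1;1;1] [3;-1;-1;-3];rk1z [1;1;2;0] [3;-1;-2;0];rk1z [1;0;3;0]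
[1;0;-1;0]]
(fun g => Node [g 0;g 1;g 2]
[(1,[0;-1;0;0],Node [g 3]
[(2,[0;1;-1;0],Leaf [[1;0;0;0];[3;-1;-1;-1];[3;0;-1;0];[1;0;0;-1]]);(1,[1;1;1;1],Leaf [[1;0;0;-1];
[3;-1;-1;-1];[2;0;-1;-1];[3;0;-1;0]])]);(1,[0;0;0;-1],Node [g 0;g 2]
[(1,[0;-1;0;1],Leaf [[1;0;0;0];[3;-1;-1;-1];[2;0;-1;0];[3;-1;-1;0]])])]);
Datum [2;3;5;6]%N [2;0;3;6]%N [[0;-1;1;0;0;0;0;0];[1;-1;0;0;0;0;0;0];[0;-1;0;1;1;1;0;0];[0;0;0;0;0;
0;1;1]] [rk1z [1;0;1;-2] [0;-1;0;1];rk1z [1;1;2;0] [-1;1;-1;0];rk1z [1;-1;-2;-2] [0;-2;1;1];rk1z [1;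
0;-1;0] [-1;-1;1;0]]
(fun g => Node [g 0;g 1;g 2]
[(1,[0;2;2;3],Node [g 3;g 1]
[(1,[1;0;0;-1],Leaf [[-2;5;-2;-2];[-2;4;-1;-2];[-1;3;-1;-1];[-3;9;-3;-4]])]);(1,[1;2;2;2],Leaf [[-2;
5;-2;-2];[-2;4;-1;-2];[-2;3;-1;-1];[-1;3;-1;-1]])]);
Datum [0;3;5;6]%N [1;0;4;6]%N [[0;1;1;-2;0;0;0;0];[1;0;0;-1;0;0;0;0];[0;0;0;0;1;1;0;0];[0;0;0;0;0;0;
1;1]] [rk1z [2;0;-1;-1] [0;-2;1;1];colz 4 [(2,3);(3,2)] [];rk1z [0;1;1;2] [-1;3;-1;-2];rk1z [2;0;0;
-2] [0;-1;0;1];rk1z [2;1;0;1] [-1;1;0;-1]]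
(fun g => Node [g 0;g 1;g 2]
[(1,[0;0;-1;0],Node [g 3;g 4]
[(1,[-2;0;1;1],Leaf [[-1;4;0;-2];[0;1;0;0];[-1;3;-1;-1];[-1;3;0;-1]])])]);
Datum [0;1;2]%N [0;1;5;6;7]%N [[1;0;0;0;0;0;0;0];[0;1;1;1;1;0;0;0];[0;0;0;0;0;1;0;0];[0;0;0;0;0;0;1;
0];[0;0;0;0;0;0;0;1]] [rk1z [1;2;0;0;1] [2;-1;0;0;-2];rk1z [1;0;1;1;1] [1;0;-1;-1;-1];colz 5 [(2,3);
(3,2)] [];colz 5 [(2,4);(4,2)] [];colz 5 [(3,4);(4,3)] []]
(fun g => Node [g 0;g 1;g 2;g 3]
[(1,[0;-1;0;0;0],Node [g 1;g 2;g 3]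
[(1,[0;1;-1;0;0],Leaf [[1;0;0;0;0];[3;-1;-1;-1;-1];[3;0;-1;-1;-1];[1;0;0;-1;0];[1;0;0;0;-1]])]);
(1,[0;0;-1;0;0],Node [g 4;g 0]
[(2,[0;-1;1;0;0],Leaf [[1;0;0;0;0];[3;-1;-1;-1;-1];[4;-1;0;-2;-2];[1;0;0;-1;0];[1;0;0;0;-1]]);(1,[0;
0;1;-1;0],Node [g 0]
[(1,[0;0;0;1;-1],Leaf [[1;0;0;0;0];[2;-1;0;0;0];[3;-1;-1;-1;-1];[4;-1;0;-2;-2];[1;0;0;0;-1]])])])]);
Datum [0;1;3]%N [0;1;4;6;7]%N [[1;0;0;0;0;0;0;0];[0;1;1;1;0;0;0;0];[0;0;0;0;1;1;0;0];[0;0;0;0;0;0;1;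
0];[0;0;0;0;0;0;0;1]] [rk1z [1;0;2;0;1] [1;0;-1;0;-1];rk1z [1;3;0;0;0] [1;-1;0;0;0];colz 5 []
[(0,[3;-1;0;-1;-2]);(1,[3;-1;0;0;-3]);(3,[1;0;0;-1;-1]);(4,[2;-1;0;-1;-1])];rk1z [1;0;2;1;0] [1;0;
-1;-1;0];colz 5 [(3,4);(4,3)] [];rk1z [2;3;2;0;1] [2;-1;-1;0;-1]]
(fun g => Node [g 0;g 1;g 2]
[(1,[0;-1;0;0;0],Node [g 0;g 3]
[(2,[0;1;-1;0;0],Leaf [[1;0;0;0;0];[3;-1;-1;-1;-1];[2;0;-1;0;0];[1;0;0;-1;0];[1;0;0;0;-1]]);(1,[1;1;
0;1;1],Leaf [[1;0;0;0;-1];[3;-1;-1;-1;-1];[2;0;-1;-1;-1];[1;0;0;-1;0];[2;0;-1;0;0]])]);(1,[0;0;-1;0;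
0],Node [g 4;g 2]
[(1,[0;-1;1;0;0],Leaf [[1;0;0;0;0];[3;-1;-1;-1;-1];[3;-1;0;-1;-1];[1;0;0;-1;0];[1;0;0;0;-1]]);(1,[0;
0;1;-1;0],Node [g 1]
[(2,[0;-1;0;1;0],Leaf [[1;0;0;0;0];[3;-1;-1;-1;-1];[3;-1;0;-1;-1];[3;-1;0;0;0];[1;0;0;0;-1]]);(1,[1;
1;0;1;1],Leaf [[1;0;0;0;-1];[2;-1;0;0;-1];[3;-1;-1;-1;-1];[3;-1;0;-1;-1];[3;-1;0;0;0]])])]);(1,[0;0;
0;-1;0],Node [g 1;g 5]
[(6,[0;-1;0;1;0],Node [g 0]
[(1,[0;0;0;1;-1],Leaf [[1;0;0;0;0];[3;-1;-1;-1;-1];[2;0;-1;0;0];[6;-2;-3;0;0];[1;0;0;0;-1]])]);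
(3,[1;1;0;1;1],Leaf [[1;0;0;0;-1];[2;-1;0;0;-1];[3;-1;-1;0;-2];[3;-1;-1;-1;-1];[6;-2;-3;0;0]]);
(4,[0;0;-1;1;0],Node [g 1]
[(1,[0;-6;4;2;0],Leaf [[1;0;0;0;0];[3;-1;-1;-1;-1];[6;-2;-3;0;0];[3;-1;0;0;0];[1;0;0;0;-1]]);(1,[3;
3;4;-1;3],Leaf [[1;0;0;0;-1];[2;-1;0;0;-1];[3;-1;-1;-1;-1];[6;-2;-3;0;0];[3;-1;0;0;0]])])])]);
Datum [0;2;4]%N [0;1;3;5;7]%N [[1;0;0;0;0;0;0;0];[0;1;1;0;0;0;0;0];[0;0;0;1;1;0;0;0];[0;0;0;0;0;1;1;
0];[0;0;0;0;0;0;0;1]] [rk1z [2;2;2;2;0] [2;-1;-1;-1;0];colz 5 [(1,2);(2,1)] [];rk1z [1;0;0;2;1] [1;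
0;0;-1;-1];colz 5 [(2,3);(3,2)] [];colz 5 [(1,3);(3,1)] []]
(fun g => Node [g 0;g 1;g 2;g 3]
[(1,[0;0;-1;0;0],Node [g 2;g 4]
[(1,[0;0;1;0;-1],Node [g 4]
[(1,[1;0;0;2;1],Leaf [[2;0;0;-1;0];[2;-1;0;-1;0];[3;-1;-1;-1;-1];[1;0;0;0;-1];[1;0;0;0;0]])])]);
(1,[0;0;0;0;-1],Node [g 0;g 3;g 1]
[(1,[0;0;-1;0;1],Node [g 4]
[(1,[1;0;1;2;0],Leaf [[2;0;0;-1;0];[2;-1;0;-1;0];[3;-1;-1;-1;-1];[1;0;0;0;0];[3;-1;-1;-1;0]])]);
(1,[1;0;0;2;1],Node [g 0;g 1]
[(1,[-1;0;-1;-2;0],Leaf [[2;0;0;-1;0];[2;-1;0;-1;0];[3;-1;-1;-1;-1];[4;-1;-1;-2;0];[3;-1;-1;-1;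
0]])])])]);
Datum [3;5;6]%N [1;0;3;4;6]%N [[0;1;-1;0;0;0;0;0];[1;0;-1;0;0;0;0;0];[0;0;-1;1;0;0;0;0];[0;0;0;0;1;
1;0;0];[0;0;0;0;0;0;1;1]] [rk1z [1;0;0;0;-1] [-1;-1;1;0;1];colz 5 [(3,4);(4,3)] [];rk1z [1;1;0;1;1]
[-2;2;0;-1;-1];rk1z [1;0;1;-1;-1] [0;-2;0;1;1];rk1z [1;0;0;-1;0] [-1;-1;1;1;0];rk1z [0;1;0;1;2] [-1;
3;-1;-1;-2];rk1z [0;0;1;-1;0] [1;-1;-1;1;0]]
(fun g => Node [g 0;g 1;g 2;g 3]
[(1,[-1;0;-1;0;1],Node [g 4;g 5;g 6]
[(1,[1;0;0;0;-1],Leaf [[-1;3;0;-1;-1];[0;1;0;0;0];[-1;3;-1;-1;-1];[-1;2;0;0;-1];[-1;5;-1;-1;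
-2]])])]);
Datum [0;1]%N [0;1;4;5;6;7]%N [[1;0;0;0;0;0;0;0];[0;1;1;1;0;0;0;0];[0;0;0;0;1;0;0;0];[0;0;0;0;0;1;0;
0];[0;0;0;0;0;0;1;0];[0;0;0;0;0;0;0;1]] [colz 6 [(2,3);(3,2)] [];rk1z [1;0;1;0;1;1] [1;0;-1;0;-1;
-1];rk1z [1;3;0;0;0;0] [1;-1;0;0;0;0];colz 6 [] [(0,[3;-1;0;0;-1;-2]);(1,[3;-1;0;0;0;-3]);(4,[1;0;0;
0;-1;-1]);(5,[2;-1;0;0;-1;-1])];colz 6 [(2,4);(4,2)] [];colz 6 [(2,5);(5,2)] [];colz 6 [(3,4);
(4,3)] [];colz 6 [(3,5);(5,3)] [];rk1z [1;0;0;1;1;1] [1;0;0;-1;-1;-1];colz 6 [(4,5);(5,4)] []]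
(fun g => Node [g 0;g 1;g 2;g 3]
[(1,[0;-1;0;0;0;0],Node [g 0;g 4;g 5;g 1]
[(1,[0;1;-1;0;0;0],Node [g 6;g 7;g 8]
[(1,[0;0;1;-1;0;0],Leaf [[1;0;0;0;0;0];[3;-1;-1;-1;-1;-1];[3;0;-1;-1;-1;-1];[3;0;0;-1;-1;-1];[1;0;0;
0;-1;0];[1;0;0;0;0;-1]])])]);(1,[0;0;-1;0;0;0],Node [g 9;g 7;g 3]
[(1,[0;-1;1;0;0;0],Node [g 7;g 8;g 6]
[(1,[0;1;0;-1;0;0],Leaf [[1;0;0;0;0;0];[3;-1;-1;-1;-1;-1];[3;-1;0;-1;-1;-1];[3;0;0;-1;-1;-1];[1;0;0;
0;-1;0];[1;0;0;0;0;-1]])]);(1,[0;0;1;-1;0;0],Node [g 9;g 3]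
[(1,[0;-1;0;1;0;0],Leaf [[1;0;0;0;0;0];[3;-1;-1;-1;-1;-1];[3;-1;0;-1;-1;-1];[3;-1;0;0;-1;-1];[1;0;0;
0;-1;0];[1;0;0;0;0;-1]]);(1,[2;3;0;1;1;1],Node [g 9]
[(2,[-1;-2;0;0;-1;0],Leaf [[3;-1;0;0;-1;-2];[2;-1;0;0;0;-1];[3;-1;-1;-1;-1;-1];[3;-1;0;-1;-1;-1];[4;
-2;0;0;-1;-1];[3;-1;0;0;-1;-1]]);(1,[-1;-3;0;0;0;0],Leaf [[3;-1;0;0;-1;-2];[4;-2;0;0;-1;-1];[3;-1;
-1;-1;-1;-1];[3;-1;0;-1;-1;-1];[3;-1;0;0;-2;-1];[3;-1;0;0;-1;-1]])])])])]);
Datum [0;2]%N [0;1;3;5;6;7]%N [[1;0;0;0;0;0;0;0];[0;1;1;0;0;0;0;0];[0;0;0;1;1;0;0;0];[0;0;0;0;0;1;0;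
0];[0;0;0;0;0;0;1;0];[0;0;0;0;0;0;0;1]] [colz 6 [(3,4);(4,3)] [];colz 6 [(3,5);(5,3)] [];rk1z [1;0;
0;1;1;1] [1;0;0;-1;-1;-1];rk1z [1;1;1;0;0;1] [2;-1;-1;0;0;-2];rk1z [1;0;2;1;0;0] [1;0;-1;-1;0;0];
rk1z [1;0;2;0;0;1] [1;0;-1;0;0;-1];rk1z [1;0;2;0;1;0] [1;0;-1;0;-1;0];rk1z [1;1;1;0;1;0] [2;-1;-1;0;
-2;0];colz 6 [(4,5);(5,4)] [];colz 6 [(1,2);(2,1)] []]
(fun g => Node [g 0;g 1;g 2;g 3;g 4]
[(1,[0;-1;0;0;0;0],Node [g 5;g 4;g 6;g 2]
[(1,[0;1;-1;0;0;0],Node [g 2;g 1;g 0]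
[(1,[0;0;1;-1;0;0],Leaf [[1;0;0;0;0;0];[3;-1;-1;-1;-1;-1];[3;0;-1;-1;-1;-1];[3;0;0;-1;-1;-1];[1;0;0;
0;-1;0];[1;0;0;0;0;-1]])]);(1,[0;1;0;-1;0;0],Node [g 5;g 6]
[(2,[0;0;-1;1;0;0],Leaf [[1;0;0;0;0;0];[3;-1;-1;-1;-1;-1];[3;0;-1;-1;-1;-1];[2;0;-1;0;0;0];[1;0;0;0;
-1;0];[1;0;0;0;0;-1]]);(1,[1;0;0;1;1;1],Leaf [[1;0;0;0;0;-1];[3;-1;-1;-1;-1;-1];[2;0;-1;0;-1;-1];[3;
0;-1;-1;-1;-1];[1;0;0;0;-1;0];[2;0;-1;0;0;0]])])]);(1,[0;0;0;-1;0;0],Node [g 7;g 8;g 6]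
[(2,[0;-1;0;1;0;0],Node [g 8;g 6]
[(1,[0;2;-2;0;0;0],Leaf [[1;0;0;0;0;0];[3;-1;-1;-1;-1;-1];[2;0;-1;0;0;0];[2;-1;-1;0;0;0];[1;0;0;0;
-1;0];[1;0;0;0;0;-1]]);(1,[1;2;0;-1;1;1],Leaf [[1;0;0;0;0;-1];[3;-1;-1;-1;-1;-1];[2;0;-1;0;-1;-1];
[2;-1;-1;0;0;0];[1;0;0;0;-1;0];[2;0;-1;0;0;0]])]);(1,[1;0;0;1;1;1],Node [g 9;g 3;g 7]
[(1,[-1;-2;0;1;-1;-1],Leaf [[1;0;0;0;0;-1];[3;-1;-1;-1;-1;-1];[2;0;-1;0;-1;-1];[2;-1;-1;0;0;0];[1;0;
0;0;-1;0];[4;-1;-1;0;-2;-2]])])])]);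
Datum [0]%N [0;1;3;4;5;6;7]%N [[1;0;0;0;0;0;0;0];[0;1;1;0;0;0;0;0];[0;0;0;1;0;0;0;0];[0;0;0;0;1;0;0;
0];[0;0;0;0;0;1;0;0];[0;0;0;0;0;0;1;0];[0;0;0;0;0;0;0;1]] [colz 7 [(2,3);(3,2)] [];colz 7 [(2,4);
(4,2)] [];colz 7 [(2,5);(5,2)] [];colz 7 [(2,6);(6,2)] [];rk1z [1;0;1;0;0;1;1] [1;0;-1;0;0;-1;-1];
rk1z [1;2;0;0;0;0;1] [1;-1;0;0;0;0;-1];colz 7 [(3,4);(4,3)] [];colz 7 [(3,5);(5,3)] [];colz 7
[(3,6);(6,3)] [];rk1z [1;0;0;1;0;1;1] [1;0;0;-1;0;-1;-1];colz 7 [(4,5);(5,4)] [];colz 7 [(4,6);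
(6,4)] [];rk1z [1;0;0;0;1;1;1] [1;0;0;0;-1;-1;-1];rk1z [1;2;0;0;1;0;0] [1;-1;0;0;-1;0;0];rk1z [1;2;
0;0;0;1;0] [1;-1;0;0;0;-1;0]]
(fun g => Node [g 0;g 1;g 2;g 3;g 4;g 5]
[(1,[0;-1;0;0;0;0;0],Node [g 0;g 1;g 2;g 3;g 4]
[(1,[0;1;-1;0;0;0;0],Node [g 6;g 7;g 8;g 9]
[(1,[0;0;1;-1;0;0;0],Node [g 10;g 11;g 12]
[(1,[0;0;0;1;-1;0;0],Leaf [[1;0;0;0;0;0;0];[3;-1;-1;-1;-1;-1;-1];[3;0;-1;-1;-1;-1;-1];[3;0;0;-1;-1;
-1;-1];[3;0;0;0;-1;-1;-1];[1;0;0;0;0;-1;0];[1;0;0;0;0;0;-1]])])])]);(1,[0;0;-1;0;0;0;0],Node [g 6;g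
7;g 8;g 9;g 5]
[(1,[0;-1;1;0;0;0;0],Node [g 6;g 7;g 8;g 9]
[(1,[0;1;0;-1;0;0;0],Node [g 10;g 11;g 12]
[(1,[0;0;0;1;-1;0;0],Leaf [[1;0;0;0;0;0;0];[3;-1;-1;-1;-1;-1;-1];[3;-1;0;-1;-1;-1;-1];[3;0;0;-1;-1;
-1;-1];[3;0;0;0;-1;-1;-1];[1;0;0;0;0;-1;0];[1;0;0;0;0;0;-1]])])]);(1,[0;0;1;-1;0;0;0],Node [g 5;g
13;g 14;g 12]
[(1,[0;-1;0;1;0;0;0],Node [g 12;g 11;g 10]
[(1,[0;1;0;0;-1;0;0],Leaf [[1;0;0;0;0;0;0];[3;-1;-1;-1;-1;-1;-1];[3;-1;0;-1;-1;-1;-1];[3;-1;0;0;-1;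
-1;-1];[3;0;0;0;-1;-1;-1];[1;0;0;0;0;-1;0];[1;0;0;0;0;0;-1]])]);(1,[0;0;0;1;-1;0;0],Node [g 5;g 14]
[(2,[0;-1;0;0;1;0;0],Leaf [[1;0;0;0;0;0;0];[3;-1;-1;-1;-1;-1;-1];[3;-1;0;-1;-1;-1;-1];[3;-1;0;0;-1;
-1;-1];[2;-1;0;0;0;0;0];[1;0;0;0;0;-1;0];[1;0;0;0;0;0;-1]]);(1,[1;0;0;0;1;1;1],Leaf [[1;0;0;0;0;0;
-1];[2;-1;0;0;0;-1;-1];[3;-1;-1;-1;-1;-1;-1];[3;-1;0;-1;-1;-1;-1];[3;-1;0;0;-1;-1;-1];[1;0;0;0;0;-1;
0];[2;-1;0;0;0;0;0]])])])])]);
Datum []%N [0;1;2;3;4;5;6;7]%N [[1;0;0;0;0;0;0;0];[0;1;0;0;0;0;0;0];[0;0;1;0;0;0;0;0];[0;0;0;1;0;0;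
0;0];[0;0;0;0;1;0;0;0];[0;0;0;0;0;1;0;0];[0;0;0;0;0;0;1;0];[0;0;0;0;0;0;0;1]] [colz 8 [(1,2);(2,1)]
[];colz 8 [(1,3);(3,1)] [];colz 8 [(1,4);(4,1)] [];colz 8 [(1,5);(5,1)] [];colz 8 [(1,6);(6,1)] [];
colz 8 [(1,7);(7,1)] [];rk1z [1;1;0;0;0;0;1;1] [1;-1;0;0;0;0;-1;-1];colz 8 [(2,3);(3,2)] [];colz 8
[(2,4);(4,2)] [];colz 8 [(2,5);(5,2)] [];colz 8 [(2,6);(6,2)] [];colz 8 [(2,7);(7,2)] [];rk1z [1;0;
1;0;0;0;1;1] [1;0;-1;0;0;0;-1;-1];colz 8 [(3,4);(4,3)] [];colz 8 [(3,5);(5,3)] [];colz 8 [(3,6);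
(6,3)] [];colz 8 [(3,7);(7,3)] [];rk1z [1;0;0;1;0;0;1;1] [1;0;0;-1;0;0;-1;-1];colz 8 [(4,5);(5,4)]
[];colz 8 [(4,6);(6,4)] [];colz 8 [(4,7);(7,4)] [];rk1z [1;0;0;0;1;0;1;1] [1;0;0;0;-1;0;-1;-1];colz
8 [(5,6);(6,5)] [];colz 8 [(5,7);(7,5)] [];rk1z [1;0;0;0;0;1;1;1] [1;0;0;0;0;-1;-1;-1]]
(fun g => Node [g 0;g 1;g 2;g 3;g 4;g 5;g 6]
[(1,[0;-1;0;0;0;0;0;0],Node [g 7;g 8;g 9;g 10;g 11;g 12]
[(1,[0;1;-1;0;0;0;0;0],Node [g 13;g 14;g 15;g 16;g 17]
[(1,[0;0;1;-1;0;0;0;0],Node [g 18;g 19;g 20;g 21]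
[(1,[0;0;0;1;-1;0;0;0],Node [g 22;g 23;g 24]
[(1,[0;0;0;0;1;-1;0;0],Leaf [[1;0;0;0;0;0;0;0];[3;-1;-1;-1;-1;-1;-1;-1];[3;0;-1;-1;-1;-1;-1;-1];[3;
0;0;-1;-1;-1;-1;-1];[3;0;0;0;-1;-1;-1;-1];[3;0;0;0;0;-1;-1;-1];[1;0;0;0;0;0;-1;0];[1;0;0;0;0;0;0;
-1]])])])])])])].

Definition values2 : seq Q :=
[Qmake 1 1;Qmake 1 1;Qmake 2 1;Qmake 2 1;Qmake 7 3;Qmake 3 1;Qmake 3 1;Qmake 4 1;Qmake 1 1;Qmake 5
3;Qmake 11 6;Qmake 2 1;Qmake 9 4;Qmake 5 2;Qmake 8 3;Qmake 3 1;Qmake 3 1;Qmake 2 3;Qmake 11 12;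
Qmake 11 9;Qmake 13 9;Qmake 19 12;Qmake 5 3;Qmake 2 1;Qmake 17 36;Qmake 2 3;Qmake 13 18;Qmake 1 1;
Qmake 7 30;Qmake 13 45;Qmake 1 10;Qmake 1 30].

Definition ranks2 : seq nat :=
[1;2;2;2;2;2;2;2;3;3;3;3;3;3;3;3;3;4;4;4;4;4;4;4;5;5;5;5;6;6;7;8]%N.

Definition data1 : seq datum := [
Datum [0;1;2;3;4;5;6;7]%N [1]%N [[-3;1;1;1;1;1;1;1;1]] []
(fun _ => Leaf [[-1]]);
Datum [0;1;2;3;4;5;7]%N [1;8]%N [[-3;1;1;1;1;1;1;1;0];[0;0;0;0;0;0;0;0;1]] []
(fun _ => Leaf [[-3;-4];[-1;0]]);
Datum [0;1;2;3;4;6;7]%N [1;7]%N [[-3;1;1;1;1;1;1;0;0];[0;0;0;0;0;0;0;1;1]] []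
(fun _ => Leaf [[-5;-6];[-1;0]]);
Datum [1;2;3;4;5;6;7]%N [2;0]%N [[0;-2;1;1;1;1;1;1;1];[1;-1;0;0;0;0;0;0;0]] []
(fun _ => Leaf [[-4;11];[0;1]]);
Datum [0;1;2;3;4;5;6]%N [0;1]%N [[1;0;0;0;0;0;0;0;0];[0;1;1;1;1;1;1;1;1]] []
(fun _ => Leaf [[1;0];[17;-6]]);
Datum [0;1;2;3;5;6;7]%N [1;6]%N [[-3;1;1;1;1;1;0;0;0];[0;0;0;0;0;0;1;1;1]] []
(fun _ => Leaf [[-7;-8];[-1;0]]);
Datum [0;2;3;4;5;6;7]%N [1;3]%N [[-2;1;1;0;0;0;0;0;0];[-1;0;0;1;1;1;1;1;1]] []
(fun _ => Leaf [[-7;-8];[-1;0]]);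
Datum [0;1;2;4;5;6;7]%N [1;5]%N [[-3;1;1;1;1;0;0;0;0];[0;0;0;0;0;1;1;1;1]] []
(fun _ => Leaf [[-9;-10];[-1;0]]);
Datum [0;1;3;4;5;6;7]%N [1;4]%N [[-3;1;1;1;0;0;0;0;0];[0;0;0;0;1;1;1;1;1]] []
(fun _ => Leaf [[-11;-12];[-1;0]]);
Datum [0;1;2;3;4;7]%N [1;7;8]%N [[-3;1;1;1;1;1;1;0;0];[0;0;0;0;0;0;0;1;0];[0;0;0;0;0;0;0;0;1]]
[rk1z [0;1;-1] [0;-1;1];rk1z [3;-2;-1] [1;2;1]]
(fun g => Node [g 0;g 1]
[(1,[-6;2;3],Leaf [[-5;-6;-6];[-4;-3;-6];[-1;-1;-1]])]);
Datum [1;2;3;4;5;7]%N [2;0;8]%N [[0;-2;1;1;1;1;1;1;0];[1;-1;0;0;0;0;0;0;0];[0;0;0;0;0;0;0;0;1]]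
[rk1z [1;0;-1] [0;-1;2];rk1z [5;2;1] [-2;5;-2]]
(fun g => Node [g 0;g 1]
[(1,[-2;0;1],Leaf [[-2;7;-4];[0;1;0];[-1;3;-1]])]);
Datum [0;1;2;3;5;7]%N [1;6;8]%N [[-3;1;1;1;1;1;0;0;0];[0;0;0;0;0;0;1;1;0];[0;0;0;0;0;0;0;0;1]]
[rk1z [2;-2;0] [1;2;0];rk1z [4;-2;-2] [1;1;2]]
(fun g => Node [g 0;g 1]
[(1,[-8;4;3],Leaf [[-7;-8;-8];[-5;-4;-8];[-1;-1;-1]]);(1,[-8;5;2],Leaf [[-7;-8;-8];[-3;-4;-2];[-1;
-1;-1]])]);
Datum [0;1;2;3;4;5]%N [0;1;8]%N [[1;0;0;0;0;0;0;0;0];[0;1;1;1;1;1;1;1;0];[0;0;0;0;0;0;0;0;1]] [rk1z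
[3;7;2] [3;-1;-2];rk1z [1;3;0] [7;-3;0]]
(fun g => Node [g 0;g 1]
[(1,[0;-1;0],Leaf [[1;0;-1];[3;-1;-1];[1;0;0]]);(1,[0;0;-1],Leaf [[1;0;0];[8;-3;0];[3;-1;-1]]);
(1,[1;1;1],Leaf [[1;0;-1];[4;-1;-3];[3;-1;-1]])]);
Datum [0;1;2;3;4;6]%N [0;1;7]%N [[1;0;0;0;0;0;0;0;0];[0;1;1;1;1;1;1;0;0];[0;0;0;0;0;0;0;1;1]] [rk1z
[2;6;0] [2;-1;0];rk1z [2;4;2] [6;-2;-3]]
(fun g => Node [g 0;g 1]
[(1,[0;-1;0],Leaf [[2;0;-1];[3;-1;-1];[1;0;0]]);(1,[0;0;-1],Leaf [[1;0;0];[5;-2;0];[3;-1;-1]]);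
(1,[1;0;2],Leaf [[2;0;-1];[14;-4;-7];[3;-1;-1]])]);
Datum [0;1;2;3;5;6]%N [0;1;6]%N [[1;0;0;0;0;0;0;0;0];[0;1;1;1;1;1;0;0;0];[0;0;0;0;0;0;1;1;1]] [rk1z
[1;0;3] [1;0;-1];rk1z [1;2;1] [15;-6;-5]]
(fun g => Node [g 0;g 1]
[(1,[0;-1;0],Leaf [[2;0;-1];[3;-1;-1];[1;0;0]]);(1,[0;0;-1],Leaf [[1;0;0];[5;-2;0];[3;-1;-1]]);
(1,[2;5;0],Leaf [[5;-2;0];[3;-1;-1];[20;-8;-5]])]);
Datum [1;2;3;5;6;7]%N [2;0;6]%N [[0;-2;1;1;1;1;0;0;0];[1;-1;0;0;0;0;0;0;0];[0;0;0;0;0;0;1;1;1]]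
[rk1z [1;0;-1] [0;-3;2];rk1z [1;1;2] [-3;9;-4]]
(fun g => Node [g 0;g 1]
[(1,[-2;0;1],Leaf [[-1;5;-2];[0;1;0];[-1;3;-1]])]);
Datum [0;1;2;4;5;6]%N [0;1;5]%N [[1;0;0;0;0;0;0;0;0];[0;1;1;1;1;0;0;0;0];[0;0;0;0;0;1;1;1;1]] [rk1z
[0;1;-1] [0;-1;1];rk1z [2;2;4] [4;-1;-2]]
(fun g => Node [g 0;g 1]
[(1,[0;-1;0],Leaf [[1;0;0];[3;-1;-1];[2;0;-1]])]);
Datum [0;1;3;4;5;7]%N [1;4;8]%N [[-3;1;1;1;0;0;0;0;0];[0;0;0;0;1;1;1;1;0];[0;0;0;0;0;0;0;0;1]]
[rk1z [2;-2;0] [2;3;0];rk1z [6;-4;-2] [1;1;2]]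
(fun g => Node [g 0;g 1]
[(1,[-12;8;3],Leaf [[-11;-12;-12];[-7;-6;-12];[-1;-1;-1]]);(1,[-12;9;2],Leaf [[-11;-12;-12];[-7;-8;
-6];[-1;-1;-1]]);(1,[-10;8;1],Leaf [[-7;-8;-6];[-5;-6;-2];[-1;-1;-1]])]);
Datum [0;1;2;4;6;7]%N [1;5;7]%N [[-3;1;1;1;1;0;0;0;0];[0;0;0;0;0;1;1;0;0];[0;0;0;0;0;0;0;1;1]]
[rk1z [0;1;-1] [0;-1;1];rk1z [2;-1;-1] [4;5;5]]
(fun g => Node [g 0;g 1]
[(1,[0;-1;0],Leaf [[-2;0;-3];[-1;-1;-1];[-1;0;0]]);(1,[-3;0;2],Leaf [[-2;0;-3];[-2;-1;-3];[-1;-1;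
-1]])]);
Datum [0;1;3;4;6;7]%N [1;4;7]%N [[-3;1;1;1;0;0;0;0;0];[0;0;0;0;1;1;1;0;0];[0;0;0;0;0;0;0;1;1]]
[rk1z [1;0;-1] [1;0;3];rk1z [4;-2;-2] [2;2;3]]
(fun g => Node [g 0;g 1]
[(1,[0;-1;0],Leaf [[-2;0;-3];[-1;-1;-1];[-1;0;0]]);(1,[-3;0;2],Leaf [[-2;0;-3];[-6;-4;-9];[-1;-1;
-1]])]);
Datum [0;1;2;3;7]%N [1;6;7;8]%N [[-3;1;1;1;1;1;0;0;0];[0;0;0;0;0;0;1;0;0];[0;0;0;0;0;0;0;1;0];[0;0;
0;0;0;0;0;0;1]] [colz 4 [(2,3);(3,2)] [];colz 4 [(1,3);(3,1)] [];rk1z [4;-2;-1;-1] [1;2;1;1];colz 4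
[(1,2);(2,1)] [];rk1z [2;-1;-1;0] [1;2;2;0]]
(fun g => Node [g 0;g 1;g 2]
[(1,[-8;2;2;3],Node [g 3;g 4]
[(1,[0;0;1;-1],Leaf [[-7;-8;-8;-8];[-3;-2;-4;-4];[-1;-1;-1;-1];[-3;-3;-3;-4]])])]);
Datum [0;1;2;3;4]%N [0;1;7;8]%N [[1;0;0;0;0;0;0;0;0];[0;1;1;1;1;1;1;0;0];[0;0;0;0;0;0;0;1;0];[0;0;0;
0;0;0;0;0;1]] [colz 4 [(2,3);(3,2)] [];rk1z [1;2;0;1] [3;-1;0;-3];rk1z [2;6;0;0] [2;-1;0;0];rk1z [1;
2;1;0] [3;-1;-3;0]]
(fun g => Node [g 0;g 1;g 2]
[(1,[0;-1;0;0],Leaf [[1;0;0;0];[3;-1;-1;-1];[1;0;-1;0];[1;0;0;-1]]);(1,[0;0;-1;0],Node [g 1;g 2]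
[(1,[0;-1;1;0],Leaf [[1;0;0;0];[3;-1;-1;-1];[3;-1;0;-1];[1;0;0;-1]]);(1,[0;0;1;-1],Leaf [[1;0;0;0];
[5;-2;0;0];[3;-1;-1;-1];[3;-1;0;-1]])]);(1,[1;0;1;1],Node [g 1;g 3]
[(1,[-1;-1;-1;-1],Leaf [[1;0;0;-1];[3;-1;-1;-1];[1;0;-1;0];[4;-1;-2;-2]])])]);
Datum [1;2;3;5;7]%N [2;0;6;8]%N [[0;-2;1;1;1;1;0;0;0];[1;-1;0;0;0;0;0;0;0];[0;0;0;0;0;0;1;1;0];[0;0;
0;0;0;0;0;0;1]] [rk1z [2;1;0;1] [-1;2;0;-2];rk1z [2;0;-2;0] [0;-1;1;0];rk1z [1;0;0;-1] [0;-1;0;2];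
rk1z [4;2;2;0] [-1;2;-1;0]]
(fun g => Node [g 0;g 1;g 2]
[(1,[4;4;4;3],Node [g 3;g 1]
[(1,[0;0;1;-1],Leaf [[-3;10;-4;-4];[-4;11;-4;-4];[-1;3;-1;-1];[-3;9;-3;-4]])]);(1,[4;4;5;2],Leaf
[[-3;10;-4;-4];[-4;11;-4;-4];[-3;9;-4;-2];[-1;3;-1;-1]])]);
Datum [0;1;2;3;5]%N [0;1;6;8]%N [[1;0;0;0;0;0;0;0;0];[0;1;1;1;1;1;0;0;0];[0;0;0;0;0;0;1;1;0];[0;0;0;
0;0;0;0;0;1]] [rk1z [2;5;0;1] [2;-1;0;-1];colz 4 [] [(0,[8;-3;-3;0]);(1,[15;-6;-5;0]);(2,[6;-2;-3;
0])];rk1z [1;0;2;1] [1;0;-1;-1]]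
(fun g => Node [g 0;g 1]
[(1,[0;-1;0;0],Node [g 2]
[(1,[0;1;0;-1],Leaf [[1;0;0;0];[3;-1;-1;-1];[2;0;-1;0];[1;0;0;-1]])]);(1,[0;0;-1;0],Node [g 0]
[(3,[0;-1;1;0],Leaf [[1;0;0;0];[3;-1;-1;-1];[5;-2;0;0];[1;0;0;-1]]);(2,[1;1;1;1],Leaf [[1;0;0;-1];
[3;-1;0;-2];[3;-1;-1;-1];[5;-2;0;0]])]);(1,[0;0;0;-1],Node [g 1]
[(1,[0;-1;0;1],Leaf [[1;0;0;0];[3;-1;-1;-1];[2;0;-1;0];[3;-1;-1;0]]);(1,[0;0;-1;1],Leaf [[1;0;0;0];
[5;-2;0;0];[3;-1;-1;-1];[3;-1;-1;0]]);(1,[1;0;2;1],Leaf [[2;0;-1;0];[10;-3;-5;0];[3;-1;-1;-1];[3;-1;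
-1;0]])]);(1,[1;1;0;1],Leaf [[1;0;0;-1];[3;-1;0;-2];[4;-1;-1;-3];[3;-1;-1;-1]])]);
Datum [0;1;2;4;5]%N [0;1;5;8]%N [[1;0;0;0;0;0;0;0;0];[0;1;1;1;1;0;0;0;0];[0;0;0;0;0;1;1;1;0];[0;0;0;
0;0;0;0;0;1]] [rk1z [1;0;3;0] [1;0;-1;0];rk1z [1;2;0;1] [2;-1;0;-2];rk1z [1;2;1;0] [6;-3;-2;0];rk1z
[2;2;3;1] [4;-1;-2;-2]]
(fun g => Node [g 0;g 1;g 2]
[(1,[0;-1;0;0],Node [g 0]
[(2,[0;1;-1;0],Leaf [[1;0;0;0];[3;-1;-1;-1];[3;0;-1;0];[1;0;0;-1]]);(1,[1;1;1;1],Leaf [[1;0;0;-1];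
[3;-1;-1;-1];[2;0;-1;-1];[3;0;-1;0]])]);(1,[0;0;-1;0],Node [g 1]
[(1,[0;0;1;-1],Leaf [[1;0;0;0];[2;-1;0;0];[3;-1;-1;-1];[1;0;0;-1]])]);(1,[0;0;0;-1],Node [g 2;g 0]
[(1,[0;-1;0;1],Leaf [[1;0;0;0];[3;-1;-1;-1];[2;0;-1;0];[3;-1;-1;0]]);(1,[0;0;-1;1],Leaf [[1;0;0;0];
[2;-1;0;0];[3;-1;-1;-1];[3;-1;-1;0]])]);(1,[1;0;1;1],Node [g 1;g 3]
[(1,[-1;-1;-1;-1],Leaf [[1;0;0;-1];[3;-1;-1;-1];[2;0;-1;-1];[6;-1;-2;-4]])])]);
Datum [0;1;2;4;6]%N [0;1;5;7]%N [[1;0;0;0;0;0;0;0;0];[0;1;1;1;1;0;0;0;0];[0;0;0;0;0;1;1;0;0];[0;0;0;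
0;0;0;0;1;1]] [colz 4 [(2,3);(3,2)] [];rk1z [2;4;0;2] [2;-1;0;-1];rk1z [2;2;2;2] [4;-1;-2;-2]]
(fun g => Node [g 0;g 1;g 2]
[(1,[0;0;-1;0],Node [g 1]
[(2,[0;-1;1;0],Leaf [[2;0;0;-1];[3;-1;-1;-1];[2;-1;0;0];[1;0;0;0]]);(1,[1;0;1;2],Leaf [[2;0;0;-1];
[6;-2;0;-3];[3;-1;-1;-1];[2;-1;0;0]])]);(1,[0;-1;0;0],Node [g 0]
[(1,[1;1;0;2],Leaf [[2;0;0;-1];[3;-1;-1;-1];[2;0;-1;-1];[1;0;0;0]])]);(1,[1;0;0;2],Node [g 2;g 1]
[(1,[-1;0;-1;-2],Leaf [[2;0;0;-1];[6;-2;0;-3];[3;-1;-1;-1];[4;-1;-1;-2]]);(1,[-1;-1;0;-2],Leaf [[2;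
0;0;-1];[3;-1;-1;-1];[2;0;-1;-1];[4;-1;-1;-2]])])]);
Datum [0;1;3;4;6]%N [0;1;4;7]%N [[1;0;0;0;0;0;0;0;0];[0;1;1;1;0;0;0;0;0];[0;0;0;0;1;1;1;0;0];[0;0;0;
0;0;0;0;1;1]] [rk1z [1;1;2;0] [3;-1;-2;0];rk1z [1;0;3;0] [1;0;-1;0];rk1z [2;2;2;2] [6;-2;-2;-3];
colz 4 [(1,2);(2,1)] []]
(fun g => Node [g 0;g 1;g 2]
[(1,[0;-1;0;0],Node [g 1]
[(3,[0;1;-1;0],Leaf [[2;0;0;-1];[3;-1;-1;-1];[6;0;-2;-3];[1;0;0;0]]);(2,[0;1;0;-1],Leaf [[1;0;0;0];
[3;-1;-1;-1];[2;0;-1;0];[6;0;-2;-3]])]);(1,[0;0;0;-1],Node [g 3;g 0]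
[(1,[0;-1;0;1],Leaf [[1;0;0;0];[3;-1;-1;-1];[2;0;-1;0];[3;-1;-1;0]])]);(1,[1;0;0;2],Node [g 3;g 2]
[(1,[-1;-1;0;-2],Leaf [[2;0;0;-1];[3;-1;-1;-1];[6;0;-2;-3];[4;-1;-1;-2]]);(1,[1;0;3;0],Leaf [[6;0;
-2;-3];[18;-4;-6;-9];[4;-1;-1;-2];[3;-1;-1;-1]])])]);
Datum [0;1;3;5;7]%N [1;4;6;8]%N [[-3;1;1;1;0;0;0;0;0];[0;0;0;0;1;1;0;0;0];[0;0;0;0;0;0;1;1;0];[0;0;
0;0;0;0;0;0;1]] [rk1z [3;-1;-2;0] [1;1;2;0];rk1z [1;0;-1;0] [1;0;3;0];rk1z [6;-2;-2;-2] [1;1;1;2];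
colz 4 [(1,2);(2,1)] []]
(fun g => Node [g 0;g 1;g 2]
[(1,[0;-1;0;0],Node [g 1]
[(2,[-3;1;2;0],Leaf [[-2;0;-3;-2];[-1;-1;-1;-1];[-1;0;-1;-2];[-2;0;-3;0]]);(1,[0;1;0;-1],Leaf [[-2;
0;-3;0];[-1;-1;-1;-1];[-1;0;0;0];[-1;0;-1;-2]])]);(1,[-4;0;2;1],Node [g 0;g 2]
[(1,[4;-1;-2;-1],Leaf [[-2;0;-3;-2];[-1;-1;-1;-1];[-1;0;-1;-2];[-3;-1;-4;-4]])]);(1,[0;0;0;-1],Node
[g 0;g 3]
[(1,[0;-1;0;1],Leaf [[-2;0;-3;0];[-1;-1;-1;-1];[-1;0;0;0];[-1;-1;-1;0]])])]);
Datum [1;2;3;7]%N [2;0;6;7;8]%N [[0;-2;1;1;1;1;0;0;0];[1;-1;0;0;0;0;0;0;0];[0;0;0;0;0;0;1;0;0];[0;0;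
0;0;0;0;0;1;0];[0;0;0;0;0;0;0;0;1]] [colz 5 [(3,4);(4,3)] [];colz 5 [(2,4);(4,2)] [];rk1z [2;0;-1;0;
-1] [0;-1;1;0;1];rk1z [2;2;1;2;1] [-1;3;-1;-2;-1];colz 5 [(2,3);(3,2)] [];rk1z [2;0;-1;-1;0] [0;-1;
1;1;0];rk1z [2;2;1;1;2] [-1;3;-1;-1;-2]]
(fun g => Node [g 0;g 1;g 2;g 3]
[(1,[-2;0;0;0;1],Node [g 4;g 5;g 6]
[(1,[0;0;0;1;-1],Leaf [[-1;5;-2;-2;-2];[0;1;0;0;0];[-1;4;0;-2;-2];[-1;3;-1;-1;-1];[-1;4;-1;-1;
-2]])])]);
Datum [0;1;2;3]%N [0;1;6;7;8]%N [[1;0;0;0;0;0;0;0;0];[0;1;1;1;1;1;0;0;0];[0;0;0;0;0;0;1;0;0];[0;0;0;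
0;0;0;0;1;0];[0;0;0;0;0;0;0;0;1]] [rk1z [1;0;1;1;1] [1;0;-1;-1;-1];rk1z [2;5;0;0;1] [2;-1;0;0;-1];
colz 5 [] [(0,[4;-1;0;-1;-3]);(1,[5;-1;0;0;-5]);(3,[1;0;0;-1;-1]);(4,[3;-1;0;-1;-2])];colz 5 [(2,3);
(3,2)] [];colz 5 [(2,4);(4,2)] [];colz 5 [(3,4);(4,3)] []]
(fun g => Node [g 0;g 1;g 2]
[(1,[0;-1;0;0;0],Node [g 3;g 4;g 0]
[(1,[0;1;-1;0;0],Leaf [[1;0;0;0;0];[3;-1;-1;-1;-1];[3;0;-1;-1;-1];[1;0;0;-1;0];[1;0;0;0;-1]])]);
(1,[0;0;-1;0;0],Node [g 5;g 2]
[(1,[0;-1;1;0;0],Leaf [[1;0;0;0;0];[3;-1;-1;-1;-1];[3;-1;0;-1;-1];[1;0;0;-1;0];[1;0;0;0;-1]]);(1,[0;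
0;1;-1;0],Node [g 1]
[(3,[0;-1;0;1;0],Leaf [[1;0;0;0;0];[3;-1;-1;-1;-1];[3;-1;0;-1;-1];[5;-2;0;0;0];[1;0;0;0;-1]]);(2,[1;
1;0;1;1],Leaf [[1;0;0;0;-1];[3;-1;0;0;-2];[3;-1;-1;-1;-1];[3;-1;0;-1;-1];[5;-2;0;0;0]])])])]);
Datum [0;1;2;4]%N [0;1;5;7;8]%N [[1;0;0;0;0;0;0;0;0];[0;1;1;1;1;0;0;0;0];[0;0;0;0;0;1;1;0;0];[0;0;0;
0;0;0;0;1;0];[0;0;0;0;0;0;0;0;1]] [colz 5 [(3,4);(4,3)] [];rk1z [1;0;2;0;1] [1;0;-1;0;-1];rk1z [1;2;
0;0;1] [2;-1;0;0;-2];rk1z [2;4;2;0;0] [2;-1;-1;0;0];rk1z [1;0;2;1;0] [1;0;-1;-1;0];rk1z [1;2;0;1;0]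
[2;-1;0;-2;0];rk1z [2;2;2;1;1] [4;-1;-2;-2;-2]]
(fun g => Node [g 0;g 1;g 2;g 3]
[(1,[0;-1;0;0;0],Node [g 1;g 4]
[(2,[0;1;-1;0;0],Leaf [[1;0;0;0;0];[3;-1;-1;-1;-1];[2;0;-1;0;0];[1;0;0;-1;0];[1;0;0;0;-1]]);(1,[1;1;
0;1;1],Leaf [[1;0;0;0;-1];[3;-1;-1;-1;-1];[2;0;-1;-1;-1];[1;0;0;-1;0];[2;0;-1;0;0]])]);(1,[0;0;-1;0;
0],Node [g 5;g 0]
[(2,[0;-1;1;0;0],Leaf [[1;0;0;0;0];[3;-1;-1;-1;-1];[2;-1;0;0;0];[1;0;0;-1;0];[1;0;0;0;-1]]);(1,[1;0;
1;1;1],Node [g 2;g 5]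
[(1,[-1;-2;1;-1;-1],Leaf [[1;0;0;0;-1];[3;-1;-1;-1;-1];[2;-1;0;0;0];[1;0;0;-1;0];[4;-1;0;-2;
-2]])])]);(1,[0;0;0;-1;0],Node [g 2;g 3;g 1]
[(1,[0;-1;0;1;0],Node [g 1]
[(1,[0;1;0;0;-1],Leaf [[1;0;0;0;0];[3;-1;-1;-1;-1];[2;0;-1;0;0];[3;-1;-1;0;-1];[1;0;0;0;-1]])]);
(1,[0;0;-1;1;0],Node [g 2]
[(1,[0;0;1;0;-1],Leaf [[1;0;0;0;0];[2;-1;0;0;0];[3;-1;-1;-1;-1];[3;-1;-1;0;-1];[1;0;0;0;-1]])]);
(1,[0;0;0;1;-1],Node [g 3]
[(2,[0;-1;0;0;1],Leaf [[1;0;0;0;0];[3;-1;-1;-1;-1];[2;0;-1;0;0];[3;-1;-1;0;-1];[2;-1;0;0;0]]);(1,[1;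
0;2;0;1],Leaf [[2;0;-1;0;0];[6;-2;-3;0;0];[3;-1;-1;-1;-1];[3;-1;-1;0;-1];[2;-1;0;0;0]])])]);(1,[1;0;
0;1;1],Node [g 6;g 1;g 4]
[(1,[-1;-1;0;-1;-1],Leaf [[1;0;0;0;-1];[3;-1;-1;-1;-1];[2;0;-1;-1;-1];[1;0;0;-1;0];[4;-1;-1;-2;
-2]]);(1,[-1;0;-1;-1;-1],Node [g 2;g 5]
[(1,[0;-1;1;0;0],Leaf [[1;0;0;0;-1];[3;-1;-1;-1;-1];[4;-1;0;-2;-2];[1;0;0;-1;0];[4;-1;-1;-2;
-2]])])])]);
Datum [0;1;3;4]%N [0;1;4;7;8]%N [[1;0;0;0;0;0;0;0;0];[0;1;1;1;0;0;0;0;0];[0;0;0;0;1;1;1;0;0];[0;0;0;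
0;0;0;0;1;0];[0;0;0;0;0;0;0;0;1]] [rk1z [1;1;2;0;0] [3;-1;-2;0;0];rk1z [1;0;3;0;0] [1;0;-1;0;0];
colz 5 [] [(0,[3;0;-1;-1;-2]);(2,[3;0;-1;0;-3]);(3,[1;0;0;-1;-1]);(4,[2;0;-1;-1;-1])];colz 5 [(3,4);
(4,3)] [];colz 5 [(1,2);(2,1)] [];rk1z [1;1;1;0;1] [3;-1;-1;0;-3]]
(fun g => Node [g 0;g 1;g 2]
[(1,[0;-1;0;0;0],Node [g 3;g 2]
[(1,[0;1;-1;0;0],Leaf [[1;0;0;0;0];[3;-1;-1;-1;-1];[3;0;-1;-1;-1];[1;0;0;-1;0];[1;0;0;0;-1]]);(1,[0;
1;0;-1;0],Node [g 1]
[(2,[0;0;-1;1;0],Leaf [[1;0;0;0;0];[3;-1;-1;-1;-1];[3;0;-1;-1;-1];[3;0;-1;0;0];[1;0;0;0;-1]]);(1,[1;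
0;1;1;1],Leaf [[1;0;0;0;-1];[3;-1;-1;-1;-1];[2;0;-1;0;-1];[3;0;-1;-1;-1];[3;0;-1;0;0]])])]);(1,[0;0;
0;-1;0],Node [g 4;g 5;g 0]
[(1,[0;-1;0;1;0],Node [g 1]
[(2,[0;1;-1;0;0],Leaf [[1;0;0;0;0];[3;-1;-1;-1;-1];[3;0;-1;0;0];[3;-1;-1;0;-1];[1;0;0;0;-1]]);(1,[1;
1;1;0;1],Leaf [[1;0;0;0;-1];[3;-1;-1;-1;-1];[2;0;-1;0;-1];[3;-1;-1;0;-1];[3;0;-1;0;0]])]);(1,[0;0;0;
1;-1],Node [g 4;g 0]
[(1,[0;-1;0;0;1],Leaf [[1;0;0;0;0];[3;-1;-1;-1;-1];[2;0;-1;0;0];[3;-1;-1;0;-1];[3;-1;-1;0;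
0]])])])]);
Datum [0;1;3;5]%N [0;1;4;6;8]%N [[1;0;0;0;0;0;0;0;0];[0;1;1;1;0;0;0;0;0];[0;0;0;0;1;1;0;0;0];[0;0;0;
0;0;0;1;1;0];[0;0;0;0;0;0;0;0;1]] [rk1z [1;0;1;1;1] [2;0;-1;-1;-2];rk1z [1;0;0;2;1] [1;0;0;-1;-1];
rk1z [1;3;0;0;0] [1;-1;0;0;0];rk1z [1;1;1;1;0] [6;-2;-3;-3;0];rk1z [2;3;0;2;1] [2;-1;0;-1;-1];colz
5 [(2,3);(3,2)] [];rk1z [2;3;1;1;1] [4;-2;-1;-1;-2]]
(fun g => Node [g 0;g 1;g 2;g 3]
[(1,[0;0;-1;0;0],Node [g 1;g 4]
[(4,[0;0;1;-1;0],Node [g 2]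
[(1,[0;-6;2;4;0],Leaf [[1;0;0;0;0];[3;-1;-1;-1;-1];[6;-2;0;-3;0];[3;-1;0;0;0];[1;0;0;0;-1]]);(1,[3;
3;-1;4;3],Leaf [[1;0;0;0;-1];[2;-1;0;0;-1];[3;-1;-1;-1;-1];[6;-2;0;-3;0];[3;-1;0;0;0]])]);(6,[0;-1;
1;0;0],Node [g 1]
[(1,[0;0;1;0;-1],Leaf [[1;0;0;0;0];[3;-1;-1;-1;-1];[6;-2;0;-3;0];[2;0;0;-1;0];[1;0;0;0;-1]])]);
(3,[1;1;1;0;1],Leaf [[1;0;0;0;-1];[2;-1;0;0;-1];[3;-1;-1;-1;-1];[3;-1;0;-1;-2];[6;-2;0;-3;0]])]);
(1,[0;-1;0;0;0],Node [g 0;g 1]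
[(1,[0;1;0;0;-1],Node [g 5]
[(1,[1;0;0;2;1],Leaf [[2;0;0;-1;0];[3;-1;-1;-1;-1];[2;0;-1;-1;0];[1;0;0;0;-1];[1;0;0;0;0]])])]);
(1,[0;0;0;0;-1],Node [g 5;g 3;g 2]
[(1,[0;0;-1;0;1],Node [g 2]
[(2,[0;0;1;-1;0],Leaf [[1;0;0;0;0];[2;-1;0;0;0];[3;-1;-1;-1;-1];[6;-2;0;-3;0];[3;-1;-1;-1;0]]);
(3,[0;-1;1;0;0],Leaf [[1;0;0;0;0];[3;-1;-1;-1;-1];[6;-2;0;-3;0];[2;0;0;-1;0];[3;-1;-1;-1;0]])]);
(1,[0;-1;0;0;1],Node [g 5]
[(1,[1;1;0;2;0],Leaf [[2;0;0;-1;0];[3;-1;-1;-1;-1];[2;0;-1;-1;0];[1;0;0;0;0];[3;-1;-1;-1;0]])]);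
(1,[1;0;0;2;1],Node [g 3]
[(2,[-1;0;-1;-2;0],Leaf [[2;0;0;-1;0];[6;-2;0;-3;0];[3;-1;-1;-1;-1];[2;0;-1;-1;0];[3;-1;-1;-1;0]]);
(1,[1;3;0;0;0],Leaf [[6;-2;0;-3;0];[2;0;-1;-1;0];[12;-4;-3;-6;0];[3;-1;-1;-1;-1];[3;-1;-1;-1;
0]])])]);(1,[1;1;0;0;1],Node [g 5;g 0;g 6]
[(1,[-1;-1;-1;0;-1],Leaf [[1;0;0;0;-1];[2;-1;0;0;-1];[3;-1;-1;-1;-1];[3;-1;0;-1;-2];[6;-2;-1;-1;
-4]])])]);
Datum [0;2;4;6]%N [0;1;3;5;7]%N [[1;0;0;0;0;0;0;0;0];[0;1;1;0;0;0;0;0;0];[0;0;0;1;1;0;0;0;0];[0;0;0;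
0;0;1;1;0;0];[0;0;0;0;0;0;0;1;1]] [colz 5 [(1,2);(2,1)] [];colz 5 [(2,3);(3,2)] [];colz 5 [(2,4);
(4,2)] [];rk1z [2;1;1;2;2] [4;-1;-1;-2;-2];colz 5 [(1,3);(3,1)] [];colz 5 [(1,4);(4,1)] [];rk1z [2;
2;0;2;2] [2;-1;0;-1;-1];colz 5 [(3,4);(4,3)] []]
(fun g => Node [g 0;g 1;g 2;g 3]
[(1,[0;0;-1;0;0],Node [g 4;g 5;g 6]
[(1,[0;-1;1;0;0],Node [g 7]
[(1,[1;1;0;0;2],Leaf [[2;0;0;0;-1];[3;-1;-1;-1;-1];[3;-1;0;-1;-1];[2;0;0;-1;-1];[1;0;0;0;0]])]);
(1,[1;0;1;0;2],Node [g 4;g 6]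
[(1,[-1;-1;0;0;-2],Leaf [[2;0;0;0;-1];[3;-1;-1;-1;-1];[3;-1;0;-1;-1];[2;0;0;-1;-1];[4;-1;0;-1;
-2]])])]);(1,[1;0;0;0;2],Node [g 0;g 1;g 3]
[(1,[-1;0;-1;0;-2],Node [g 4;g 6]
[(1,[0;-1;1;0;0],Leaf [[2;0;0;0;-1];[3;-1;-1;-1;-1];[4;-1;0;-1;-2];[2;0;0;-1;-1];[4;-1;-1;-1;
-2]])])])]);
Datum [0;1;2]%N [0;1;5;6;7;8]%N [[1;0;0;0;0;0;0;0;0];[0;1;1;1;1;0;0;0;0];[0;0;0;0;0;1;0;0;0];[0;0;0;
0;0;0;1;0;0];[0;0;0;0;0;0;0;1;0];[0;0;0;0;0;0;0;0;1]] [colz 6 [(2,3);(3,2)] [];colz 6 [(2,4);(4,2)]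
[];colz 6 [(2,5);(5,2)] [];rk1z [1;0;1;0;1;1] [1;0;-1;0;-1;-1];rk1z [1;2;0;0;0;1] [2;-1;0;0;0;-2];
colz 6 [(3,4);(4,3)] [];colz 6 [(3,5);(5,3)] [];rk1z [1;0;0;1;1;1] [1;0;0;-1;-1;-1];rk1z [1;2;0;0;1;
0] [2;-1;0;0;-2;0];colz 6 [(4,5);(5,4)] []]
(fun g => Node [g 0;g 1;g 2;g 3;g 4]
[(1,[0;-1;0;0;0;0],Node [g 0;g 1;g 2;g 3]
[(1,[0;1;-1;0;0;0],Node [g 5;g 6;g 7]
[(1,[0;0;1;-1;0;0],Leaf [[1;0;0;0;0;0];[3;-1;-1;-1;-1;-1];[3;0;-1;-1;-1;-1];[3;0;0;-1;-1;-1];[1;0;0;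
0;-1;0];[1;0;0;0;0;-1]])])]);(1,[0;0;-1;0;0;0],Node [g 8;g 5;g 6;g 7]
[(1,[0;-1;1;0;0;0],Node [g 5;g 6;g 7]
[(1,[0;1;0;-1;0;0],Leaf [[1;0;0;0;0;0];[3;-1;-1;-1;-1;-1];[3;-1;0;-1;-1;-1];[3;0;0;-1;-1;-1];[1;0;0;
0;-1;0];[1;0;0;0;0;-1]])]);(1,[0;0;1;-1;0;0],Node [g 8;g 9]
[(2,[0;-1;0;1;0;0],Leaf [[1;0;0;0;0;0];[3;-1;-1;-1;-1;-1];[3;-1;0;-1;-1;-1];[2;-1;0;0;0;0];[1;0;0;0;
-1;0];[1;0;0;0;0;-1]]);(1,[1;0;0;1;1;1],Node [g 4;g 8]
[(1,[-1;-2;0;1;-1;-1],Leaf [[1;0;0;0;0;-1];[3;-1;-1;-1;-1;-1];[3;-1;0;-1;-1;-1];[2;-1;0;0;0;0];[1;0;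
0;0;-1;0];[4;-1;0;0;-2;-2]])])])])]);
Datum [0;1;3]%N [0;1;4;6;7;8]%N [[1;0;0;0;0;0;0;0;0];[0;1;1;1;0;0;0;0;0];[0;0;0;0;1;1;0;0;0];[0;0;0;
0;0;0;1;0;0];[0;0;0;0;0;0;0;1;0];[0;0;0;0;0;0;0;0;1]] [rk1z [1;0;0;1;1;1] [1;0;0;-1;-1;-1];rk1z [1;
0;2;0;0;1] [1;0;-1;0;0;-1];rk1z [1;3;0;0;0;0] [1;-1;0;0;0;0];colz 6 [] [(0,[3;-1;0;0;-1;-2]);(1,[3;
-1;0;0;0;-3]);(4,[1;0;0;0;-1;-1]);(5,[2;-1;0;0;-1;-1])];rk1z [1;0;2;1;0;0] [1;0;-1;-1;0;0];rk1z [1;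
0;2;0;1;0] [1;0;-1;0;-1;0];colz 6 [(3,5);(5,3)] [];colz 6 [(3,4);(4,3)] [];colz 6 [(4,5);(5,4)] [];
rk1z [2;3;2;0;0;1] [2;-1;-1;0;0;-1]]
(fun g => Node [g 0;g 1;g 2;g 3]
[(1,[0;-1;0;0;0;0],Node [g 1;g 4;g 5;g 0]
[(1,[0;1;-1;0;0;0],Node [g 0;g 6;g 7]
[(1,[0;0;1;-1;0;0],Leaf [[1;0;0;0;0;0];[3;-1;-1;-1;-1;-1];[3;0;-1;-1;-1;-1];[3;0;0;-1;-1;-1];[1;0;0;
0;-1;0];[1;0;0;0;0;-1]])]);(1,[0;1;0;-1;0;0],Node [g 1;g 5]
[(2,[0;0;-1;1;0;0],Leaf [[1;0;0;0;0;0];[3;-1;-1;-1;-1;-1];[3;0;-1;-1;-1;-1];[2;0;-1;0;0;0];[1;0;0;0;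
-1;0];[1;0;0;0;0;-1]]);(1,[1;0;0;1;1;1],Leaf [[1;0;0;0;0;-1];[3;-1;-1;-1;-1;-1];[2;0;-1;0;-1;-1];[3;
0;-1;-1;-1;-1];[1;0;0;0;-1;0];[2;0;-1;0;0;0]])])]);(1,[0;0;-1;0;0;0],Node [g 8;g 6;g 3]
[(1,[0;-1;1;0;0;0],Node [g 6;g 0;g 7]
[(1,[0;1;0;-1;0;0],Leaf [[1;0;0;0;0;0];[3;-1;-1;-1;-1;-1];[3;-1;0;-1;-1;-1];[3;0;0;-1;-1;-1];[1;0;0;
0;-1;0];[1;0;0;0;0;-1]])]);(1,[0;0;1;-1;0;0],Node [g 8;g 3]
[(1,[0;-1;0;1;0;0],Leaf [[1;0;0;0;0;0];[3;-1;-1;-1;-1;-1];[3;-1;0;-1;-1;-1];[3;-1;0;0;-1;-1];[1;0;0;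
0;-1;0];[1;0;0;0;0;-1]]);(1,[2;3;0;1;1;1],Node [g 8]
[(2,[-1;-2;0;0;-1;0],Leaf [[3;-1;0;0;-1;-2];[2;-1;0;0;0;-1];[3;-1;-1;-1;-1;-1];[3;-1;0;-1;-1;-1];[4;
-2;0;0;-1;-1];[3;-1;0;0;-1;-1]]);(1,[-1;-3;0;0;0;0],Leaf [[3;-1;0;0;-1;-2];[4;-2;0;0;-1;-1];[3;-1;
-1;-1;-1;-1];[3;-1;0;-1;-1;-1];[3;-1;0;0;-2;-1];[3;-1;0;0;-1;-1]])])])]);(1,[0;0;0;-1;0;0],Node [g
9;g 8;g 3]
[(1,[0;-1;0;1;0;0],Node [g 1;g 5]
[(2,[0;1;-1;0;0;0],Leaf [[1;0;0;0;0;0];[3;-1;-1;-1;-1;-1];[2;0;-1;0;0;0];[3;-1;-1;0;-1;-1];[1;0;0;0;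
-1;0];[1;0;0;0;0;-1]]);(1,[1;1;0;0;1;1],Leaf [[1;0;0;0;0;-1];[3;-1;-1;-1;-1;-1];[2;0;-1;0;-1;-1];[3;
-1;-1;0;-1;-1];[1;0;0;0;-1;0];[2;0;-1;0;0;0]])]);(1,[0;0;-1;1;0;0],Node [g 8;g 3]
[(1,[0;-1;1;0;0;0],Leaf [[1;0;0;0;0;0];[3;-1;-1;-1;-1;-1];[3;-1;0;0;-1;-1];[3;-1;-1;0;-1;-1];[1;0;0;
0;-1;0];[1;0;0;0;0;-1]]);(1,[0;0;1;0;-1;0],Node [g 2]
[(2,[0;-1;0;0;1;0],Leaf [[1;0;0;0;0;0];[3;-1;-1;-1;-1;-1];[3;-1;0;0;-1;-1];[3;-1;-1;0;-1;-1];[3;-1;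
0;0;0;0];[1;0;0;0;0;-1]]);(1,[1;1;0;0;1;1],Leaf [[1;0;0;0;0;-1];[2;-1;0;0;0;-1];[3;-1;-1;-1;-1;-1];
[3;-1;-1;0;-1;-1];[3;-1;0;0;-1;-1];[3;-1;0;0;0;0]])])]);(1,[0;0;0;1;-1;0],Node [g 2;g 9]
[(6,[0;-1;0;0;1;0],Node [g 1]
[(1,[0;0;0;0;1;-1],Leaf [[1;0;0;0;0;0];[3;-1;-1;-1;-1;-1];[2;0;-1;0;0;0];[3;-1;-1;0;-1;-1];[6;-2;-3;
0;0;0];[1;0;0;0;0;-1]])]);(3,[1;1;0;0;1;1],Leaf [[1;0;0;0;0;-1];[2;-1;0;0;0;-1];[3;-1;-1;0;0;-2];[3;
-1;-1;-1;-1;-1];[3;-1;-1;0;-1;-1];[6;-2;-3;0;0;0]]);(4,[0;0;-1;0;1;0],Node [g 2]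
[(1,[0;-6;4;0;2;0],Leaf [[1;0;0;0;0;0];[3;-1;-1;-1;-1;-1];[6;-2;-3;0;0;0];[3;-1;-1;0;-1;-1];[3;-1;0;
0;0;0];[1;0;0;0;0;-1]]);(1,[3;3;4;0;-1;3],Leaf [[1;0;0;0;0;-1];[2;-1;0;0;0;-1];[3;-1;-1;-1;-1;-1];
[3;-1;-1;0;-1;-1];[6;-2;-3;0;0;0];[3;-1;0;0;0;0]])])])])]);
Datum [0;2;4]%N [0;1;3;5;7;8]%N [[1;0;0;0;0;0;0;0;0];[0;1;1;0;0;0;0;0;0];[0;0;0;1;1;0;0;0;0];[0;0;0;
0;0;1;1;0;0];[0;0;0;0;0;0;0;1;0];[0;0;0;0;0;0;0;0;1]] [colz 6 [(1,2);(2,1)] [];colz 6 [(4,5);(5,4)]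
[];rk1z [1;0;1;1;0;1] [2;0;-1;-1;0;-2];rk1z [1;0;0;2;1;0] [1;0;0;-1;-1;0];rk1z [2;2;2;2;0;0] [2;-1;
-1;-1;0;0];rk1z [1;1;0;1;1;0] [2;-1;0;-1;-2;0];colz 6 [(1,3);(3,1)] [];rk1z [1;1;0;1;0;1] [2;-1;0;
-1;0;-2];rk1z [1;0;0;2;0;1] [1;0;0;-1;0;-1];colz 6 [(2,3);(3,2)] [];rk1z [1;0;1;1;1;0] [2;0;-1;-1;
-2;0]]
(fun g => Node [g 0;g 1;g 2;g 3;g 4]
[(1,[0;0;-1;0;0;0],Node [g 5;g 1;g 3]
[(2,[0;-1;1;0;0;0],Node [g 1;g 3]
[(1,[0;2;0;-2;0;0],Leaf [[1;0;0;0;0;0];[3;-1;-1;-1;-1;-1];[2;-1;0;-1;0;0];[2;0;0;-1;0;0];[1;0;0;0;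
-1;0];[1;0;0;0;0;-1]]);(1,[1;2;-1;0;1;1],Leaf [[1;0;0;0;0;-1];[3;-1;-1;-1;-1;-1];[2;-1;0;-1;0;0];[2;
0;0;-1;-1;-1];[1;0;0;0;-1;0];[2;0;0;-1;0;0]])]);(1,[1;0;1;0;1;1],Node [g 6;g 7;g 5]
[(1,[-1;-2;1;0;-1;-1],Leaf [[1;0;0;0;0;-1];[3;-1;-1;-1;-1;-1];[2;-1;0;-1;0;0];[2;0;0;-1;-1;-1];[1;0;
0;0;-1;0];[4;-1;0;-1;-2;-2]])])]);(1,[0;0;0;0;-1;0],Node [g 0;g 2;g 4;g 8]
[(1,[0;0;-1;0;1;0],Node [g 7;g 8]
[(1,[0;0;1;0;0;-1],Node [g 6]
[(1,[1;0;0;2;0;1],Leaf [[2;0;0;-1;0;0];[2;-1;0;-1;0;0];[3;-1;-1;-1;-1;-1];[1;0;0;0;0;-1];[3;-1;-1;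
-1;0;-1];[1;0;0;0;0;0]])])]);(1,[0;0;0;0;1;-1],Node [g 0;g 9;g 4]
[(1,[0;0;-1;0;0;1],Node [g 6]
[(1,[1;0;1;2;0;0],Leaf [[2;0;0;-1;0;0];[2;-1;0;-1;0;0];[3;-1;-1;-1;-1;-1];[1;0;0;0;0;0];[3;-1;-1;-1;
0;-1];[3;-1;-1;-1;0;0]])]);(1,[1;0;0;2;0;1],Node [g 0;g 4]
[(1,[-1;0;-1;-2;0;0],Leaf [[2;0;0;-1;0;0];[2;-1;0;-1;0;0];[3;-1;-1;-1;-1;-1];[4;-1;-1;-2;0;0];[3;-1;
-1;-1;0;-1];[3;-1;-1;-1;0;0]])])])]);(1,[1;0;0;0;1;1],Node [g 0;g 9;g 2;g 10]
[(1,[-1;0;-1;0;-1;-1],Node [g 6;g 7;g 5]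
[(1,[0;-1;1;0;0;0],Leaf [[1;0;0;0;0;-1];[3;-1;-1;-1;-1;-1];[4;-1;0;-1;-2;-2];[2;0;0;-1;-1;-1];[1;0;
0;0;-1;0];[4;-1;-1;-1;-2;-2]])])])]);
Datum [0;1]%N [0;1;4;5;6;7;8]%N [[1;0;0;0;0;0;0;0;0];[0;1;1;1;0;0;0;0;0];[0;0;0;0;1;0;0;0;0];[0;0;0;
0;0;1;0;0;0];[0;0;0;0;0;0;1;0;0];[0;0;0;0;0;0;0;1;0];[0;0;0;0;0;0;0;0;1]] [colz 7 [(2,3);(3,2)] [];
colz 7 [(2,4);(4,2)] [];rk1z [1;0;1;0;0;1;1] [1;0;-1;0;0;-1;-1];rk1z [1;3;0;0;0;0;0] [1;-1;0;0;0;0;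
0];colz 7 [] [(0,[3;-1;0;0;0;-1;-2]);(1,[3;-1;0;0;0;0;-3]);(5,[1;0;0;0;0;-1;-1]);(6,[2;-1;0;0;0;-1;
-1])];colz 7 [(2,5);(5,2)] [];colz 7 [(2,6);(6,2)] [];colz 7 [(3,4);(4,3)] [];colz 7 [(3,5);(5,3)]
[];colz 7 [(3,6);(6,3)] [];rk1z [1;0;0;1;0;1;1] [1;0;0;-1;0;-1;-1];colz 7 [(4,5);(5,4)] [];colz 7
[(4,6);(6,4)] [];rk1z [1;0;0;0;1;1;1] [1;0;0;0;-1;-1;-1];colz 7 [(5,6);(6,5)] [];rk1z [2;3;0;0;1;1;
1] [2;-1;0;0;-1;-1;-1];colz 7 [] [(0,[3;-1;0;0;-2;0;-1]);(1,[3;-1;0;0;-3;0;0]);(4,[2;-1;0;0;-1;0;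
-1]);(6,[1;0;0;0;-1;0;-1])]]
(fun g => Node [g 0;g 1;g 2;g 3;g 4]
[(1,[0;-1;0;0;0;0;0],Node [g 0;g 1;g 5;g 6;g 2]
[(1,[0;1;-1;0;0;0;0],Node [g 7;g 8;g 9;g 10]
[(1,[0;0;1;-1;0;0;0],Node [g 11;g 12;g 13]
[(1,[0;0;0;1;-1;0;0],Leaf [[1;0;0;0;0;0;0];[3;-1;-1;-1;-1;-1;-1];[3;0;-1;-1;-1;-1;-1];[3;0;0;-1;-1;
-1;-1];[3;0;0;0;-1;-1;-1];[1;0;0;0;0;-1;0];[1;0;0;0;0;0;-1]])])])]);(1,[0;0;-1;0;0;0;0],Node [g 14;
g 15;g 9;g 4]
[(1,[0;-1;1;0;0;0;0],Node [g 9;g 10;g 7;g 8]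
[(1,[0;1;0;-1;0;0;0],Node [g 12;g 13;g 14]
[(1,[0;0;0;1;0;0;-1],Leaf [[1;0;0;0;0;0;0];[3;-1;-1;-1;-1;-1;-1];[3;-1;0;-1;-1;-1;-1];[3;0;0;-1;-1;
-1;-1];[1;0;0;0;-1;0;0];[1;0;0;0;0;-1;0];[3;0;0;0;-1;-1;-1]])])]);(1,[0;0;1;-1;0;0;0],Node [g 14;g
12;g 4]
[(1,[0;-1;0;1;0;0;0],Node [g 13;g 12;g 11]
[(1,[1;1;0;0;0;1;1],Leaf [[2;0;0;0;-1;-1;-1];[3;-1;-1;-1;-1;-1;-1];[3;-1;0;-1;-1;-1;-1];[3;-1;0;0;
-1;-1;-1];[1;0;0;0;0;0;-1];[1;0;0;0;0;-1;0];[3;0;0;0;-1;-1;-1]])]);(1,[2;3;0;1;0;1;1],Node [g 14;g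
16]
[(1,[-1;-1;0;0;0;-1;-1],Leaf [[4;-2;0;0;-1;-1;-1];[3;-1;-1;-1;-1;-1;-1];[3;-1;0;-1;-1;-1;-1];[3;-1;
0;0;-1;-1;-1];[2;-1;0;0;0;0;-1];[2;-1;0;0;0;-1;0];[5;-2;0;0;-1;-2;-2]]);(1,[-1;-3;0;0;0;0;0],Node
[g 14]
[(1,[1;2;0;0;1;0;0],Leaf [[3;-1;0;0;-1;-1;-2];[5;-2;0;0;-1;-2;-2];[3;-1;-1;-1;-1;-1;-1];[3;-1;0;-1;
-1;-1;-1];[6;-2;0;0;0;-3;-3];[3;-1;0;0;-1;-2;-1];[3;-1;0;0;-1;-1;-1]]);(2,[0;1;0;0;0;-1;0],Leaf [[3;
-1;0;0;0;-1;-2];[5;-2;0;0;-1;-2;-2];[3;-1;-1;-1;-1;-1;-1];[3;-1;0;-1;-1;-1;-1];[3;-1;0;0;-1;-1;-2];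
[6;-2;0;0;0;-3;-3];[3;-1;0;0;-1;-1;-1]])])])])])]);
Datum [0;2]%N [0;1;3;5;6;7;8]%N [[1;0;0;0;0;0;0;0;0];[0;1;1;0;0;0;0;0;0];[0;0;0;1;1;0;0;0;0];[0;0;0;
0;0;1;0;0;0];[0;0;0;0;0;0;1;0;0];[0;0;0;0;0;0;0;1;0];[0;0;0;0;0;0;0;0;1]] [colz 7 [(3,4);(4,3)] [];
colz 7 [(3,5);(5,3)] [];colz 7 [(3,6);(6,3)] [];rk1z [1;0;0;1;0;1;1] [1;0;0;-1;0;-1;-1];rk1z [1;1;1;
0;0;0;1] [2;-1;-1;0;0;0;-2];rk1z [1;0;2;1;0;0;0] [1;0;-1;-1;0;0;0];rk1z [1;0;2;0;0;0;1] [1;0;-1;0;0;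
0;-1];rk1z [1;0;2;0;1;0;0] [1;0;-1;0;-1;0;0];rk1z [1;0;2;0;0;1;0] [1;0;-1;0;0;-1;0];rk1z [2;0;2;1;1;
1;1] [2;0;-1;-1;-1;-1;-1];rk1z [1;0;0;1;1;1;0] [1;0;0;-1;-1;-1;0];colz 7 [(4,6);(6,4)] [];colz 7
[(5,6);(6,5)] [];rk1z [1;0;0;0;1;1;1] [1;0;0;0;-1;-1;-1];rk1z [1;1;1;0;0;1;0] [2;-1;-1;0;0;-2;0];
colz 7 [(4,5);(5,4)] [];colz 7 [(1,2);(2,1)] []]
(fun g => Node [g 0;g 1;g 2;g 3;g 4;g 5]
[(1,[0;-1;0;0;0;0;0],Node [g 6;g 5;g 7;g 8;g 9]
[(1,[0;1;-1;0;0;0;0],Node [g 2;g 0;g 1;g 10]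
[(1,[0;0;1;-1;0;0;0],Node [g 11;g 12;g 13]
[(1,[0;0;0;1;0;0;-1],Leaf [[1;0;0;0;0;0;0];[3;-1;-1;-1;-1;-1;-1];[3;0;-1;-1;-1;-1;-1];[3;0;0;-1;-1;
-1;-1];[1;0;0;0;-1;0;0];[1;0;0;0;0;-1;0];[3;0;0;0;-1;-1;-1]])])]);(1,[0;1;0;-1;0;0;0],Node [g 6;g 7;
g 8;g 13]
[(1,[0;0;-1;1;0;0;0],Node [g 11;g 12;g 13]
[(1,[0;0;1;0;0;0;-1],Leaf [[1;0;0;0;0;0;0];[3;-1;-1;-1;-1;-1;-1];[3;0;-1;-1;-1;-1;-1];[3;0;-1;0;-1;
-1;-1];[1;0;0;0;-1;0;0];[1;0;0;0;0;-1;0];[3;0;0;0;-1;-1;-1]])]);(1,[1;0;2;1;0;0;0],Node [g 11;g 12]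
[(2,[0;0;-1;0;0;0;1],Leaf [[2;0;-1;0;0;0;-1];[3;-1;-1;-1;-1;-1;-1];[3;0;-1;-1;-1;-1;-1];[3;0;-1;0;
-1;-1;-1];[2;0;-1;0;-1;0;-1];[2;0;-1;0;0;-1;-1];[2;0;-1;0;0;0;0]]);(1,[1;0;0;0;1;1;1],Leaf [[2;0;-1;
0;0;-1;-1];[3;-1;-1;-1;-1;-1;-1];[3;0;-1;-1;-1;-1;-1];[3;0;-1;0;-1;-1;-1];[2;0;-1;0;-1;0;-1];[2;0;
-1;0;-1;-1;0];[2;0;-1;0;0;0;0]])])])]);(1,[0;0;0;-1;0;0;0],Node [g 14;g 15;g 11;g 13;g 7]
[(1,[0;-1;0;1;0;0;0],Node [g 6;g 7;g 8;g 13]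
[(1,[0;1;-1;0;0;0;0],Node [g 13;g 11;g 15]
[(1,[0;0;1;0;-1;0;0],Leaf [[1;0;0;0;0;0;0];[3;-1;-1;-1;-1;-1;-1];[3;0;-1;0;-1;-1;-1];[3;-1;-1;0;-1;
-1;-1];[3;0;0;0;-1;-1;-1];[1;0;0;0;0;-1;0];[1;0;0;0;0;0;-1]])]);(1,[0;1;0;0;-1;0;0],Node [g 6;g 8]
[(2,[0;0;-1;0;1;0;0],Leaf [[1;0;0;0;0;0;0];[3;-1;-1;-1;-1;-1;-1];[3;0;-1;0;-1;-1;-1];[3;-1;-1;0;-1;
-1;-1];[2;0;-1;0;0;0;0];[1;0;0;0;0;-1;0];[1;0;0;0;0;0;-1]]);(1,[1;0;0;0;1;1;1],Leaf [[1;0;0;0;0;0;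
-1];[3;-1;-1;-1;-1;-1;-1];[2;0;-1;0;0;-1;-1];[3;-1;-1;0;-1;-1;-1];[3;0;-1;0;-1;-1;-1];[1;0;0;0;0;-1;
0];[2;0;-1;0;0;0;0]])])]);(1,[0;0;0;1;-1;0;0],Node [g 14;g 12;g 8]
[(2,[0;-1;0;0;1;0;0],Node [g 12;g 8]
[(1,[0;2;-2;0;0;0;0],Leaf [[1;0;0;0;0;0;0];[3;-1;-1;-1;-1;-1;-1];[2;0;-1;0;0;0;0];[3;-1;-1;0;-1;-1;
-1];[2;-1;-1;0;0;0;0];[1;0;0;0;0;-1;0];[1;0;0;0;0;0;-1]]);(1,[1;2;0;0;-1;1;1],Leaf [[1;0;0;0;0;0;
-1];[3;-1;-1;-1;-1;-1;-1];[2;0;-1;0;0;-1;-1];[3;-1;-1;0;-1;-1;-1];[2;-1;-1;0;0;0;0];[1;0;0;0;0;-1;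
0];[2;0;-1;0;0;0;0]])]);(1,[1;0;0;0;1;1;1],Node [g 16;g 4;g 14]
[(1,[-1;-2;0;0;1;-1;-1],Leaf [[1;0;0;0;0;0;-1];[3;-1;-1;-1;-1;-1;-1];[2;0;-1;0;0;-1;-1];[3;-1;-1;0;
-1;-1;-1];[2;-1;-1;0;0;0;0];[1;0;0;0;0;-1;0];[4;-1;-1;0;0;-2;-2]])])])])]);
Datum [0]%N [0;1;3;4;5;6;7;8]%N [[1;0;0;0;0;0;0;0;0];[0;1;1;0;0;0;0;0;0];[0;0;0;1;0;0;0;0;0];[0;0;0;
0;1;0;0;0;0];[0;0;0;0;0;1;0;0;0];[0;0;0;0;0;0;1;0;0];[0;0;0;0;0;0;0;1;0];[0;0;0;0;0;0;0;0;1]] [colz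
8 [(2,3);(3,2)] [];colz 8 [(2,4);(4,2)] [];colz 8 [(2,5);(5,2)] [];colz 8 [(2,6);(6,2)] [];colz 8
[(2,7);(7,2)] [];rk1z [1;0;1;0;0;0;1;1] [1;0;-1;0;0;0;-1;-1];rk1z [1;2;0;0;0;0;0;1] [1;-1;0;0;0;0;0;
-1];colz 8 [(3,4);(4,3)] [];colz 8 [(3,5);(5,3)] [];colz 8 [(3,6);(6,3)] [];colz 8 [(3,7);(7,3)] [];
rk1z [1;0;0;1;0;0;1;1] [1;0;0;-1;0;0;-1;-1];colz 8 [(4,5);(5,4)] [];colz 8 [(4,6);(6,4)] [];colz 8
[(4,7);(7,4)] [];rk1z [1;0;0;0;1;0;1;1] [1;0;0;0;-1;0;-1;-1];colz 8 [(5,6);(6,5)] [];colz 8 [(5,7);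
(7,5)] [];rk1z [1;0;0;0;0;1;1;1] [1;0;0;0;0;-1;-1;-1];rk1z [1;2;0;0;1;0;0;0] [1;-1;0;0;-1;0;0;0];
rk1z [1;2;0;0;0;1;0;0] [1;-1;0;0;0;-1;0;0];rk1z [1;2;0;0;0;0;1;0] [1;-1;0;0;0;0;-1;0];rk1z [2;2;0;0;
1;1;1;1] [2;-1;0;0;-1;-1;-1;-1];rk1z [1;0;0;0;1;1;1;0] [1;0;0;0;-1;-1;-1;0];colz 8 [(6,7);(7,6)] []]
(fun g => Node [g 0;g 1;g 2;g 3;g 4;g 5;g 6]
[(1,[0;-1;0;0;0;0;0;0],Node [g 0;g 1;g 2;g 3;g 4;g 5]
[(1,[0;1;-1;0;0;0;0;0],Node [g 7;g 8;g 9;g 10;g 11]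
[(1,[0;0;1;-1;0;0;0;0],Node [g 12;g 13;g 14;g 15]
[(1,[0;0;0;1;-1;0;0;0],Node [g 16;g 17;g 18]
[(1,[0;0;0;0;1;-1;0;0],Leaf [[1;0;0;0;0;0;0;0];[3;-1;-1;-1;-1;-1;-1;-1];[3;0;-1;-1;-1;-1;-1;-1];[3;
0;0;-1;-1;-1;-1;-1];[3;0;0;0;-1;-1;-1;-1];[3;0;0;0;0;-1;-1;-1];[1;0;0;0;0;0;-1;0];[1;0;0;0;0;0;0;
-1]])])])])]);(1,[0;0;-1;0;0;0;0;0],Node [g 7;g 8;g 9;g 10;g 11;g 6]
[(1,[0;-1;1;0;0;0;0;0],Node [g 7;g 8;g 9;g 10;g 11]
[(1,[0;1;0;-1;0;0;0;0],Node [g 12;g 13;g 14;g 15]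
[(1,[0;0;0;1;-1;0;0;0],Node [g 16;g 17;g 18]
[(1,[0;0;0;0;1;-1;0;0],Leaf [[1;0;0;0;0;0;0;0];[3;-1;-1;-1;-1;-1;-1;-1];[3;-1;0;-1;-1;-1;-1;-1];[3;
0;0;-1;-1;-1;-1;-1];[3;0;0;0;-1;-1;-1;-1];[3;0;0;0;0;-1;-1;-1];[1;0;0;0;0;0;-1;0];[1;0;0;0;0;0;0;
-1]])])])]);(1,[0;0;1;-1;0;0;0;0],Node [g 6;g 19;g 20;g 21;g 22]
[(1,[0;-1;0;1;0;0;0;0],Node [g 14;g 12;g 13;g 23]
[(1,[0;1;0;0;-1;0;0;0],Node [g 17;g 24;g 18]
[(1,[0;0;0;0;1;0;0;-1],Leaf [[1;0;0;0;0;0;0;0];[3;-1;-1;-1;-1;-1;-1;-1];[3;-1;0;-1;-1;-1;-1;-1];[3;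
-1;0;0;-1;-1;-1;-1];[3;0;0;0;-1;-1;-1;-1];[1;0;0;0;0;-1;0;0];[1;0;0;0;0;0;-1;0];[3;0;0;0;0;-1;-1;
-1]])])]);(1,[0;0;0;1;-1;0;0;0],Node [g 6;g 20;g 21;g 18]
[(1,[0;-1;0;0;1;0;0;0],Node [g 17;g 24;g 18]
[(1,[0;1;0;0;0;0;0;-1],Leaf [[1;0;0;0;0;0;0;0];[3;-1;-1;-1;-1;-1;-1;-1];[3;-1;0;-1;-1;-1;-1;-1];[3;
-1;0;0;-1;-1;-1;-1];[3;-1;0;0;0;-1;-1;-1];[1;0;0;0;0;-1;0;0];[1;0;0;0;0;0;-1;0];[3;0;0;0;0;-1;-1;
-1]])]);(1,[1;2;0;0;1;0;0;0],Node [g 17;g 24]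
[(2,[0;-1;0;0;0;0;0;1],Leaf [[2;-1;0;0;0;0;0;-1];[3;-1;-1;-1;-1;-1;-1;-1];[3;-1;0;-1;-1;-1;-1;-1];
[3;-1;0;0;-1;-1;-1;-1];[3;-1;0;0;0;-1;-1;-1];[2;-1;0;0;0;-1;0;-1];[2;-1;0;0;0;0;-1;-1];[2;-1;0;0;0;
0;0;0]]);(1,[1;0;0;0;0;1;1;1],Leaf [[2;-1;0;0;0;0;-1;-1];[3;-1;-1;-1;-1;-1;-1;-1];[3;-1;0;-1;-1;-1;
-1;-1];[3;-1;0;0;-1;-1;-1;-1];[3;-1;0;0;0;-1;-1;-1];[2;-1;0;0;0;-1;0;-1];[2;-1;0;0;0;-1;-1;0];[2;-1;
0;0;0;0;0;0]])])])])])]);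
Datum []%N [0;1;2;3;4;5;6;7;8]%N [[1;0;0;0;0;0;0;0;0];[0;1;0;0;0;0;0;0;0];[0;0;1;0;0;0;0;0;0];[0;0;
0;1;0;0;0;0;0];[0;0;0;0;1;0;0;0;0];[0;0;0;0;0;1;0;0;0];[0;0;0;0;0;0;1;0;0];[0;0;0;0;0;0;0;1;0];[0;0;
0;0;0;0;0;0;1]] [colz 9 [(1,2);(2,1)] [];colz 9 [(1,3);(3,1)] [];colz 9 [(1,4);(4,1)] [];colz 9
[(1,5);(5,1)] [];colz 9 [(1,6);(6,1)] [];colz 9 [(1,7);(7,1)] [];colz 9 [(1,8);(8,1)] [];rk1z [1;1;
0;0;0;0;0;1;1] [1;-1;0;0;0;0;0;-1;-1];colz 9 [(2,3);(3,2)] [];colz 9 [(2,4);(4,2)] [];colz 9 [(2,5);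
(5,2)] [];colz 9 [(2,6);(6,2)] [];colz 9 [(2,7);(7,2)] [];colz 9 [(2,8);(8,2)] [];rk1z [1;0;1;0;0;0;
0;1;1] [1;0;-1;0;0;0;0;-1;-1];colz 9 [(3,4);(4,3)] [];colz 9 [(3,5);(5,3)] [];colz 9 [(3,6);(6,3)]
[];colz 9 [(3,7);(7,3)] [];colz 9 [(3,8);(8,3)] [];rk1z [1;0;0;1;0;0;0;1;1] [1;0;0;-1;0;0;0;-1;-1];
colz 9 [(4,5);(5,4)] [];colz 9 [(4,6);(6,4)] [];colz 9 [(4,7);(7,4)] [];colz 9 [(4,8);(8,4)] [];
rk1z [1;0;0;0;1;0;0;1;1] [1;0;0;0;-1;0;0;-1;-1];colz 9 [(5,6);(6,5)] [];colz 9 [(5,7);(7,5)] [];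
colz 9 [(5,8);(8,5)] [];rk1z [1;0;0;0;0;1;0;1;1] [1;0;0;0;0;-1;0;-1;-1];colz 9 [(6,7);(7,6)] [];
colz 9 [(6,8);(8,6)] [];rk1z [1;0;0;0;0;0;1;1;1] [1;0;0;0;0;0;-1;-1;-1]]
(fun g => Node [g 0;g 1;g 2;g 3;g 4;g 5;g 6;g 7]
[(1,[0;-1;0;0;0;0;0;0;0],Node [g 8;g 9;g 10;g 11;g 12;g 13;g 14]
[(1,[0;1;-1;0;0;0;0;0;0],Node [g 15;g 16;g 17;g 18;g 19;g 20]
[(1,[0;0;1;-1;0;0;0;0;0],Node [g 21;g 22;g 23;g 24;g 25]
[(1,[0;0;0;1;-1;0;0;0;0],Node [g 26;g 27;g 28;g 29]
[(1,[0;0;0;0;1;-1;0;0;0],Node [g 30;g 31;g 32]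
[(1,[0;0;0;0;0;1;-1;0;0],Leaf [[1;0;0;0;0;0;0;0;0];[3;-1;-1;-1;-1;-1;-1;-1;-1];[3;0;-1;-1;-1;-1;-1;
-1;-1];[3;0;0;-1;-1;-1;-1;-1;-1];[3;0;0;0;-1;-1;-1;-1;-1];[3;0;0;0;0;-1;-1;-1;-1];[3;0;0;0;0;0;-1;
-1;-1];[1;0;0;0;0;0;0;-1;0];[1;0;0;0;0;0;0;0;-1]])])])])])])])].

Definition values1 : seq Q :=
[Qmake 1 1;Qmake 2 1;Qmake 4 1;Qmake 4 1;Qmake 16 3;Qmake 6 1;Qmake 7 1;Qmake 8 1;Qmake 10 1;Qmake
3 1;Qmake 4 1;Qmake 6 1;Qmake 77 12;Qmake 23 3;Qmake 26 3;Qmake 9 1;Qmake 32 3;Qmake 11 1;Qmake 11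
1;Qmake 14 1;Qmake 4 1;Qmake 35 6;Qmake 20 3;Qmake 31 4;Qmake 85 9;Qmake 92 9;Qmake 31 3;Qmake 13 1;
Qmake 4 1;Qmake 355 72;Qmake 41 6;Qmake 31 4;Qmake 103 12;Qmake 92 9;Qmake 178 45;Qmake 16 3;Qmake
94 15;Qmake 59 20;Qmake 18 5;Qmake 29 15;Qmake 1 1].

Definition ranks1 : seq nat :=
[1;2;2;2;2;2;2;2;2;3;3;3;3;3;3;3;3;3;3;3;4;4;4;4;4;4;4;4;5;5;5;5;5;5;6;6;6;7;7;8;9]%N.

End Data.

(** * Evaluation of the tables *)

Definition data (d : nat) := if d == 1%N then data1 else data2.
Definition steps (d : nat) := if d == 1%N then steps1 else steps2.
Definition values (d : nat) := if d == 1%N then values1 else values2.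
Definition ranks (d : nat) := if d == 1%N then ranks1 else ranks2.

Fixpoint undupz (A : matZ) : matZ :=
  if A is a :: A' then if memz a A' then undupz A' else a :: undupz A' else [::].

(** All classes in an orbit restrict to the same functional on the invariant lattice, so each
    functional is kept once. *)
Definition facetz (d : nat) (B : matZ) : matZ :=
  undupz (map (fun E => map (pairz E) B) (curvel d)).

Definition degz (d : nat) (B : matZ) : vecZ := map (pairz (Kz (9 - d))) B.

Definition gramz (B : matZ) : matZ := map (fun b => map (pairz b) B) B.

(** [None] marks a failed certificate; equality with the tabulated values under [Some] thus
    certifies all cases at once. *)
Definition alphaq (d : nat) (c : datum) : option Q :=
  let B := zbasis c in let r := size B in
  let g := detq r (map (map qz) (gramz B)) in
  if eq0q g then None else
  if tvol r (degz d B) (facetz d B)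
       (fan c (fun i => nth [::] (symmetries c) (Z.to_nat i))) is Some q
  then Some (qmul (qz (Z.of_nat r)) (qmul (qabs g) q)) else None.

Fixpoint subseqs (s : seq nat) : seq (seq nat) :=
  if s is x :: s' then let t := subseqs s' in map (cons x) t ++ t else [:: [::]].

(** It is called with fuel 120, the number of positive roots of E_8 and so the length of its longest
    element. *)
Fixpoint descentz (fuel : nat) (sim : matZ) (J : seq nat) (x : vecZ) : seq nat :=
  if fuel is f.+1 then
    if seq.filter (fun j => Z.ltb (pairz x (nth [::] sim j)) Z0) J is j :: _ then
      j :: descentz f sim J (reflz (nth [::] sim j) x)
    else [::]
  else [::].

(* Sorting an antidominant vector spells the longest element of the parabolic subgroup of J. *)
Definition longestz (n : nat) (J : seq nat) : seq nat :=
  descentz 120 (simplez n) J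
    (foldr addz [::] (map (fun j => map Z.opp (nth [::] (coweightz n) j)) J)).

Definition actz (sim : matZ) (s : seq nat) (x : vecZ) : vecZ :=
  foldl (fun x j => reflz (nth [::] sim j) x) x s.

(* The image of J under w_J w_(J + i), up to signs. *)
Definition conjz (n : nat) (J : seq nat) (i : nat) : seq nat :=
  let sim := simplez n in
  let s := longestz n J ++ longestz n (i :: J) in
  let ims := map (fun j => actz sim s (nth [::] sim j)) J in
  let ims2 := ims ++ map (map Z.opp) ims in
  let J' := seq.filter (fun m => memz (nth [::] sim m) ims2) (iota 0 n) in
  if all (fun j => (j < n)%N) J && all (fun v => has (fun m =>
       if eqvz v (nth [::] sim m) then true else eqvz (map Z.opp v) (nth [::] sim m)) J') ims
  then J' else J.

Definition lookups (G : seq (seq nat * seq nat)) (J : seq nat) : seq nat :=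
  foldr (fun p acc => if p.1 == J then p.2 else acc) J G.

(** The table [G] fixes the representatives and moves every other subset one step; nine rounds bring
    each subset to its representative. *)
Definition chain_ok (d : nat) : bool :=
  let n := (9 - d)%N in
  let reps := map simple_part (data d) in
  let G := map (fun p => (p.1, if p.1 \in reps then p.1 else conjz n p.1 p.2))
    (zip (subseqs (iota 0 n)) (steps d)) in
  all (fun J => iter 9 (lookups G) J \in reps) (subseqs (iota 0 n)).

(** The last test certifies that [B] generates all of the orthogonal complement. By duality, e minus
    the sum of <e, al_i> P_i over the simple part is orthogonal to that part, hence equal to its own
    projection, which reads off coordinates at the pivots. *)
Definition basis_ok (d : nat) (c : datum) : bool :=
  let n := (9 - d)%N in let sim := simplez n in let cow := coweightz n in
  let B := zbasis c in let piv := pivots c in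
  let proj v := foldr addz [::]
    (map (fun p => scalez (nth Z0 v p.1) p.2) (zip piv B)) in
  let X := map (fun i => (nth [::] sim i,
             let p := nth [::] cow i in subz p (proj p))) (simple_part c) in
  [&& size piv == size B, all (fun b => size b == n.+1) B,
      all (fun k => (k < n.+1)%N) piv, all (fun i => (i < n)%N) (simple_part c),
      all (fun b => all (fun i => Z.eqb (pairz b (nth [::] sim i)) Z0) (simple_part c)) B,
      all (fun i => all (fun j => Z.eqb (nth Z0 (nth [::] B i) (nth 0%N piv j))
         (if i == j then p1z else Z0)) (iota 0 (size B))) (iota 0 (size B)) &
      all (fun k => let e := unitz n.+1 k in
        eqvz e (foldr addz (proj e) (map (fun p => scalez (pairz e p.1) p.2) X)))
        (iota 0 n.+1)].

(** * Conjugacy of faces *)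

Lemma root_base_d d : (d = 1 \/ d = 2)%N -> root_base (@al d) (@cow d) (posroots d (rootl d)).
Proof.
move=> d12; have := d12; case=> E; subst d.
  exact: (@root_base_of_check 1 d12 roots1 3 roots1E base_ok1).
exact: (@root_base_of_check 2 d12 roots2 3 roots2E base_ok2).
Qed.

Lemma size_subz a b : size (subz a b) = maxn (size a) (size b).
Proof.
elim: a b => [|x a IH] [|y b] //=; rewrite ?size_map ?max0n ?maxn0 //.
by rewrite IH maxnSS.
Qed.

Lemma size_reflz m r x : (size r <= m)%N -> size x = m -> size (reflz r x) = m.
Proof.
by move=> sr sx; rewrite size_subz size_map size_scalez sx; apply/maxn_idPl.
Qed.

Lemma subseqsP s t : subseq s t -> s \in subseqs t.
Proof.
elim: t s => [|x t IH] [|y s] //=; rewrite ?mem_seq1 //.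
  by move=> _; rewrite mem_cat IH ?orbT // sub0seq.
by case: eqP => [->|_] /IH h; rewrite mem_cat ?map_f // h orbT.
Qed.

Section Faces.
Variable d : nat.
Hypothesis d12 : (d = 1 \/ d = 2)%N.
Notation n := (9 - d)%N.
Notation vz := (vecz int n.+1).
Notation sim j := (nth [::] (simplez n) j).

Lemma size_simple j : (j < n)%N -> size (sim j) = n.+1.
Proof.
have h : all (fun b => size b == n.+1) (simplez n) by case: d12 => ->; vm_compute.
by move=> jn; apply/eqP/(allP h); rewrite mem_nth ?size_simplez.
Qed.

Definition face (J : seq nat) : set (Lambda d) :=
  [set u | forall j, j \in J -> pairing u (vz (sim j)) = 0].

Definition face_conj J J' : Prop :=
  exists2 w, weyl d w & forall u, face J u <-> face J' (u *m w).

Lemma face_conj_refl J : face_conj J J.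
Proof. by exists 1%:M => [|u]; rewrite ?mulmx1 //; exact: weyl1. Qed.

Lemma face_conj_trans J1 J2 J3 : face_conj J1 J2 -> face_conj J2 J3 -> face_conj J1 J3.
Proof.
move=> [w hw h] [w' hw' h']; exists (w *m w'); first exact: weylM.
by move=> u; rewrite mulmxA; split=> [/h/h'|/h'/h].
Qed.

Lemma weyl_actz s : exists2 w, weyl d w & forall x, size x = n.+1 ->
  size (actz (simplez n) s x) = n.+1 /\ vz (actz (simplez n) s x) = vz x *m w.
Proof.
elim: s => [|j s [w hw IH]]; first by exists 1%:M => [|x sx]; rewrite ?mulmx1 //; exact: weyl1.
have [jn|jn] := ltnP j n; last first.
  (* An index out of range yields the empty list, and reflecting in it changes nothing. *)
  exists w => // x sx /=; have -> : reflz (sim j) x = x; last exact: IH.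
  rewrite nth_default ?size_simplez // /reflz /addz /=.
  by case: x {sx}.
have hr : is_root d (vz (sim j)) := rb_root (root_base_d d12) (Ordinal jn).
exists (reflection (vz (sim j)) *m w); first exact/weylM/hw/weyl_reflection.
move=> x sx /=; have sx' : size (reflz (sim j) x) = n.+1.
  by apply: size_reflz => //; rewrite size_simple.
have [-> ->] := IH _ sx'; split=> //.
by rewrite mulmxA mul_reflection /reflz vz_add vz_scale /refl vz_pairing.
Qed.

(** A product of simple reflections that carries the simple roots of J onto those of J' up to signs
    also carries the one face onto the other; [conjz] tests exactly this for the word that it
    computes. *)
Lemma face_conjz J i : face_conj J (conjz n J i).
Proof.
rewrite /conjz; set s := longestz n J ++ _; set ims := map _ J.
set J' := seq.filter _ _; case: ifP => [/andP[Jn ok]|_]; last exact: face_conj_refl.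
have [w hw act] := weyl_actz s; exists w => // u.
have imE j : j \in J -> pairing (u *m w) (vz (actz (simplez n) s (sim j))) =
    pairing u (vz (sim j)).
  by move=> /(allP Jn) jn; rewrite (act _ (size_simple jn)).2 weyl_pairing.
have oppE v : pairing (u *m w) (vz (map Z.opp v)) = - pairing (u *m w) (vz v).
  by rewrite vz_opp pairingNr.
split=> [uJ m|uJ j jJ].
  rewrite mem_filter memzE mem_cat => /andP[/orP[|] /mapP[x xJ ->] _].
    by rewrite imE ?uJ.
  by have [j jJ ->] := mapP xJ; rewrite oppE imE ?uJ ?oppr0.
have := allP ok _ (map_f _ jJ) => /hasP[m mJ]; rewrite !eqvzE.
case: eqP => [E _|_ /eqP E]; first by rewrite -imE // E uJ.
by apply/eqP; rewrite -oppr_eq0 -imE // -oppE E uJ.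
Qed.

Hypothesis chain : chain_ok d = true.

Lemma face_chain J : J \in subseqs (iota 0 n) ->
  exists2 c, c \in map simple_part (data d) & face_conj J c.
Proof.
move=> hJ; have := allP chain _ hJ; set G := map _ _ => h.
eexists; first exact: h.
have step K : face_conj K (lookups G K).
  rewrite /lookups /G; elim: (zip _ _) => [|[K1 i] G' IH]; first exact: face_conj_refl.
  rewrite map_cons [foldr _ _ _]/=; case: eqP => [->|_] //; case: ifP => _; first exact: face_conj_refl.
  exact: face_conjz.
elim: 9%N => [|k IH]; first exact: face_conj_refl.
by rewrite iterS; apply: face_conj_trans IH _.
Qed.

Theorem invariants_face (G : set 'M[int]_n.+1) : G `<=` weyl d ->
  exists2 c, c \in map simple_part (data d) &
    exists2 w, weyl d w & forall u, invariants G u <-> face c (u *m w).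
Proof.
move=> GW; have [J [w hw hJ]] := invariants_conj (root_base_d d12) GW.
pose K := [seq val i | i <- enum J].
have KE u : perp (@al d) J u <-> face K u.
  split=> [h _ /mapP[i iJ ->]|h i iJ]; first by apply: h; rewrite -mem_enum.
  by apply: h; rewrite map_f // mem_enum.
have [|c hc [w' hw' h']] := @face_chain K.
  apply: subseqsP; rewrite -val_enum_ord; apply: map_subseq.
  by rewrite [X in subseq X _](_ : _ = seq.filter (mem J) (enum 'I_n)) ?filter_subseq // enumT.
exists c => //; exists (w *m w'); first exact: weylM.
by move=> u; rewrite mulmxA; split=> [/hJ/KE/h'|/h'/KE/hJ].
Qed.

End Faces.

(** * Lattice bases *)

Section Lattice.
Variable R : realType.
Variable n : nat.
Implicit Types (M : set 'rV[R]_n).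

Lemma toR_inj p q : injective (@toR R p q).
Proof. by move=> A B /matrixP E; apply/matrixP => i j; have := E i j; rewrite !mxE => /intr_inj. Qed.

Lemma toR_mul p q s (A : 'M[int]_(p, q)) (B : 'M[int]_(q, s)) :
  toR R (A *m B) = toR R A *m toR R B.
Proof. exact: map_mxM. Qed.

Lemma lattice_basis_change M r s (B : 'M[R]_(r, n)) (B' : 'M[R]_(s, n)) :
  lattice_basis M B -> lattice_basis M B' -> exists U : 'M[int]_(s, r), B' = toR R U *m B.
Proof.
move=> [_ EM] [_ EM'].
have h (i : 'I_s) : exists c : 'rV[int]_r, toR R c *m B = row i B'.
  have : M (row i B').
    rewrite EM'; exists (delta_mx 0 i) => //=; rewrite rowE; congr (_ *m _).
    by apply/rowP => j; rewrite !mxE; case: (_ && _).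
  by rewrite EM => -[c _ E]; exists c.
exists (\matrix_i sval (cid (h i))); apply/row_matrixP => i.
rewrite row_mul -(svalP (cid (h i))); congr (_ *m _).
by apply/rowP => j; rewrite !mxE.
Qed.

Lemma lattice_basis_rank M r s (B : 'M[R]_(r, n)) (B' : 'M[R]_(s, n)) :
  lattice_basis M B -> lattice_basis M B' -> s = r.
Proof.
have le p q (C : 'M[R]_(p, n)) (C' : 'M[R]_(q, n)) : lattice_basis M C -> lattice_basis M C' -> (q <= p)%N.
  move=> hC hC'; have [U E] := lattice_basis_change hC hC'.
  have [+ _] := hC'; have [+ _] := hC; rewrite /row_free => /eqP <- /eqP <-.
  by rewrite E mxrankM_maxr.
by move=> h h'; apply/eqP; rewrite eqn_leq (le _ _ _ _ h h') (le _ _ _ _ h' h).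
Qed.

(** The two transition matrices are integral and mutually inverse. This makes the volumes
    independent of the bases that [xget] happens to select. *)
Lemma lattice_basis_unimodular M r (B B' : 'M[R]_(r, n)) :
  lattice_basis M B -> lattice_basis M B' ->
  exists2 U : 'M[int]_r, B' = toR R U *m B & `|\det (toR R U)| = 1.
Proof.
move=> h h'; have [U E] := lattice_basis_change h h'; have [U' E'] := lattice_basis_change h' h.
exists U => //; rewrite det_map_mx.
suff : U \in unitmx.
  by rewrite unitmxE qualifE /= => /orP[] /eqP ->; rewrite ?rmorphN rmorph1 ?normrN normr1.
have : toR R (U *m U') *m B' = 1%:M *m B' by rewrite toR_mul -mulmxA -E' -E mul1mx.
move/(row_free_inj h'.1) => E1; have : U *m U' = 1%:M.
  by apply: toR_inj; rewrite E1; apply/matrixP => i j; rewrite !mxE; case: (i == j).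
by case/mulmx1_unit.
Qed.

Lemma lat_basisP M r (B : 'M[R]_(r, n)) : lattice_basis M B ->
  lat_rank M = r /\ lattice_basis M (lat_basis M).
Proof.
move=> hB; have [B0 hB0] : [set r | exists B : 'M[R]_(r, n), lattice_basis M B] (lat_rank M).
  by apply: (@xgetPex _ _ [set r | exists B : 'M[R]_(r, n), lattice_basis M B]); exists r, B.
split; first exact: lattice_basis_rank hB hB0.
by apply: (@xgetPex _ _ [set B | lattice_basis M B]); exists B0.
Qed.

End Lattice.

(** * Integral bases of faces *)

Section FaceBasis.
Variable d : nat.
Hypothesis d12 : (d = 1 \/ d = 2)%N.
Notation n := (9 - d)%N.
Notation vz := (vecz int n.+1).
Variable c : datum.
Hypothesis ok : basis_ok d c.
Notation r := (size (zbasis c)).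

Definition base_mx : 'M[int]_(r, n.+1) := mxz int r n.+1 (zbasis c).

Lemma row_base_mx i : row i base_mx = vz (nth [::] (zbasis c) i).
Proof. by apply/rowP => j; rewrite !mxE. Qed.

Lemma size_basis b : b \in zbasis c -> size b = n.+1.
Proof. by case/and5P: ok => _ + _ _ _ => /allP h /h /eqP. Qed.

Lemma size_basis_nth (i : 'I_r) : size (nth [::] (zbasis c) i) = n.+1.
Proof. by rewrite size_basis // mem_nth. Qed.

Lemma pivot_lt i : (i < r)%N -> (nth 0%N (pivots c) i < n.+1)%N.
Proof.
case/and5P: ok => /eqP sz _ h _ _ ir; by apply: (allP h); rewrite mem_nth // sz.
Qed.

Definition pivot_mx : 'M[int]_(n.+1, r) :=
  \matrix_(k, j) (k == nth 0%N (pivots c) j :> nat)%:R.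

(** A right inverse of the basis matrix, from which the independence of its rows follows. *)
Lemma base_pivot : base_mx *m pivot_mx = 1%:M.
Proof.
apply/matrixP => i j; rewrite !mxE (bigD1 (Ordinal (pivot_lt (ltn_ord j)))) //= big1 ?addr0.
  rewrite !mxE eqxx mulr1; case/and5P: ok => _ _ _ _ /and3P[_ h _].
  have := allP h i; rewrite mem_iota ltn_ord => /(_ isT)/allP/(_ j).
  rewrite mem_iota ltn_ord => /(_ isT)/Z.eqb_spec ->.
  by rewrite -[(i == j :> nat)]/(i == j); case: (i == j).
move=> k; rewrite -val_eqE /= => ne; by rewrite !mxE (negPf ne) mulr0.
Qed.

Lemma face_basis u : face (simple_part c) u <-> exists y : 'rV[int]_r, u = y *m base_mx.
Proof.
have sI i : i \in simple_part c -> (i < n)%N.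
  by case/and5P: ok => _ _ _ /allP h _ /h.
case/and5P: ok => /eqP szp _ _ _ /and3P[perp _ res]; split=> [uI|[y ->] j jI]; last first.
  rewrite mulmx_sum_row pairing_suml big1 // => i _; rewrite pairingZl row_base_mx.
  have := allP (allP perp _ (mem_nth [::] (ltn_ord i))) j jI => /Z.eqb_spec E.
  by rewrite vz_pairing ?size_basis_nth // E mulr0.
pose sim j := nth [::] (simplez n) j.
pose proj v := foldr addz [::] (map (fun p => scalez (nth Z0 v p.1) p.2) (zip (pivots c) (zbasis c))).
pose X i := let p := nth [::] (coweightz n) i in subz p (proj p).
(* T is the decomposition tested by [basis_ok], the identity because it is so on unit vectors. On
   the face its second sum vanishes, leaving an integral combination of the basis. *)
pose T := \sum_(i < r) delta_mx (inord (nth 0%N (pivots c) i)) 0 *m vz (nth [::] (zbasis c) i) +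
  \sum_(j <- simple_part c) gram int n *m (vz (sim j))^T *m vz (X j).
have TE v : v *m T = \sum_(i < r) v 0 (inord (nth 0%N (pivots c) i)) *: vz (nth [::] (zbasis c) i) +
    \sum_(j <- simple_part c) pairing v (vz (sim j)) *: vz (X j).
  rewrite mulmxDr !mulmx_sumr; congr (_ + _); apply: eq_bigr => i _.
    rewrite mulmxA -colE; apply/rowP => k; rewrite mxE big_ord1 !mxE.
    by [].
  by rewrite scale_pairing.
have projE v : vz (proj v) = \sum_(i < r) vz v 0 (inord (nth 0%N (pivots c) i)) *:
    vz (nth [::] (zbasis c) i).
  rewrite /proj vz_foldr big_map (big_nth (0%N, [::])) size_zip szp minnn big_mkord.
  rewrite (_ : vz [::] = 0) ?add0r; last by apply/rowP => k; rewrite !mxE nth_nil.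
  apply: eq_bigr => i _; rewrite nth_zip //; cbv [fst snd]; rewrite vz_scale mxE inordK //.
  exact: pivot_lt.
have T1 : T = 1%:M.
  apply/row_matrixP => k; rewrite !rowE mulmx1 TE -vz_unitz.
  have := allP res k; rewrite mem_iota ltn_ord => /(_ isT); cbv beta zeta; rewrite eqvzE => /eqP E.
  rewrite {3}E vz_foldr -/(proj _) projE big_map big_map; congr (_ + _).
  apply: eq_big_seq => i /sI iI; cbv [fst snd]; rewrite vz_scale vz_pairing //.
  by rewrite size_mkseq.
exists (\row_i u 0 (inord (nth 0%N (pivots c) i))).
rewrite -[LHS]mulmx1 -T1 TE [X in _ + X]big1_seq ?addr0; last first.
  by move=> j /andP[_ jI]; rewrite uI // scale0r.
by rewrite mulmx_sum_row; apply: eq_bigr => i _; rewrite row_base_mx mxE.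
Qed.

End FaceBasis.

(** * The value of alpha *)

Lemma toR_pairing (R : realType) n (u v : 'rV[int]_n.+1) :
  pairing (toR R u) (toR R v) = (pairing u v)%:~R.
Proof.
rewrite !pairingE rmorphB rmorphM rmorph_sum !mxE; congr (_ - _).
by apply: eq_bigr => j _; rewrite !mxE rmorphM.
Qed.

Lemma curvelP d E : (d = 1 \/ d = 2)%N -> minus_one_class d E <->
  exists2 a, a \in curvel d & E = vecz int (9 - d).+1 a.
Proof.
move=> d12; split=> [hE|[a aC ->]].
  exists (lst E); last by rewrite lstK.
  have <- : curvez (9 - d) = curvel d by case: d12 => ->; [exact: curves1E|exact: curves2E].
  exact: curvezP.
have h : all (fun a => [&& size a == (9 - d).+1, Z.eqb (pairz a a) m1z &
    Z.eqb (pairz (Kz (9 - d)) a) p1z]) (curvel d).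
  by case: d12 => ->; vm_cast_no_check (erefl true).
have /and3P[/eqP sa /Z.eqb_spec E1 /Z.eqb_spec E2] := allP h _ aC.
by split; rewrite ?antiK_vz ?vz_pairing ?E1 ?E2 //= ?size_nseq.
Qed.

Lemma undupzE A : undupz A =i A.
Proof.
elim: A => //= a A IH b; rewrite memzE inE; case: ifP => aA; rewrite ?inE IH //.
by case: eqP => [->|].
Qed.

Section Alpha.
Variables (R : realType) (d : nat).
Hypothesis d12 : (d = 1 \/ d = 2)%N.
Notation n := (9 - d)%N.
Variable G : set 'M[int]_n.+1.
Hypotheses (GW : G `<=` weyl d) (G0 : G !=set0).
Hypothesis GM : forall g h, G g -> G h -> G (g *m h).
Variables (c : datum) (w : 'M[int]_n.+1).
Hypotheses (hw : weyl d w) (ok : basis_ok d c).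
Hypothesis hG : forall u, invariants G u <-> face (simple_part c) (u *m w).
Notation r := (size (zbasis c)).

(** w takes the invariants of G to the tabulated face, so its inverse brings the tabulated basis
    back. *)
Let Bi : 'M[int]_(r, n.+1) := base_mx d c *m invmx w.
Let B : 'M[R]_(r, n.+1) := toR R Bi.

Let invP u : invariants G u <-> exists y : 'rV[int]_r, u = y *m Bi.
Proof.
split=> [/hG/(face_basis ok)[y E]|[y ->]].
  by exists y; rewrite mulmxA -E mulmxK // weyl_unitmx.
by apply/hG/(face_basis ok); exists y; rewrite mulmxA mulmxKV // weyl_unitmx.
Qed.

Let row_inv i : invariants G (row i Bi).
Proof. by apply/invP; exists (delta_mx 0 i); rewrite -rowE. Qed.

Lemma inv_lattice_basis : lattice_basis (inv_lattice R G) B.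
Proof.
split.
  apply/row_freeP; exists (toR R (w *m pivot_mx d c)); rewrite -toR_mul /Bi.
  rewrite mulmxA mulmxKV ?weyl_unitmx // base_pivot //.
  by apply/matrixP => i j; rewrite !mxE; case: (i == j).
apply/seteqP; split=> x [u]; first by move=> /invP[y ->] <-; exists y => //; rewrite toR_mul.
by move=> _ <-; exists (u *m Bi); [apply/invP; exists u|rewrite toR_mul].
Qed.

Let Qm : 'M[R]_r := mxz R r r (gramz (zbasis c)).

Let gramE : B *m gram R n *m B^T = Qm.
Proof.
apply/matrixP => i j.
have -> : (B *m gram R n *m B^T) i j = pairing (row i B) (row j B).
  by rewrite /pairing -row_mul mxE [RHS]mxE; apply: eq_bigr => k _; rewrite !(mxE, tr_row).
have rowB k : row k B = toR R (row k Bi) by apply/rowP => l; rewrite !mxE.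
rewrite !rowB toR_pairing !row_mul weyl_pairing; last exact: weylV.
rewrite !row_base_mx vz_pairing ?(size_basis_nth ok) // mxE.
rewrite (nth_map [::]) // (nth_map [::]) //.
by rewrite /zr intz.
Qed.

Let pairB x y : pairing (x *m B) (y *m B) = (x *m Qm *m y^T) 0 0.
Proof. by rewrite /pairing trmx_mul -gramE !mulmxA. Qed.

Let QmT : Qm^T = Qm.
Proof.
apply/matrixP => i j; rewrite -gramE !trmx_mul trmxK !mulmxA.
by rewrite /gram tr_diag_mx.
Qed.

(** The polytope of alpha before coordinates are chosen: functionals are represented by pairing, and
    the individual (-1)-classes stand in for the orbit sums. *)
Definition nef (v : 'rV[R]_n.+1) : Prop :=
  (forall E, minus_one_class d E -> 0 <= pairing v (toR R E)) /\
  pairing v (toR R (antiK d)) <= 1.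

Let pairBE y E : pairing (y *m B) (toR R E) = \sum_j y 0 j * (pairing (row j Bi) E)%:~R.
Proof.
rewrite mulmx_sum_row pairing_suml; apply: eq_bigr => j _; rewrite pairingZl.
by rewrite -toR_pairing; congr (_ * pairing _ _); apply/rowP => k; rewrite !mxE.
Qed.

Let pairB_ev y a : pairing (y *m B) (toR R (vecz int n.+1 a *m invmx w)) =
  ev (map (pairz a) (zbasis c)) y.
Proof.
rewrite pairBE; apply: eq_bigr => j _; congr (_ * _).
rewrite row_mul weyl_pairing; last exact: weylV.
rewrite row_base_mx vz_pairing ?(size_basis_nth ok) // (nth_map [::]) //.
by rewrite pairzC /zr intz.
Qed.

(** w permutes the (-1)-classes, fixes -K and is an isometry, so the inequalities in the coordinates
    on [B] are those of the table. *)
Let nef_region : [set y : 'rV[R]_r | nef (y *m B)] =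
  @region R r (facetz d (zbasis c)) (degz d (zbasis c)).
Proof.
have EK y : pairing (y *m B) (toR R (antiK d)) = ev (degz d (zbasis c)) y.
  by rewrite -(weyl_antiK (weylV hw)) antiK_vz // pairB_ev.
apply/seteqP; split=> y [h1 h2]; split; rewrite ?EK // -?EK //.
  move=> a; rewrite undupzE => /mapP[E EC ->]; rewrite -pairB_ev; apply: h1.
  by apply: weyl_curve; [exact: weylV|apply/(curvelP _ d12); exists E].
move=> E hE; have := weyl_curve hw hE => /(curvelP _ d12)[a aC E'].
rewrite -[E](mulmxK (weyl_unitmx hw)) E' pairB_ev; apply: h1.
by rewrite undupzE; apply/mapP; exists a.
Qed.

(** The (-1)-classes are listed in [curvel], so orbits are finite and the finitely supported sum in
    [orbit_sum] is a sum over an actual list. *)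
Lemma orbit_list E : minus_one_class d E -> exists s : seq (Lambda d),
  [/\ uniq s, (0 < size s)%N, (forall F, F \in s <-> exists2 g, G g & F = E *m g) &
      orbit_sum G E = \sum_(F <- s) F].
Proof.
move=> hE.
pose s := undup (seq.filter (fun F => `[< [set E *m g | g in G] F >])
  (map (vecz int n.+1) (curvel d))).
have sP F : F \in s <-> exists2 g, G g & F = E *m g.
  rewrite mem_undup mem_filter; split=> [/andP[/asboolP[g Gg <-] _]|[g Gg ->]].
    by exists g.
  apply/andP; split; first by apply/asboolP; exists g.
  have := weyl_curve (GW Gg) hE => /(curvelP _ d12)[a aC ->]; exact: map_f.
exists s; split=> //; first exact: undup_uniq.
  have [g Gg] := G0; rewrite lt0n size_eq0; apply/eqP => s0.
  by have : E *m g \in s by [apply/sP; exists g]; rewrite s0.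
rewrite fsbig_seq ?undup_uniq // /orbit_sum.
suff -> : [set E *m g | g in G] = [set` s] by [].
by apply/seteqP; split=> F; [move=> [g Gg <-]; apply/sP; exists g|move=> /sP[g Gg ->]; exists g].
Qed.

Let orbit_pair y E : minus_one_class d E -> exists2 N : nat, (0 < N)%N &
  pairing (y *m B) (toR R (orbit_sum G E)) = N%:R * pairing (y *m B) (toR R E).
Proof.
move=> hE; have [s [_ s0 sP ->]] := orbit_list hE; exists (size s) => //.
rewrite !pairBE mulr_sumr; apply: eq_bigr => j _; rewrite mulrCA; congr (_ * _).
rewrite pairingC pairing_suml rmorph_sum big_seq.
under eq_bigr => F Fs.
  have -> : pairing F (row j Bi) = pairing (row j Bi) E.
    have /sP[g Gg ->] := Fs.
    have := weyl_pairing (row j Bi) E (GW Gg); rewrite (row_inv j Gg) => <-; exact: pairingC.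
  over.
by rewrite -big_seq big_const_seq iter_addr_0 count_predT mulr_natl.
Qed.

(** Multiplication by an element of G maps the finite orbit injectively into itself, so it only
    permutes the summands. *)
Let orbit_inv E : minus_one_class d E -> invariants G (orbit_sum G E).
Proof.
move=> hE h Gh; have [s [us s0 sP ->]] := orbit_list hE.
rewrite mulmx_suml -(big_map (mulmx^~ h) xpredT id); apply: perm_big.
have uh : uniq (map (mulmx^~ h) s).
  rewrite map_inj_uniq // => x y /(congr1 (mulmx^~ (invmx h))).
  by rewrite !mulmxK // weyl_unitmx //; exact: GW.
apply: uniq_perm => //; have [] := @uniq_min_size _ (map (mulmx^~ h) s) s uh.
- move=> F /mapP[F' /sP[g Gg ->] ->]; apply/sP; exists (g *m h); rewrite ?mulmxA //.
  exact: GM.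
- by rewrite size_map.
- by [].
Qed.

Let cone_pair y : (forall s, orbit_cone R G s -> 0 <= pairing (y *m B) s) <->
  (forall E, minus_one_class d E -> 0 <= pairing (y *m B) (toR R E)).
Proof.
split=> [h E hE|h s [l hl ->]].
  have [N N0 E1] := orbit_pair y hE.
  have : 0 <= pairing (y *m B) (toR R (orbit_sum G E)).
    apply: h; exists [:: (1, orbit_sum G E)]; last by rewrite big_seq1 scale1r.
    by move=> p; rewrite inE => /eqP ->; split=> //=; exists E.
  by rewrite E1 pmulr_rge0 // ltr0n.
rewrite pairingC pairing_suml big_seq sumr_ge0 // => p pl; have [p0 [E hE EE]] := hl p pl.
rewrite pairingZl mulr_ge0 // pairingC -EE; have [N N0 ->] := orbit_pair y hE.
by rewrite mulr_ge0 // h.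
Qed.

Let span_inv u : invariants G u -> exists y : 'rV[R]_r, toR R u = y *m B.
Proof. by move=> /invP[y ->]; exists (toR R y); rewrite toR_mul. Qed.

Let cone_span s : orbit_cone R G s -> exists y : 'rV[R]_r, s = y *m B.
Proof.
move=> [l hl ->]; rewrite big_seq.
  apply: (big_rec (fun s => exists y : 'rV[R]_r, s = y *m B)); first by exists 0; rewrite mul0mx.
move=> p x pl [y ->]; have [_ [E hE EE]] := hl p pl.
have [z Ez] := span_inv (orbit_inv hE); rewrite -EE Ez.
by exists (p.1 *: z + y); rewrite mulmxDl scalemxAl.
Qed.

Let antiK_inv : invariants G (antiK d).
Proof. by move=> g /GW/weyl_antiK. Qed.

Hypothesis det_gram : eq0q (detq r (map (map qz) (gramz (zbasis c)))) = false.
Notation gq := (detq r (map (map qz) (gramz (zbasis c)))).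

Let detQm : \det Qm = qr R gq.
Proof.
have s1 : size (map (map qz) (gramz (zbasis c))) = r by rewrite !size_map.
have s2 : all (fun v => size v == r) (map (map qz) (gramz (zbasis c))).
  by rewrite all_map all_map; apply/allP => b _ /=; rewrite !size_map.
rewrite -(det_mxq R s1 s2 det_gram).
congr (\det _); apply/matrixP => i j; rewrite !mxE (nth_map [::]) ?size_map //.
by rewrite (nth_map Z0) ?qr_qz // (nth_map [::]) // size_map.
Qed.

Let Qm_unit : Qm \in unitmx.
Proof. by rewrite unitmxE unitfE detQm eq0qF. Qed.

Variable q : Q.
Hypothesis fan_vol : tvol r (degz d (zbasis c)) (facetz d (zbasis c))
  (fan c (fun i => nth [::] (symmetries c) (Z.to_nat i))) = Some q.

Let vol_nef (T : 'M[R]_r) : T \in unitmx ->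
  (vol [set v : 'rV[R]_r | nef (v *m T *m B)] = (`|\det T|^-1 * qr R q)%:E)%E.
Proof.
move=> uT; have := @volume_scales_unit R r T uT [set y | nef (y *m B)].
rewrite nef_region => /(_ (@vmeas_region _ _ _ _)); rewrite (tvol_sound R fan_vol) -EFinM => <-.
by rewrite -nef_region.
Qed.

Let nefE y : nef (y *m B) <->
  (forall s, orbit_cone R G s -> 0 <= pairing (y *m B) s) /\
  pairing (y *m B) (toR R (antiK d)) <= 1.
Proof. by split=> -[/cone_pair h1 h2]. Qed.

Theorem alphaE : picard_rank R G = r /\
  alpha R G = (r%:R * (`|qr R gq| * qr R q))%:E.
Proof.
have [Er hB'] := lat_basisP inv_lattice_basis; split=> //.
rewrite /alpha /picard_rank; cbv zeta; move: (lat_basis _) hB'; rewrite Er => B' hB'.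
have [U EB dU] := lattice_basis_unimodular inv_lattice_basis hB'.
set V := toR R U in EB dU.
have uV : V \in unitmx by rewrite unitmxE unitfE -normr_eq0 dU oner_eq0.
(* T turns the row of values of a functional on B' = V B into the B-coordinates of the vector
   representing it. V being unimodular, its determinant is that of the inverse Gram matrix up to
   sign. *)
pose T := (invmx V)^T *m invmx Qm.
have pairT x v : pairing (v *m T *m B) (x *m B') = (x *m v^T) 0 0.
  rewrite pairingC EB mulmxA pairB !trmx_mul trmxK trmx_inv QmT !mulmxA.
  by rewrite (mulmxK Qm_unit) mulmxK.
have spanB' (y : 'rV[R]_r) : y *m B = y *m invmx V *m B' by rewrite EB mulmxA mulmxKV.
rewrite EFinM; congr (_ * _)%E; rewrite -detQm.
have -> : `|\det Qm| = `|\det T|^-1.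
  by rewrite det_mulmx det_tr !det_inv !normrM !normfV dU invr1 mul1r invrK.
rewrite -vol_nef; last by rewrite unitmx_mul unitmx_tr !unitmx_inv uV.
congr vol; apply/seteqP; split=> v /=.
  move=> [h1 h2]; apply/nefE; split=> [s hs|].
    have [y Ey] := cone_span hs; move: hs; rewrite Ey (spanB' y) => hs.
    by rewrite pairT h1.
  by have [y Ey] := span_inv antiK_inv; rewrite Ey (spanB' y) pairT h2 // -spanB'.
by move=> /nefE[h1 h2]; split=> x hx; rewrite -pairT ?h1 // hx.
Qed.

(** The vector y B pairs integrally with all rows of B exactly when y Q is integral, so the rows of
    Q^-1 B form a basis. *)
Lemma dual_lattice_basis : lattice_basis
  [set x | real_span R (invariants G) x /\
    forall y, invariants G y -> exists m : int, pairing x (toR R y) = m%:~R] (invmx Qm *m B).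
Proof.
have pairD y z : pairing (y *m B) (toR R (z *m Bi)) = (y *m Qm *m (toR R z)^T) 0 0.
  by rewrite toR_mul pairB.
split.
  by rewrite /row_free mxrankMfree ?inv_lattice_basis.1 // -/(row_free _) row_free_unit unitmx_inv.
apply/seteqP; split=> x.
  move=> [[l hl Ex] hx]; have [y Ey] : exists y : 'rV[R]_r, x = y *m B.
    rewrite Ex big_seq.
  apply: (big_rec (fun s => exists y : 'rV[R]_r, s = y *m B)); first by exists 0; rewrite mul0mx.
    move=> p z pl [y ->]; have [z' ->] := span_inv (hl p pl).2.
    by exists (p.1 *: z' + y); rewrite mulmxDl scalemxAl.
  have hm (j : 'I_r) : exists m : int, (y *m Qm) 0 j = m%:~R.
    have [m Em] := hx _ (row_inv j); exists m; rewrite -Em Ey rowE pairD.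
    rewrite (_ : toR R (delta_mx 0 j) = delta_mx 0 j) ?trmx_delta -?colE ?mxE //.
    by apply/rowP => k; rewrite !mxE; case: (_ && _).
  exists (\row_j sval (cid (hm j))) => //; rewrite Ey mulmxA; congr (_ *m _).
  rewrite -[y in RHS](mulmxK Qm_unit); congr (_ *m _).
  by apply/rowP => j; rewrite !mxE -(svalP (cid (hm j))) mxE.
move=> [z _ <-]; rewrite mulmxA; split.
  exists [seq ((toR R z *m invmx Qm) 0 j, row j Bi) | j <- enum 'I_r].
    by move=> p /mapP[j _ ->]; split=> // g; exact: row_inv.
  rewrite mulmx_sum_row big_map big_enum; apply: eq_bigr => j _; cbv [fst snd].
  by congr (_ *: _); apply/rowP => k; rewrite !mxE.
move=> y /invP[u ->]; rewrite pairD mulmxKV //.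
exists ((z *m u^T) 0 0); rewrite !mxE rmorph_sum; apply: eq_bigr => j _.
by rewrite !mxE rmorphM.
Qed.

(** The chosen basis of the dual lattice differs from Q^-1 B by a unimodular V, so the polytope is
    [nef] pulled back along V Q^-1, which scales volume as in [alphaE]. *)
Theorem surface_alphaE (k : fieldType) (S : delPezzo R k d) :
  Pic S = invariants G -> cone R (effective_class S) = orbit_cone R G ->
  surface_rank S = r /\ surface_alpha S = (r%:R * (`|qr R gq| * qr R q))%:E.
Proof.
move=> hP hC; have Er : surface_rank S = r.
  by have [] := lat_basisP inv_lattice_basis; rewrite /surface_rank /Pic_lattice hP.
split=> //; rewrite /surface_alpha Er hC.
have : lattice_basis (dual_Pic_lattice S) (invmx Qm *m B).
  by rewrite /dual_Pic_lattice hP; exact: dual_lattice_basis.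
move=> hD; have [Ed hB'] := lat_basisP hD.
cbv zeta; move: (lat_basis _) hB'; rewrite Ed => B' hB'.
have [U EB dU] := lattice_basis_unimodular hD hB'.
set V := toR R U in EB dU.
have uV : V \in unitmx by rewrite unitmxE unitfE -normr_eq0 dU oner_eq0.
pose T := V *m invmx Qm.
rewrite EFinM; congr (_ * _)%E; rewrite -detQm.
have -> : `|\det Qm| = `|\det T|^-1.
  by rewrite det_mulmx det_inv normrM normfV dU mul1r invrK.
rewrite -vol_nef; last by rewrite unitmx_mul unitmx_inv uV.
have EvB (v : 'rV[R]_r) : v *m B' = v *m T *m B by rewrite EB !mulmxA.
by congr vol; apply/seteqP; split=> v; rewrite /mkset EvB => /nefE.
Qed.

End Alpha.

(** * Classification *)

Definition qeqb (p q : Q) : bool :=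
  Z.eqb (Z.mul (QArith_base.Qnum p) (Zpos (QArith_base.Qden q)))
        (Z.mul (QArith_base.Qnum q) (Zpos (QArith_base.Qden p))).

Lemma qr_inj (F : numFieldType) p q : qr F p = qr F q -> qeqb p q.
Proof.
move/eqP; rewrite /qr eqr_div ?zr_pos_neq0 // -!zrM => /eqP/(@zr_inj F) E.
exact/Z.eqb_spec.
Qed.

(* Separates classes of equal rank and equal alpha. *)
Definition orth_roots (d : nat) (c : datum) : nat :=
  count (fun a => all (fun b => Z.eqb (pairz a b) Z0) (zbasis c)) (rootl d).

Definition datum0 : datum := Datum [::] [::] [::] [::] (fun _ => Leaf [::]).

Definition data_ok (d : nat) : bool :=
  [&& all (basis_ok d) (data d),
      map (fun c => size (zbasis c)) (data d) == ranks d,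
      all (fun a => [&& size a == (9 - d).+1, Z.eqb (pairz (Kz (9 - d)) a) Z0 &
         Z.eqb (pairz a a) (Zneg 2)]) (rootl d), uniqz (rootl d) &
      pairwise (fun x y => if x.1 == y.1 then if qeqb x.2.1 y.2.1 then x.2.2 != y.2.2
                           else true else true)
        (zip (ranks d) (zip (values d) (map (orth_roots d) (data d))))].

Lemma data_ok1 : data_ok 1 = true. Proof. by vm_cast_no_check (erefl true). Qed.
Lemma data_ok2 : data_ok 2 = true. Proof. by vm_cast_no_check (erefl true). Qed.
Lemma chain_ok1 : chain_ok 1 = true. Proof. by vm_cast_no_check (erefl true). Qed.
Lemma chain_ok2 : chain_ok 2 = true. Proof. by vm_cast_no_check (erefl true). Qed.
Lemma alphaq1 : map (alphaq 1) (data 1) = map Some (values 1).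
Proof. by vm_cast_no_check (erefl (map Some (values 1))). Qed.
Lemma alphaq2 : map (alphaq 2) (data 2) = map Some (values 2).
Proof. by vm_cast_no_check (erefl (map Some (values 2))). Qed.

Section Classes.
Variable d : nat.
Hypothesis d12 : (d = 1 \/ d = 2)%N.
Notation n := (9 - d)%N.
Notation M := 'M[int]_n.+1.
Notation vz := (vecz int n.+1).
Notation N := (size (data d)).
Notation cd i := (nth datum0 (data d) i).
Implicit Types (i j : nat) (G : set M).

Let dok : data_ok d.
Proof. by case: d12 => ->; [exact: data_ok1|exact: data_ok2]. Qed.

Let chain : chain_ok d = true.
Proof. by case: d12 => ->; [exact: chain_ok1|exact: chain_ok2]. Qed.

Let alphaqE : map (alphaq d) (data d) = map Some (values d).
Proof. by case: d12 => ->; [exact: alphaq1|exact: alphaq2]. Qed.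

Lemma datum_ok i : (i < N)%N -> basis_ok d (cd i).
Proof. by move=> iN; have /and5P[h _ _ _ _] := dok; exact: (all_nthP datum0 h). Qed.

Let ranksE : map (fun c => size (zbasis c)) (data d) = ranks d.
Proof. by have /and5P := dok; case=> _ /eqP. Qed.

Lemma size_values : size (values d) = N.
Proof. by rewrite -(size_map Some) -alphaqE size_map. Qed.

Lemma size_ranks : size (ranks d) = N.
Proof. by rewrite -ranksE size_map. Qed.

Notation rk i := (nth 0%N (ranks d) i).
Notation val i := (nth (Qmake Z0 xH) (values d) i).

Definition type_of G i : Prop :=
  exists2 w, weyl d w & forall u, invariants G u <-> face (simple_part (cd i)) (u *m w).

Lemma type_exists G : G `<=` weyl d -> exists2 i, (i < N)%N & type_of G i.
Proof.
move=> GW; have [c /(nthP [::])[i iN <-] [w hw h]] := invariants_face d12 chain GW.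
rewrite size_map in iN; exists i => //; exists w => // u.
by rewrite h (nth_map datum0).
Qed.

Section Values.
Variables (R : realType) (G : set M) (i : nat).
Hypotheses (GW : G `<=` weyl d) (G0 : G !=set0) (GM : forall g h, G g -> G h -> G (g *m h)).
Hypotheses (iN : (i < N)%N) (Gi : type_of G i).

Let valE : exists q, [/\ eq0q (detq (size (zbasis (cd i)))
      (map (map qz) (gramz (zbasis (cd i))))) = false,
    tvol (size (zbasis (cd i))) (degz d (zbasis (cd i))) (facetz d (zbasis (cd i)))
      (fan (cd i) (fun z => nth [::] (symmetries (cd i)) (Z.to_nat z))) = Some q &
    qr R (val i) = (rk i)%:R *
      (`|qr R (detq (size (zbasis (cd i))) (map (map qz) (gramz (zbasis (cd i)))))| * qr R q)].
Proof.
have : nth None (map (alphaq d) (data d)) i = Some (val i).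
  by rewrite alphaqE (nth_map (Qmake Z0 xH)) // size_values.
rewrite (nth_map datum0) // /alphaq; cbv zeta.
case E1: (eq0q _) => //; case E2: (tvol _ _ _ _) => [q|] // [<-].
exists q; split=> //; rewrite !qrM qr_qz zr_nat qr_abs.
by rewrite -ranksE (nth_map datum0).
Qed.

Lemma type_alpha : picard_rank R G = rk i /\ alpha R G = (qr R (val i))%:E.
Proof.
have [w hw h] := Gi; have [q [E1 E2 ->]] := valE.
have [-> ->] := alphaE R d12 GW G0 GM hw (datum_ok iN) h E1 E2.
by rewrite -ranksE (nth_map datum0).
Qed.

Lemma type_surface (k : fieldType) (S : delPezzo R k d) :
  Pic S = invariants G -> cone R (effective_class S) = orbit_cone R G ->
  surface_rank S = rk i /\ surface_alpha S = (qr R (val i))%:E.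
Proof.
move=> hP hC; have [w hw h] := Gi; have [q [E1 E2 ->]] := valE.
have [-> ->] := surface_alphaE d12 GW G0 hw (datum_ok iN) h E1 E2 hP hC.
by rewrite -ranksE (nth_map datum0).
Qed.

End Values.

Let face_root c x : basis_ok d c ->
  (forall u, face (simple_part c) u -> pairing x u = 0) <->
  (forall b, b \in zbasis c -> pairing x (vz b) = 0).
Proof.
move=> okc; split=> [h b bc|h u].
  apply: h; apply/(face_basis okc).
  have [i ir <-] := nthP [::] bc; exists (delta_mx 0 (Ordinal ir)).
  by rewrite -rowE row_base_mx.
move=> /(face_basis okc)[y ->]; rewrite pairingC mulmx_sum_row pairing_suml big1 // => i _.
by rewrite pairingZl pairingC row_base_mx h ?mulr0 // mem_nth.
Qed.

Let root_in a : a \in rootl d -> size a = n.+1 /\ is_root d (vz a).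
Proof.
move=> aR; have /and5P[_ _ h _ _] := dok; have := allP h _ aR.
move=> /and3P[/eqP sa /Z.eqb_spec E1 /Z.eqb_spec E2]; split=> //.
by split; rewrite ?antiK_vz ?vz_pairing ?E1 ?E2 //= size_nseq.
Qed.

Let in_root x : is_root d x -> lst x \in rootl d.
Proof.
have <- : rootz (9 - d) = rootl d by case: d12 => ->; [exact: roots1E|exact: roots2E].
exact: rootzP.
Qed.

(** Multiplication by v carries the roots orthogonal to the first face injectively to roots
    orthogonal to the second; exchanging the roles gives equality. *)
Let orth_roots_le c c' v : basis_ok d c -> basis_ok d c' -> weyl d v ->
  (forall u, face (simple_part c) u <-> face (simple_part c') (u *m v)) ->
  (orth_roots d c <= orth_roots d c')%N.
Proof.
move=> ok ok' hv h; rewrite /orth_roots -!size_filter.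
set s := seq.filter _ _; set s' := seq.filter _ _.
rewrite -(size_map (fun a => lst (vz a *m v)) s); apply: uniq_leq_size.
  have us : uniq (rootl d) by rewrite -uniqzE; case/and5P: dok.
  rewrite map_inj_in_uniq ?filter_uniq //.
  move=> a b; rewrite !mem_filter => /andP[_ /root_in[sa _]] /andP[_ /root_in[sb _]].
  move/(can_inj (@lstK _))/(congr1 (mulmx^~ (invmx v))); rewrite !mulmxK ?weyl_unitmx //.
  exact: vz_inj.
move=> _ /mapP[a + ->]; rewrite !mem_filter => /andP[/allP ha /root_in[sa hr]].
have orth x e : is_root d x -> basis_ok d e ->
    all (fun b => Z.eqb (pairz (lst x) b) Z0) (zbasis e) <->
    (forall b, b \in zbasis e -> pairing x (vz b) = 0).
  move=> hx oke; rewrite -{2}[x]lstK; split=> [/allP H b be|H].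
    by rewrite vz_pairing ?size_lst //; have /Z.eqb_spec -> := H b be.
  apply/allP => b be; apply/Z.eqb_spec; have := H b be.
  by rewrite vz_pairing ?size_lst // => E; exact: (@zr_eq _ Z0 E).
rewrite in_root ?andbT; last exact: weyl_root.
apply/orth => //; first exact: weyl_root.
apply/(face_root _ ok') => u hu; rewrite weyl_adj //.
apply: (proj2 (face_root (vz a) ok)).
  by apply/orth => //; rewrite veczK //; apply/allP.
by apply/h; rewrite mulmxKV // weyl_unitmx.
Qed.

(** Two types of one group agree in rank, alpha and the number of roots orthogonal to the
    invariants, against the pairwise test in [data_ok]. The real field serves to compare the values
    of alpha. *)
Lemma type_unique (R : realType) G i j : G `<=` weyl d -> G !=set0 ->
  (forall g h, G g -> G h -> G (g *m h)) -> (i < N)%N -> (j < N)%N ->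
  type_of G i -> type_of G j -> i = j.
Proof.
move=> GW G0 GM; wlog lt_ij : i j / (i < j)%N.
  move=> H iN jN hi hj; have [lt|lt|//] := ltngtP i j; first exact: H.
  by apply/esym; apply: H.
move=> iN jN hi hj.
have [r1 a1] := type_alpha R GW G0 GM iN hi; have [r2 a2] := type_alpha R GW G0 GM jN hj.
have [w1 hw1 h1] := hi; have [w2 hw2 h2] := hj.
have rE : rk i = rk j by rewrite -r1 -r2.
have vE : qeqb (val i) (val j) by apply: (@qr_inj R); have := a1; rewrite a2 => -[].
have oE : orth_roots d (cd i) = orth_roots d (cd j).
  apply/eqP; rewrite eqn_leq; apply/andP; split.
    apply: (@orth_roots_le _ _ (invmx w1 *m w2)); rewrite ?datum_ok //.
      by apply: weylM => //; exact: weylV.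
    move=> u; rewrite mulmxA -h2 h1 mulmxKV // weyl_unitmx //.
  apply: (@orth_roots_le _ _ (invmx w2 *m w1)); rewrite ?datum_ok //.
    by apply: weylM => //; exact: weylV.
  move=> u; rewrite mulmxA -h1 h2 mulmxKV // weyl_unitmx //.
have /and5P := dok; case=> _ _ _ _ /(pairwiseP (0%N, (Qmake Z0 xH, 0%N))) /(_ i j).
rewrite !inE !size_zip size_ranks size_values size_map minnn minnn => /(_ iN jN lt_ij).
rewrite !nth_zip ?size_zip ?size_ranks ?size_values ?size_map ?minnn //; cbv [fst snd].
by rewrite rE eqxx vE !(nth_map datum0) // oE eqxx.
Qed.

Definition stabilizer (J : seq nat) : set M :=
  [set g | weyl d g /\ forall v, face J v -> v *m g = v].

Lemma stabilizer_subgroup J : weyl_subgroup (stabilizer J).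
Proof.
split=> [g []//||g h [hg fg] [hh fh]|g [hg fg]].
- by split=> [|v _]; [exact: weyl1|rewrite mulmx1].
- by split=> [|v hv]; [exact: weylM|rewrite mulmxA fg // fh].
- by split=> [|v hv]; [exact: weylV|rewrite -{1}(fg v hv) mulmxK // weyl_unitmx].
Qed.

(** The reflections in the simple roots of J belong to the stabilizer, and a vector fixed by such a
    reflection is orthogonal to its root. *)
Lemma invariants_stabilizer J u : {subset J <= iota 0 n} ->
  invariants (stabilizer J) u <-> face J u.
Proof.
move=> Jn; split=> [hu j jJ|hu g [_]]; last exact.
have jn : (j < n)%N by have := Jn j jJ; rewrite mem_iota.
have hr : is_root d (vz (nth [::] (simplez n) j)) := rb_root (root_base_d d12) (Ordinal jn).
have := hu (reflection (vz (nth [::] (simplez n) j))); rewrite mul_reflection.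
have S : stabilizer J (reflection (vz (nth [::] (simplez n) j))).
  split; first exact: weyl_reflection.
  by move=> v hv; rewrite mul_reflection /refl hv // scale0r addr0.
move=> /(_ S); rewrite /refl -[RHS]addr0 => /addrI.
move=> /(congr1 (fun x => pairing x (vz (nth [::] (simplez n) j)))).
by rewrite pairing0l pairingZl hr.2 => /eqP; rewrite mulf_eq0 orbF => /eqP.
Qed.

Lemma simple_part_sub i : (i < N)%N -> {subset simple_part (cd i) <= iota 0 n}.
Proof.
move=> iN j jI; have /and5P[_ _ _ /allP/(_ _ jI)] := datum_ok iN.
by rewrite mem_iota.
Qed.

Notation stab i := (stabilizer (simple_part (cd i))).

Lemma stabilizer_type i : (i < N)%N -> type_of (stab i) i.
Proof.
move=> iN; exists 1%:M => [|u]; first exact: weyl1.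
by rewrite mulmx1; apply/invariants_stabilizer/simple_part_sub.
Qed.

Lemma stabilizer_max i : (i < N)%N -> rho_maximal (stab i).
Proof.
move=> iN; split; first exact: stabilizer_subgroup.
by apply/seteqP; split=> g [hg h]; split=> // v hv; apply: h;
  apply/(invariants_stabilizer _ (simple_part_sub iN)).
Qed.

Let conj_set w G : set M := [set w *m g *m invmx w | g in G].

Lemma conj_setM w v G : w \in unitmx -> v \in unitmx ->
  conj_set w (conj_set v G) = conj_set (w *m v) G.
Proof.
move=> uw uv; have iE : invmx (w *m v) = invmx v *m invmx w.
  have u : w *m v \in unitmx by rewrite unitmx_mul uw.
  by apply: (can_inj (mulKmx u)); rewrite mulmxV // mulmxA mulmxK // mulmxV.
apply/seteqP; split=> g.
  by move=> [_ [h Gh <-] <-]; exists h => //; rewrite iE !mulmxA.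
move=> [h Gh <-]; exists (v *m h *m invmx v); first by exists h.
by rewrite iE !mulmxA.
Qed.

Lemma conj_set1 G : conj_set 1%:M G = G.
Proof.
have i1 : invmx (1%:M : M) = 1%:M.
  by rewrite -[LHS]mul1mx mulmxV // unitmx1.
by apply/seteqP; split=> g; [move=> [h Gh <-]|move=> Gg; exists g => //]; rewrite i1 mul1mx mulmx1.
Qed.

Lemma conjugates_conj w G : weyl d w -> conjugates (conj_set w G) = conjugates G.
Proof.
move=> hw; have uw := weyl_unitmx hw; apply/seteqP; split=> C [v hv <-].
  exists (v *m w); first exact: weylM.
  by rewrite -/(conj_set _ _) -conj_setM // weyl_unitmx.
exists (v *m invmx w); first exact/weylM/weylV.
rewrite -/(conj_set _ _) -/(conj_set _ _) conj_setM ?unitmx_mul ?unitmx_inv ?uw ?weyl_unitmx //.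
by rewrite mulmxKV.
Qed.

Lemma type_conj w G i : weyl d w -> type_of G i -> type_of (conj_set w G) i.
Proof.
move=> hw [v hv h]; exists (w *m v) => [|u]; first exact: weylM.
rewrite mulmxA -h; split=> hu g Gg.
  have := hu (w *m g *m invmx w); rewrite !mulmxA => /(_ (ex_intro2 _ _ g Gg _)).
  move=> /(_ (erefl _))/(congr1 (mulmx^~ w)).
  by rewrite mulmxKV // weyl_unitmx.
by case: Gg => g' Gg' <-; rewrite !mulmxA hu // mulmxK // weyl_unitmx.
Qed.

(** A rho-maximal group is recovered from its invariants as their stabilizer, so conjugate
    invariants give conjugate groups. *)
Lemma max_conj G i : (i < N)%N -> rho_maximal G -> type_of G i ->
  conjugates G = conjugates (stab i).
Proof.
move=> iN [_ GE] [w hw h]; have uw := weyl_unitmx hw.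
rewrite -(conjugates_conj (stab i) hw); congr conjugates.
rewrite GE; apply/seteqP; split=> g.
  move=> [hg fg]; exists (invmx w *m g *m w); last by rewrite !mulmxA mulmxV // mul1mx mulmxK.
  split; first exact/weylM/hw/weylM/hg/weylV.
  move=> v hv; rewrite !mulmxA fg ?mulmxKV //.
  by apply/h; rewrite mulmxKV.
move=> [g' [hg' fg'] <-]; split; first exact/weylM/weylV/hw/weylM.
by move=> v /h hv; rewrite !mulmxA fg' // mulmxK.
Qed.

Definition conj_class i : set (set M) := conjugates (stab i).

Lemma classes_image : rho_maximal_classes d = [set conj_class i | i in `I_N].
Proof.
apply/seteqP; split=> C.
  move=> [G hG <-]; have [i iN hi] := type_exists (let: conj (And4 GW _ _ _) _ := hG in GW).
  by exists i => //; exact: esym (max_conj iN hG hi).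
by move=> [i iN <-]; exists (stab i) => //; exact: stabilizer_max.
Qed.

Lemma conj_class_type i G : (i < N)%N -> conj_class i G -> type_of G i.
Proof. by move=> iN [w hw <-]; exact/type_conj/stabilizer_type. Qed.

Lemma conj_class_self i : conj_class i (stab i).
Proof. by exists 1%:M; [exact: weyl1|exact: conj_set1]. Qed.

Lemma conj_class_group i G : conj_class i G ->
  [/\ G `<=` weyl d, G !=set0 & forall g h, G g -> G h -> G (g *m h)].
Proof.
move=> [w hw <-]; have uw := weyl_unitmx hw; have [hW h1 hM _] := stabilizer_subgroup (simple_part (cd i)).
split.
- by move=> _ [g /hW hg <-]; apply: weylM (weylV hw); exact: weylM.
- by exists (w *m 1%:M *m invmx w), 1%:M.
- move=> _ _ [g Gg <-] [h Gh <-]; exists (g *m h); first exact: hM.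
  by rewrite !mulmxA mulmxKV.
Qed.

Lemma conj_class_inj (R : realType) i j : (i < N)%N -> (j < N)%N -> conj_class i = conj_class j -> i = j.
Proof.
move=> iN jN E; have [GW G0 GM] := conj_class_group (conj_class_self i).
apply: (@type_unique R (stab i)) => //; first exact: stabilizer_type.
by apply: conj_class_type => //; rewrite -E; exact: conj_class_self.
Qed.

Lemma card_classes (R : realType) (s : seq nat) : uniq s -> {subset s <= iota 0 N} ->
  ([set conj_class i | i in [set` s]] #= `I_(size s))%card.
Proof.
move=> us sN; have -> : [set conj_class i | i in [set` s]] = [set conj_class (nth 0%N s i) | i in `I_(size s)].
  apply/seteqP; split=> C [i].
    by move=> /(nthP 0%N)[k ks <-] <-; exists k.
  by move=> ks <-; exists (nth 0%N s i) => //; exact: mem_nth.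
apply: inj_card_eq => i j; rewrite !inE => /= si sj E.
have lt k : (k < size s)%N -> (nth 0%N s k < N)%N.
  by move=> ks; have := sN _ (mem_nth 0%N ks); rewrite mem_iota.
have := conj_class_inj R (lt _ si) (lt _ sj) E.
by move/eqP; rewrite nth_uniq // => /eqP.
Qed.

End Classes.

(** * Counting classes by rank and alpha *)

Local Open Scope card_scope.

Lemma qr_ratr (R : realType) p : qr R p = ratr (qr rat p).
Proof. by rewrite /qr fmorph_div /= !ratr_int. Qed.

Lemma alpha_listE (R : realType) d r : (d = 1 \/ d = 2)%N ->
  alpha_list R d r = [seq (qr R (nth (Qmake Z0 xH) (values d) i))%:E |
    i <- iota 0 (size (data d)) & nth 0%N (ranks d) i == r].
Proof.
move=> d12; rewrite /alpha_list; suff -> : alpha_values d r =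
    [seq qr rat (nth (Qmake Z0 xH) (values d) i) |
      i <- iota 0 (size (data d)) & nth 0%N (ranks d) i == r].
  by rewrite -map_comp; apply: eq_map => i /=; rewrite qr_ratr.
(* The ranks 0 to 9 are evaluated one at a time; from 10 on both lists are empty. *)
by apply/esym/eqP; case: d12 => ->; do 10?[case: r => [|r]]; vm_compute.
Qed.

Theorem mainTheorem4 (R : realType) :
  rho_maximal_classes 2 #= `I_32 /\
  rho_maximal_classes 1 #= `I_41 /\
  (forall (d : nat), (d = 1 \/ d = 2)%N ->
     forall (r : nat) (a : \bar R),
       [set C | rho_maximal_classes d C /\
                exists2 G, C G & picard_rank R G = r /\ alpha R G = a]
         #= `I_(count_mem a (alpha_list R d r))) /\
  (forall (d : nat), (d = 1 \/ d = 2)%N ->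
     forall (k : fieldType) (S : delPezzo R k d),
       inhabited (rational_point S) ->
       surface_alpha S \in alpha_list R d (surface_rank S)).
Proof.
have card_all d : (d = 1 \/ d = 2)%N -> rho_maximal_classes d #= `I_(size (data d)).
  move=> d12; rewrite classes_image //.
  have := @card_classes d d12 R (iota 0 (size (data d))) (iota_uniq _ _) (fun _ => id).
  rewrite size_iota (_ : [set` iota 0 _] = `I_(size (data d))) //.
  by apply/seteqP; split=> i; rewrite /= mem_iota.
split; first exact: card_all (or_intror (erefl 2%N)).
split; first exact: card_all (or_introl (erefl 1%N)).
split=> [d d12 r a|d d12 k S [x]].
  (* The indices of the classes with rank r and value a. Distinct indices give distinct classes, so
     counting them yields the multiplicity of a in the list. *)
  pose P i := (nth 0%N (ranks d) i == r) && ((qr R (nth (Qmake Z0 xH) (values d) i))%:E == a).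
  have -> : count_mem a (alpha_list R d r) = size (seq.filter P (iota 0 (size (data d)))).
    rewrite alpha_listE // count_map count_filter size_filter; apply: eq_count => i /=.
    by rewrite /P andbC.
  rewrite (_ : [set C | _] = [set @conj_class d i | i in [set` seq.filter P (iota 0 (size (data d)))]]).
    apply: card_classes => //; first by rewrite filter_uniq ?iota_uniq.
    by move=> i; rewrite mem_filter => /andP[].
  apply/seteqP; split=> C; rewrite classes_image //.
    move=> [[i iN <-] [G Gi [rG aG]]]; exists i => //=.
    rewrite mem_filter mem_iota iN andbT; have [GW G0 GM] := conj_class_group Gi.
    have [E1 E2] := type_alpha d12 R GW G0 GM iN (conj_class_type d12 iN Gi).
    by rewrite /P -E1 -E2 rG aG !eqxx.
  move=> [i /=]; rewrite mem_filter mem_iota => /andP[/andP[/eqP Er /eqP Ea] iN] <-.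
  split; first by exists i.
  exists (stabilizer (simple_part (nth datum0 (data d) i))); first exact: conj_class_self.
  have [GW G0 GM] := conj_class_group (conj_class_self d i).
  have [-> ->] := type_alpha d12 R GW G0 GM iN (stabilizer_type d12 iN).
  by rewrite Er Ea.
(* The Galois image may fail to be rho-maximal; it still has a type, because the type refers to its
   invariants only. *)
pose G := [set @galois_act _ _ _ S s | s in galois_group (kbar_emb S)].
have GW : G `<=` weyl d by move=> _ [s hs <-]; exact: galois_act_weyl.
have G0 : G !=set0.
  exists (@galois_act _ _ _ S id), id => //; split=> //; last by exists idfun.
  by exists id.
have px := inhabits x.
have hP := Pic_of_point px; have hC := effective_cone_of_point px.
have [i iN hi] := type_exists d12 GW.
have [-> ->] := type_surface d12 GW G0 iN hi hP hC.
rewrite alpha_listE //; apply: (map_f (fun i => (qr R (nth (Qmake Z0 xH) (values d) i))%:E)).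
by rewrite mem_filter eqxx mem_iota.
Qed.
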